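(* Let $Y$, $\mu$, $\Gamma$ be as in the context and let $\eta$ be a positive Radon measure on $\Gamma$ such that $(e_t)_\#\eta=\mu$ for every $t\in\mathbb{R}$. Assume that $\eta$ is Markov regular. Then the Markov hull $\mathfrak{M}(\eta)$ of $\eta$ is non-empty, and each element of $\mathfrak{M}(\eta)$ satisfies the strong Markov property.
   Context: Setting. $Y$ is a locally compact Polish space and $\mu$ is a positive Radon measure on $Y$. $C(\mathbb{R};Y)$ is the set of continuous maps $\mathbb{R}\to Y$ with the topology of uniform convergence on compacts. For $t\in\mathbb{R}$, $e_t(\gamma)=\gamma(t)$; for $h\in\mathbb{R}$, $b_h(\gamma)=\gamma(\cdot-h)$. $\Gamma\subset C(\mathbb{R};Y)$ is a locally compact Polish subspace such that: (i) for each compact interval $I\subset\mathbb{R}$ and compact $K\subset Y$, the set $\{\gamma\in\Gamma:\gamma(t)\in K\text{ for some }t\in I\}$ is compact in $\Gamma$; (ii) $b_h(\Gamma)=\Gamma$ for every $h\in\mathbb{R}$. Measures. $\mathcal{M}(\Gamma)$ is the set of positive Radon measures on $\Gamma$ with the vague (weak-star) topology (coarsest topology making $\nu\mapsto\int\Phi\,d\nu$ continuous for all $\Phi\in C_c(\Gamma)$); $\mathcal{P}(\Gamma)\subset\mathcal{M}(\Gamma)$ is the set of probability measures, with the induced topology (and the uniformity given by the pseudometrics $|\int\Phi\,d\nu^1-\int\Phi\,d\nu^2|$, $\Phi\in C_c(\Gamma)$). $\mathcal{M}_\mu(\Gamma)$ is the set of $\eta\in\mathcal{M}(\Gamma)$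 with $(e_t)_\#\eta=\mu$ for all $t\in\mathbb{R}$. A disintegration of $\eta\in\mathcal{M}_\mu(\Gamma)$ with respect to $e_t$ and $\mu$ is a Borel family $\{\eta_{t,x}\}_{x\in\operatorname{supp}\mu}\subset\mathcal{P}(\Gamma)$ with $\eta_{t,x}(\{\gamma:\gamma(t)=x\})=1$ for every $x$ and $\eta=\int\eta_{t,x}\,\mu(dx)$; it is unique up to $\mu$-null sets of $x$. Markovianisation. For an interval $I$, $\Gamma\lfloor_I$ is the set of restrictions to $I$ of elements of $\Gamma$, with the final topology for the restriction map $r^I:\Gamma\to\Gamma\lfloor_I$; for $\nu\in\mathcal{P}(\Gamma)$, $\nu^I:=(r^I)_\#\nu$. If $\nu_1,\nu_2$ are Borel probability measures on $\Gamma\lfloor_{(-\infty,t]}$ and $\Gamma\lfloor_{[t,+\infty)}$, each concentrated on paths with value $x$ at time $t$, then $\nu_1\otimes_{(t,x)}\nu_2$ is the unique Borel probability measure on $\Gamma$ whose pushforward under $\gamma\mapsto(\gamma\lfloor_{(-\infty,t]},\gamma\lfloor_{[t,+\infty)})$ is $\nu_1\times\nu_2$. For $\eta\in\mathcal{M}_\mu(\Gamma)$, $$M_t(\eta)=\int_Y\eta_{t,x}^{(-\infty,t]}\otimes_{(t,x)}\eta_{t,x}^{[t,+\infty)}\,\mu(dx)\in\mathcal{M}_\mu(\Gamma).$$ For a finite set $F=\{t_1,\dots,t_n\}\subset\mathbb{R}$, $M_F(\eta)=(M_{t_n}\circ\cdots\circ M_{t_1})(\eta)$, which does not depend on the ordering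 of $F$. $\mathcal{X}_\mu$ is the set of families $\{\nu_x\}_{x\in\operatorname{supp}\mu}\subset\mathcal{P}(\Gamma)$ such that $x\mapsto\nu_x$ is continuous on $\operatorname{supp}\mu$ and there exists $t\in\mathbb{R}$ such that $\operatorname{supp}\nu_x\subset\{\gamma:\gamma(t)=x\}$ for every $x\in\operatorname{supp}\mu$; it carries the topology of uniform convergence on compact subsets of $\operatorname{supp}\mu$ of maps into $\mathcal{P}(\Gamma)$. Markov regular. $\eta\in\mathcal{M}_\mu(\Gamma)$ is Markov regular if for every compact $I\subset\mathbb{R}$ there is a compact $K\subset\mathcal{X}_\mu$ such that for every finite $F\subset\mathbb{R}$ and every $t\in I$ there is a disintegration of $M_F(\eta)$ with respect to $e_t$ and $\mu$ belonging to $K$. Markov hull. For $D\subset\mathbb{R}$ countable and dense, a set ordering of $D$ is a sequence $(D_N)_{N\ge1}$ of subsets of $D$ with $D_N$ having exactly $N$ elements and $D_N\subset D_{N+1}$ for every $N$. The Markov $D$-hull $\mathfrak{M}_D(\eta)$ is the set of all $\bar\eta\in\mathcal{M}_\mu(\Gamma)$ that are vague accumulation points of the sequence $(M_{D_N}(\eta))_N$ for some set ordering $(D_N)$ of $D$. The Markov hull is $\mathfrak{M}(\eta)=\bigcup_D\mathfrak{M}_D(\eta)$ over all countable dense $D\subset\mathbb{R}$. Strong Markov property. $\eta\in\mathcal{M}_\mu(\Gamma)$ satisfies the Markov property if $M_t(\eta)=\eta$ for every $t\in\mathbb{R}$. It satisfies the strong Markov property if moreover for every $t\in\mathbb{R}$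 there is a disintegration $\{\eta_{t,x}\}_{x\in\operatorname{supp}\mu}$ of $\eta$ with respect to $e_t$ and $\mu$ which belongs to $\mathcal{X}_\mu$ and satisfies $\eta_{t,x}^{(-\infty,t]}\otimes_{(t,x)}\eta_{t,x}^{[t,+\infty)}=\eta_{t,x}$ for every $x\in\operatorname{supp}\mu$.
   Formalization: A set ordering of D is additionally required to exhaust D (the union of the D_N is D); otherwise the D_N could stay inside, say, [0,1], and accumulation points need not be Markov at times outside it. Γ is taken non-empty. *)

(* Defs.v *)
Set Warnings "-notation-overridden,-ambiguous-paths,-notation-incompatible-prefix,-redundant-canonical-projection".
From HB Require Import structures.
From mathcomp Require Import all_boot all_order all_algebra.
From mathcomp Require Import all_classical all_reals all_analysis.
From mathcomp Require Import measurable_realfun.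
Import Order.TTheory GRing.Theory Num.Theory.
Import numFieldTopology.Exports.
Set Implicit Arguments.
Unset Strict Implicit.
Unset Printing Implicit Defensive.
Local Open Scope classical_set_scope.
Local Open Scope ring_scope.

Definition separable (T : topologicalType) : Prop :=
  exists2 D : set T, countable D & dense D.

Definition completely_metrizable (R : realType) (T : topologicalType) : Prop :=
  exists (M : metricType R) (f : T -> M) (g : M -> T),
    [/\ cancel f g, cancel g f, continuous f, continuous g &
     forall F : set_system M, ProperFilter F -> cauchy F ->
       exists x : M, F --> x].

Definition locally_compact_polish (R : realType) (T : topologicalType) : Prop :=
  [/\ separable T, completely_metrizable R T & locally_compact [set: T]].

(* Measurable types of the library are inhabited, hence the base points below. *)
Definition borel (T : ptopologicalType) := g_sigma_algebraType (@open T).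

(* A measure of the library is a function on all subsets of [T], of which only
   the values on Borel sets are meaningful: two measures are compared on Borel
   sets only, never with Leibniz equality. *)
Definition is_radon (R : realType) (T : ptopologicalType)
    (m : {measure set (borel T) -> \bar R}) : Prop :=
  (forall K : set T, compact K -> (m K < +oo)%E) /\
  (forall A : set (borel T), measurable A ->
    m A = ereal_sup [set m K | K in [set K : set T | compact K /\ K `<=` A]]).

Record radon (R : realType) (T : ptopologicalType) := Radon {
  radon_measure :> {measure set (borel T) -> \bar R} ;
  radonP : is_radon radon_measure }.

Record Cc (R : realType) (T : ptopologicalType) := MkCc {
  Cc_fun :> T -> R ;
  Cc_continuous : continuous Cc_fun ;
  Cc_compact : compact (closure [set x | Cc_fun x != 0]) }.

Definition vague_eval (R : realType) (T : ptopologicalType) (m : radon R T) :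
    {ptws Cc R T -> R} :=
  fun Phi => \int[m]_x (Phi : borel T -> R) x.

(* The initial uniformity for [vague_eval] is the one given by the pseudometrics
   |int Phi dm1 - int Phi dm2|, Phi in C_c(T). *)
HB.instance Definition _ (R : realType) (T : ptopologicalType) :=
  gen_eqMixin (radon R T).
HB.instance Definition _ (R : realType) (T : ptopologicalType) :=
  gen_choiceMixin (radon R T).
HB.instance Definition _ (R : realType) (T : ptopologicalType) :=
  Uniform.copy (radon R T) (initial_topology (@vague_eval R T)).

(* The subspace topology and uniformity are those of [set_type]. *)
Definition prob (R : realType) (T : ptopologicalType) :=
  set_type [set m : radon R T | m [set: T] = 1%E].

Definition prob_measure (R : realType) (T : ptopologicalType) (m : prob R T) :
  {measure set (borel T) -> \bar R} := \val m.

HB.instance Definition _ (R : realType) (T : ptopologicalType) :=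
  Uniform.on (prob R T).

Definition supp (R : realType) (T : ptopologicalType)
    (m : {measure set (borel T) -> \bar R}) : set T :=
  [set x | forall U : set T, open U -> U x -> (0 < m U)%E].

Section paths.
Variables (R : realType) (Y : puniformType).
Variables (Gamma : set {family compact, R -> Y}) (g0 : Gamma).

(* [Y] has any uniform structure compatible with its Polish topology: the trace
   of the topology of {family compact, R -> Y} on continuous functions does not
   depend on it. The base point [g0] only serves the pointed structure. *)
Definition path_space : Type := let _ := g0 in Gamma.
HB.instance Definition _ := Uniform.copy path_space (set_type Gamma).
HB.instance Definition _ := isPointed.Build path_space g0.

Definition path_fun (g : path_space) : R -> Y := \val g.

Definition ev (t : R) (g : path_space) : Y := path_fun g t.

Definition restrictions (I : set R) : set (I -> Y) :=
  range (fun g : path_space => sigL I (path_fun g)).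

Definition restr_space (I : set R) : Type := @restrictions I.

Definition restr (I : set R) (g : path_space) : restr_space I :=
  SigSub (mem_set (imageT (fun h => sigL I (path_fun h)) g : @restrictions I _)).

Section final_topology.
Variable I : set R.
Definition restr_open : set_system (restr_space I) :=
  [set U | open (@restr I @^-1` U)].
Let restr_openT : restr_open setT.
Proof. by rewrite /restr_open /= preimage_setT; exact: openT. Qed.
Let restr_openI : setI_closed restr_open.
Proof.
by move=> A B oA oB; rewrite /restr_open /= preimage_setI; exact: openI.
Qed.
Let restr_open_bigU (J : Type) (f : J -> set (restr_space I)) :
  (forall i, restr_open (f i)) -> restr_open (\bigcup_i f i).
Proof.
move=> of_; rewrite /restr_open /= preimage_bigcup.
by apply: bigcup_open => i _; exact: of_.
Qed.
HB.instance Definition _ := gen_eqMixin (restr_space I).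
HB.instance Definition _ := gen_choiceMixin (restr_space I).
HB.instance Definition _ :=
  isOpenTopological.Build (restr_space I) restr_openT restr_openI restr_open_bigU.
HB.instance Definition _ := isPointed.Build (restr_space I) (@restr I point).
End final_topology.

Definition restr_law (I : set R) (m : prob R path_space) :
    set (borel (restr_space I)) -> \bar R :=
  pushforward (prob_measure m) (@restr I : borel path_space -> borel (restr_space I)).

Definition through (I : set R) (t : R) (x : Y) : set (restr_space I) :=
  [set f | exists s : I, \val s = t /\ (\val f) s = x].

(* m1 (x)_{(t, x)} m2 = m. Such an [m] is unique on Borel sets, but it may fail
   to exist when [Gamma] is not stable under concatenation of paths: the partial
   operation is given by its graph, and so are M_t and M_F below. *)
Definition is_concat (t : R) (x : Y)
    (m1 : set (borel (restr_space `]-oo, t])) -> \bar R)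
    (m2 : set (borel (restr_space `[t, +oo[)) -> \bar R)
    (m : prob R path_space) : Prop :=
  [/\ m1 (through t x) = 1%E, m2 (through t x) = 1%E &
   forall A : set (borel (restr_space `]-oo, t]) * borel (restr_space `[t, +oo[)),
     measurable A ->
     pushforward (prob_measure m)
       (fun g : borel path_space =>
          (@restr `]-oo, t] g, @restr `[t, +oo[ g)
          : borel (restr_space `]-oo, t]) * borel (restr_space `[t, +oo[)) A
     = (m1 \x m2)%E A].

(* m^{(-oo, t]} (x)_{(t, x)} m^{[t, +oo)} = m' *)
Definition is_decoupling (t : R) (x : Y) (m m' : prob R path_space) : Prop :=
  is_concat x (@restr_law `]-oo, t] m) (@restr_law `[t, +oo[ m) m'.

Variable mu : radon R Y.

Definition has_marginals : set (radon R path_space) :=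
  [set eta | forall (t : R) (B : set (borel Y)), measurable B ->
     pushforward eta (ev t : borel path_space -> borel Y) B = mu B].

Definition prob_family : Type := {family compact, supp mu -> prob R path_space}.
HB.instance Definition _ := Uniform.on prob_family.

(* x |-> nu_x(B), extended by 0 outside the support of mu *)
Definition mass (nu : prob_family) (B : set (borel path_space)) : borel Y -> \bar R :=
  valL_ (0%E : \bar R) (fun x : supp mu => prob_measure (nu x) B).

Definition borel_family (nu : prob_family) : Prop :=
  forall B : set (borel path_space), measurable B ->
    measurable_fun (supp mu : set (borel Y)) (mass nu B).

(* eta = int nu_x mu(dx) *)
Definition is_mixture (nu : prob_family) (eta : radon R path_space) : Prop :=
  borel_family nu /\
  forall B : set (borel path_space), measurable B ->
    eta B = (\int[mu]_x mass nu B x)%E.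

Definition disintegration (eta : radon R path_space) (t : R) (nu : prob_family) : Prop :=
  (forall x : supp mu, prob_measure (nu x) [set g | ev t g = \val x] = 1%E) /\
  is_mixture nu eta.

(* M_t(eta) = eta' *)
Definition markovianisation (t : R) (eta eta' : radon R path_space) : Prop :=
  exists nu nu' : prob_family,
    [/\ disintegration eta t nu,
     forall x : supp mu, is_decoupling t (\val x) (nu x) (nu' x) &
     is_mixture nu' eta'].

(* (M_{t_n} o ... o M_{t_1})(eta) = eta' for s = [:: t_1; ...; t_n] *)
Fixpoint markovianisations (s : seq R) (eta eta' : radon R path_space) : Prop :=
  match s with
  | [::] => eta' = eta
  | t :: s' => exists2 eta1, markovianisation t eta eta1 &
                 markovianisations s' eta1 eta'
  end.

Definition finite_markovianisation (F : set R)
    (eta eta' : radon R path_space) : Prop :=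
  exists s : seq R, [/\ uniq s, [set` s] = F & markovianisations s eta eta'].

Definition Xmu : set prob_family :=
  [set nu | continuous (nu : supp mu -> prob R path_space) /\
    exists t : R, forall x : supp mu,
      supp (prob_measure (nu x)) `<=` [set g | ev t g = \val x]].

Definition markov_regular (eta : radon R path_space) : Prop :=
  forall I : set R, compact I ->
    exists K : set prob_family, [/\ compact K, K `<=` Xmu &
      forall (F : set R) (t : R), finite_set F -> I t ->
        exists etaF nu, [/\ finite_markovianisation F eta etaF,
          disintegration etaF t nu & K nu]].

(* The sequence starts at N = 1. It exhausts [D]: the union of the [DN] would
   otherwise be an arbitrary infinite subset of [D], possibly not dense. *)
Definition set_ordering (D : set R) (DN : nat -> set R) : Prop :=
  (forall N, (0 < N)%N ->
     [/\ DN N `<=` D, (DN N #= `I_N)%card & DN N `<=` DN N.+1]) /\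
  D `<=` \bigcup_(N in [set N | (0 < N)%N]) DN N.

Definition markov_D_hull (D : set R) (eta : radon R path_space) :
    set (radon R path_space) :=
  [set etab | has_marginals etab /\
    exists (DN : nat -> set R) (etaN : nat -> radon R path_space),
      [/\ set_ordering D DN,
       forall N, (0 < N)%N -> finite_markovianisation (DN N) eta (etaN N) &
       cluster (etaN @ \oo) etab]].

Definition markov_hull (eta : radon R path_space) : set (radon R path_space) :=
  \bigcup_(D in [set D : set R | countable D /\ dense D]) markov_D_hull D eta.

Definition markov_property (eta : radon R path_space) : Prop :=
  forall t : R, markovianisation t eta eta.

Definition strong_markov (eta : radon R path_space) : Prop :=
  markov_property eta /\
  forall t : R, exists nu : prob_family,
    [/\ disintegration eta t nu, Xmu nu &
     forall x : supp mu, is_decoupling t (\val x) (nu x) (nu x)].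

End paths.

(* Main.v *)
(* Testing measures on cylinders g |-> prod_i phi_i(g(t_i)), M_F(eta) is
   characterized by two properties which do not depend on an ordering of F: it
   agrees with eta on cylinders whose times are separated by no element of F, and
   it is Markov at the times of F. Cylinders determine the Borel sets of Gamma
   and, through times dense in (-oo,t] or [t,+oo), those of the spaces of
   restrictions.
   If nu_j -> nu in X_mu, where nu_j disintegrates eta_j at time t_j -> t, then nu
   is concentrated on {g(t) = x}, and eta_j converges vaguely to the mixture of nu:
   on compact sets of paths g(t_j) is uniformly close to g(t), and nu_j converges
   uniformly on compact sets of supp mu. If moreover eta_j is Markov at t_j, then
   nu_x decouples cylinders with times < t from those with times > t: for j large
   these times are on the right sides of t_j, and continuity of nu turns the
   equality for mu-almost every x into an equality for every x in supp mu.
   Markov regularity provides, by compactness, such limits: for M_{D_N}(eta) at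
   t_N = 0 this gives an element of the hull; for an element of the hull, taking
   t_N in D_N with t_N -> t gives the decoupled disintegration at time t. *)
Require Import Defs.
From HB Require Import structures.
From mathcomp Require Import all_boot all_order all_algebra.
From mathcomp Require Import all_classical all_reals all_analysis.
From mathcomp Require Import measurable_realfun finmap lra ring.
Import Order.TTheory GRing.Theory Num.Theory.
Import numFieldTopology.Exports.
Set Implicit Arguments.
Unset Strict Implicit.
Unset Printing Implicit Defensive.
Local Open Scope classical_set_scope.
Local Open Scope ring_scope.

(** * Compactly supported functions on locally compact Polish spaces *)

Section topology.
Variable R : realType.

(** Disintegration and markovianisation are relations, and measures are determined on Borel sets
    only. The measure that Markov regularity provides for a finite set of times therefore need not
    be the term of the sequence defining the hull; uniqueness of finite markovianisations on Borel
    sets identifies the two, and this is where independence of the order enters. Two calculi of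
    cylinders coexist. Factors with values in [0,+oo] are stable under conditional expectation and
    need no integrability: they serve the algebra of markovianisations. Factors in C_c(Y) give
    functions in C_c(Gamma), which the vague topology can see: they serve the limits. The constant 1
    need not be in C_c(Gamma), hence the nonempty lists of times and the cutoffs psi(g(t)). The
    spaces of measures and of families are used without a metric, so finer ultrafilters replace
    subsequences. Dominated convergence is confined to sequences of functions under a fixed measure;
    along filters, uniform convergence on compact sets takes its place. The limit measure is
    constructed as a mixture, which must be shown to be inner regular before it counts as a Radon
    measure. *)

Lemma metrizable_dist (T : topologicalType) : completely_metrizable R T ->
  exists d : T -> T -> R,
  [/\ forall x e, 0 < e -> nbhs x [set y | d x y < e],
      forall x (U : set T), nbhs x U -> exists2 e, 0 < e & [set y | d x y < e] `<=` U,
      forall x y, d x y = d y x, forall x y z, d x z <= d x y + d y z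
    & forall x y, d x y = 0 -> x = y].
Proof.
move=> [M [f [g [fK gK cf cg _]]]]; exists (fun x y => mdist (f x) (f y)); split.
- move=> x e e0.
  have : nbhs (f x) (ball (f x) e) by exact: nbhsx_ballx.
  by move=> /cf; rewrite ballEmdist.
- move=> x U; rewrite -{1}(fK x) => /cg /nbhs_ballP [e /= e0 eU].
  exists e => // y /= xy; rewrite -(fK y); apply: eU.
  by rewrite ballEmdist.
- by move=> x y; rewrite metric_sym.
- by move=> x y z; exact: metric_triangle.
- by move=> x y /mdist_positivity /(can_inj fK).
Qed.

Lemma metrizable_hausdorff (T : topologicalType) :
  completely_metrizable R T -> hausdorff_space T.
Proof.
move=> /metrizable_dist[d [dn _ dC dD d0]] x y xy; apply: d0.
apply/eqP/negPn/negP => dxy0.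
have d_ge0 u v : 0 <= d u v.
  have duu : 0 <= d u u by have := dD u u u; rewrite -subr_ge0 addrK.
  by have := le_trans duu (dD u v u); rewrite (dC v u) -mulr2n pmulrn_lge0.
have d_gt0 : 0 < d x y / 2 by rewrite divr_gt0// lt_neqAle eq_sym dxy0 d_ge0.
have [z [/= xz yz]] := xy _ _ (dn x _ d_gt0) (dn y _ d_gt0).
have := dD x z y; rewrite (dC z y) leNgt => /negP; apply.
by rewrite (splitr (d x y)) ltrD.
Qed.

(** Serves to approximate the indicator of a compact set by functions in C_c, and an open set from
    inside by closed sets. [V n] collects interiors of balls of radius 1/(n+1) about the points of
    [C]; interiors, because the balls are only known to be neighbourhoods. *)
Lemma metrizable_closed_Gdelta (T : topologicalType) (C : set T) :
  completely_metrizable R T -> closed C ->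
  exists V : nat -> set T, [/\ forall n, open (V n),
    forall n, V n.+1 `<=` V n & C = \bigcap_n V n].
Proof.
move=> /metrizable_dist[d [dn dU dC dD _]] clC.
pose V n := \bigcup_(c in C) interior [set y | d c y < n.+1%:R^-1].
have inv_gt0 n : 0 < n.+1%:R^-1 :> R by rewrite invr_gt0.
exists V; split.
- by move=> n; apply: bigcup_open => c _; exact: open_interior.
- move=> n y [c Cc cy]; exists c => //; apply: filterS cy => z /= /lt_trans; apply.
  by rewrite ltf_pV2 ?posrE// ltr_nat.
- apply/seteqP; split.
    move=> c Cc n _; exists c => //=.
    by rewrite /interior; exact: dn.
  move=> y Vy; rewrite -[C]setCK => nCy.
  have : nbhs y (~` C) by apply: open_nbhs_nbhs; split => //; exact: closed_openC.
  move=> /dU[e e0 eC].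
  have [n _ /(_ n (leqnn n)) ne] := near_infty_natSinv_lt (PosNum e0).
  have [c Cc /interior_subset /= cy] := Vy n I.
  by apply: (eC c) => //=; rewrite dC (lt_trans cy)// .
Qed.

(** The closed balls with centre in the dense set, radius 1/(n+1) and compact closure are countably
    many. They cover: if a closed compact neighbourhood of [y] contains its ball of radius [e], a
    centre near [y] and a radius below [e]/2 keep the closed ball inside that neighbourhood. *)
Lemma sigma_compact (T : topologicalType) : locally_compact_polish R T ->
  exists L : nat -> set T, [/\ forall n, compact (L n),
    forall n, L n `<=` L n.+1 & \bigcup_n L n = setT].
Proof.
move=> [[D cD dD] cm lc]; have hT := metrizable_hausdorff cm.
have [d [dn dU dC dtri _]] := metrizable_dist cm.
have inv_gt0 n : 0 < n.+1%:R^-1 :> R by rewrite invr_gt0.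
pose B (p : T * nat) := closure [set y | d p.1 y < p.2.+1%:R^-1].
pose Ix := [set p : T * nat | D p.1 /\ compact (B p)].
have cIx : countable Ix.
  apply: (@sub_countable _ _ _ (D `*` [set: nat])).
    by apply: subset_card_le => -[x n] [].
  by apply: countableX => //; exact: countableP.
have cov y : exists2 p, Ix p & B p y.
  have [/= U Uy [cU clU]] : exists2 U, nbhs y U & compact U /\ closed U.
    by have := lc y I; rewrite withinET.
  have [e e0 eU] := dU _ _ Uy.
  have [n _ /(_ n (leqnn n)) ne] := near_infty_natSinv_lt (PosNum (divr_gt0 e0 (ltr0n R 2))).
  have [x [/interior_subset /= yx Dx]] : interior [set z | d y z < n.+1%:R^-1] `&` D !=set0.
    by apply: dD; [exists y; exact: dn|exact: open_interior].
  exists (x, n); last by apply: subset_closure => /=; rewrite dC.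
  split => //=; apply: (subclosed_compact _ cU); first exact: closed_closure.
  rewrite (closure_id U).1//; apply: closureS => z /= xz; apply: eU => /=.
  apply: le_lt_trans (dtri y x z) _.
  by rewrite (splitr e) ltrD// (lt_trans _ ne).
have /pfcard_geP[Ix0|[f]] := cIx.
  exists (fun=> set0); split; first by move=> _; exact: compact0.
    by move=> n; exact: subset_refl.
  by rewrite -subTset => y _; have [p] := cov y; rewrite Ix0.
exists (fun n => \big[setU/set0]_(i < n) B (f i)); split.
- move=> n; apply: bigsetU_compact => i _.
  by have [] : Ix (f i) by apply: funS.
- by move=> n; rewrite big_ord_recr/=; exact: subsetUl.
- rewrite -subTset => y _; have [p Ixp By] := cov y.
  have [i _ fip] := @surj _ _ _ _ f _ Ixp.
  exists i.+1 => //; rewrite big_ord_recr/=; right.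
  by rewrite fip.
Qed.

End topology.

Section cutoff.
Variables (R : realType) (Y : puniformType).
Hypothesis polishY : locally_compact_polish R Y.

(** Near each point of [K], all sufficiently large compact sets [C] contain the nearby points in
    their interior; the near-covering form of compactness makes [C] uniform over [K], in place of a
    finite union of neighbourhoods. *)
Lemma compact_relatively_compact_nbhs (K : set Y) : compact K ->
  exists2 C : set Y, compact C & K `<=` interior C.
Proof.
move=> cK; have [_ _ lc] := polishY.
(* the filter generated by the sets [C | C0 `<=` C], for [C0] compact *)
pose F : set_system (set Y) :=
  [set P | exists2 C0, compact C0 & forall C, compact C -> C0 `<=` C -> P C].
have FF : Filter F.
  split.
  - by exists set0 => //; exact: compact0.
  - move=> P Q [C0 cC0 C0P] [C1 cC1 C1Q]; exists (C0 `|` C1); first exact: compactU.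
    by move=> C cC; rewrite subUset => -[? ?]; split; [exact: C0P|exact: C1Q].
  - by move=> P Q PQ [C0 cC0 C0P]; exists C0 => // C cC CC; exact/PQ/C0P.
have /compact_near_coveringP cover := cK.
have [x Kx|C0 cC0 C0P] := cover _ F (fun C x => interior C x) FF.
  have := lc x I; rewrite withinET => -[U xU [cU _]].
  exists (interior U, [set C | compact C /\ U `<=` C]) => /=.
    split; first exact: nbhs_interior.
    by exists U.
  by move=> -[y C] /= [Uy [_ UC]]; exact: interiorS Uy.
by exists C0 => //; exact: C0P.
Qed.

(** Working in [W], the trace of [V] on a relatively compact neighbourhood of [K], forces the
    support to be compact. Compactness of [K] yields one entourage that keeps the neighbourhood of
    every point of [K] inside [W], that is, a uniform separation of [K] from the complement of
    [W]. *)
Lemma Cc_urysohn (K V : set Y) : compact K -> open V -> K `<=` V ->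
  exists phi : Cc R Y, [/\ forall y, 0 <= phi y <= 1,
    forall y, K y -> phi y = 1 & forall y, ~ V y -> phi y = 0].
Proof.
move=> cK oV KV; have [C cC KC] := compact_relatively_compact_nbhs cK.
have hY : hausdorff_space Y by have [_ /metrizable_hausdorff] := polishY.
pose W := V `&` interior C.
have oW : open W by apply: openI => //; exact: open_interior.
have KW : K `<=` W by move=> y Ky; split; [exact: KV|exact: KC].
pose F : set_system (set (Y * Y)) :=
  [set P | exists2 E0, entourage E0 & forall E, entourage E -> E `<=` E0 -> P E].
have FF : Filter F.
  split.
  - by exists setT => //; exact: filterT.
  - move=> P Q [A eA AP] [B eB BQ]; exists (A `&` B); first exact: filterI.
    by move=> E eE; rewrite subsetI => -[? ?]; split; [exact: AP|exact: BQ].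
  - by move=> P Q PQ [A eA AP]; exists A => // E eE EA; exact/PQ/AP.
have /compact_near_coveringP cover := cK.
have [x Kx|E eE EP] :=
    cover _ F (fun E x => forall y, E (x, y) -> W y) FF.
  have : nbhs x W by apply: open_nbhs_nbhs; split => //; exact: KW.
  rewrite -nbhs_entourageE => -[E eE EW].
  exists (xsection (split_ent E) x, [set D | D `<=` split_ent E]) => /=.
    split; first by apply: nbhs_entourage; exact: entourage_split_ent.
    by exists (split_ent E) => //; exact: entourage_split_ent.
  move=> -[y D] /= [/xsectionP xy DE] z /DE yz; apply: EW; apply/xsectionP.
  by apply: entourage_split xy yz.
have : uniform_separator (~` W) K.
  exists (Uniform.class Y), [set xy | E (xy.2, xy.1)]; split.
  - exact: entourage_inv.
  - rewrite -subset0 => -[a b] [/= [nWa Kb] ba]; apply: nWa.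
    by apply: (EP _ eE (@subset_refl _ _) b Kb).
  - by move=> x; exact: subset_refl.
move=> /(@uniform_separatorP _ R)[f [cf f01 f0 f1]].
have fC : [set y | f y != 0] `<=` C.
  move=> y /= fy0; apply: contrapT => nCy; move/eqP: fy0; apply.
  by apply: f0; exists y => // -[_ /interior_subset].
have cC' : compact (closure [set y | f y != 0]).
  apply: (subclosed_compact _ cC); first exact: closed_closure.
  by have /closure_id -> := compact_closed hY cC; exact: closureS.
exists (MkCc cf cC'); split => /=.
- move=> y; have : range f (f y) by exists y.
  by move=> /f01; rewrite /= in_itv.
- by move=> y Ky; apply: f1; exists y.
- by move=> y nVy; apply: f0; exists y => // -[].
Qed.

(** [V n] decreases to [K], so that outside [K] the sequence [phi] is eventually 0. The function
    [chi] dominates all the [phi n] at once, as dominated convergence demands. *)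
Lemma Cc_approx (K : set Y) : compact K ->
  exists (phi : nat -> Cc R Y) (chi : Cc R Y),
  [/\ forall n y, 0 <= phi n y <= chi y, forall y, 0 <= chi y <= 1 &
      forall y, phi n y @[n --> \oo] --> (\1_K y : R)].
Proof.
move=> cK; have [_ cm _] := polishY; have hY := metrizable_hausdorff cm.
have [V [oV dV KV]] := metrizable_closed_Gdelta cm (compact_closed hY cK).
have [C cC KC] := compact_relatively_compact_nbhs cK.
have [chi [chi01 chi1 _]] := Cc_urysohn cC openT (@subsetT _ _).
have /choice[phi phiP] n : exists phi : Cc R Y, [/\ forall y, 0 <= phi y <= 1,
    forall y, K y -> phi y = 1 & forall y, ~ (V n `&` interior C) y -> phi y = 0].
  apply: Cc_urysohn => //.
    by apply: openI => //; exact: open_interior.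
  by move=> y Ky; split; [move: Ky; rewrite KV; exact|exact: KC].
exists phi, chi; split => //.
- move=> n y; have [p01 _ p0] := phiP n.
  have [Cy|nCy] := pselect (C y).
    by rewrite (chi1 y Cy) p01.
  rewrite p0 ?lexx; first by have /andP[] := chi01 y.
  by move=> [_ /interior_subset].
- move=> y; have [Ky|nKy] := pselect (K y).
    rewrite indicE mem_set//= (_ : (fun n => _) = cst 1); first exact: cvg_cst.
    by apply/funext => n; have [_ /(_ y Ky)] := phiP n.
  rewrite indicE memNset//=.
  have [n nVy] : exists n, ~ V n y.
    apply: contrapT => VV; apply: nKy; rewrite KV => n _.
    by apply: contrapT => nV; apply: VV; exists n.
  apply: cvg_near_cst; exists n => // m /= nm.
  have [_ _ ->//] := phiP m.
  move=> [Vmy _]; apply: nVy; elim: m nm Vmy => [|m ih]; first by rewrite leqn0 => /eqP ->.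
  by rewrite leq_eqVlt => /predU1P[->//|/ih]; move=> h /dV /h.
Qed.

End cutoff.

Section borel_sets.
Variable R : realType.
Implicit Types T U : ptopologicalType.

Lemma borel_open T (A : set (borel T)) : open (A : set T) -> measurable A.
Proof. exact: sub_sigma_algebra. Qed.

Lemma borel_closed T (A : set (borel T)) : closed (A : set T) -> measurable A.
Proof.
by move=> cA; rewrite -[A]setCK; apply: measurableC; apply: borel_open; exact: closed_openC.
Qed.

Lemma continuous_borel T U (f : T -> U) : continuous f ->
  measurable_fun setT (f : borel T -> borel U).
Proof.
move=> /continuousP cf; apply: (@measurability _ _ (borel T) (borel U) _ _ open) => //.
by move=> _ [B oB <-]; rewrite setTI; apply: borel_open; exact: cf.
Qed.

Lemma continuous_borel_real T (f : T -> R) : continuous f ->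
  measurable_fun setT (f : borel T -> R).
Proof.
move=> /continuousP cf; apply: (measurability _ (RGenOpens.measurableE R)).
move=> _ [_ [a [b ->] <-]]; rewrite setTI; apply: borel_open.
exact/cf/interval_open.
Qed.

Lemma Cc_measurable T (Phi : Cc R T) :
  measurable_fun setT (EFin \o Phi : borel T -> \bar R).
Proof.
apply/measurable_EFinP; apply: (@continuous_borel_real T Phi).
exact: Cc_continuous.
Qed.

Lemma Cc_bounded T (Phi : Cc R T) : exists c, forall x, `|Phi x| <= c.
Proof.
have cS := @Cc_compact _ _ Phi; set S := closure _ in cS.
have : compact (Phi @` S : set R).
  by apply: continuous_compact => //; apply: continuous_subspaceT; exact: Cc_continuous.
move=> /compact_bounded[c [_ cP]]; exists (`|c| + 1) => x.
have [Sx|nSx] := pselect (S x).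
  have lec : c < `|c| + 1 by rewrite (le_lt_trans (ler_norm c))// ltrDl.
  by have := cP _ lec; apply; exists x.
have -> : Phi x = 0.
  by apply: contrapT => /eqP Px; apply: nSx; exact: subset_closure.
by rewrite normr0 addr_ge0.
Qed.

Lemma Cc_integrable T (m : {measure set (borel T) -> \bar R}) (Phi : Cc R T) :
  (forall K : set T, compact K -> (m K < +oo)%E) ->
  m.-integrable setT (EFin \o Phi : borel T -> \bar R).
Proof.
move=> mfin; have [c cP] := Cc_bounded Phi.
have cS := @Cc_compact _ _ Phi; set S := closure _ in cS.
have mS : measurable (S : set (borel T)) by apply: borel_closed; exact: closed_closure.
have iS : m.-integrable setT (EFin \o (\1_S : borel T -> R)).
  apply/integrableP; split; first by apply/measurable_EFinP; exact: measurable_indic.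
  under eq_integral do rewrite gee0_abs ?lee_fin//.
  by rewrite integral_indic// setIT mfin.
apply: (@le_integrable _ _ _ _ _ measurableT _ (fun x : borel T => c%:E * (EFin \o (\1_S : borel T -> R)) x)%E).
- exact: Cc_measurable.
- move=> x _; rewrite /= lee_fin.
  have [Sx|nSx] := pselect (S x).
    by rewrite indicE mem_set//= mulr1 (le_trans (cP x))// ler_norm.
  have -> : Phi x = 0.
    by apply: contrapT => /eqP Px; apply: nSx; exact: subset_closure.
  by rewrite normr0.
- exact: integrableZl.
Qed.

End borel_sets.

(** * The cylinder sigma-algebra on the path space *)

Section Cc_operations.
Variables (R : realType) (T : ptopologicalType).

Lemma Cc_mul_compact (Phi Psi : Cc R T) :
  compact (closure [set x | Phi x * Psi x != 0]).
Proof.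
apply: (subclosed_compact _ (@Cc_compact _ _ Phi)); first exact: closed_closure.
by apply: closureS => x /=; apply: contraNN => /eqP ->; rewrite mul0r.
Qed.

Lemma Cc_mul_continuous (Phi Psi : Cc R T) : continuous (fun x => Phi x * Psi x).
Proof. by move=> x; apply: cvgM; apply: Cc_continuous. Qed.

Definition Cc_mul (Phi Psi : Cc R T) : Cc R T :=
  MkCc (@Cc_mul_continuous Phi Psi) (@Cc_mul_compact Phi Psi).

Lemma Cc_integral_cvg (m : {measure set (borel T) -> \bar R})
    (Phi : nat -> Cc R T) (chi : Cc R T) (A : set (borel T)) :
  (forall K : set T, compact K -> (m K < +oo)%E) -> measurable A ->
  (forall n x, 0 <= Phi n x <= chi x) ->
  (forall x, Phi n x @[n --> \oo] --> (\1_A x : R)) ->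
  (\int[m]_x ((EFin \o Phi n : borel T -> \bar R) x))%E @[n --> \oo] --> m A.
Proof.
move=> mfin mA Phib PhiA.
have -> : m A = (\int[m]_x (EFin \o (\1_A : borel T -> R)) x)%E.
  by rewrite integral_indic// setIT.
have := @dominated_convergence _ (borel T) R m setT measurableT
  (fun n => EFin \o Phi n) (EFin \o (\1_A : borel T -> R)) (EFin \o chi).
case=> //.
- by move=> n; exact: Cc_measurable.
- by apply/measurable_EFinP; exact: measurable_indic.
- by apply: aeW => x _; apply: cvg_EFin; [exact: nearW|exact: PhiA].
- exact: Cc_integrable.
- apply: aeW => x n _; rewrite /= lee_fin ger0_norm; first by have /andP[] := Phib n x.
  by have /andP[] := Phib n x.
Qed.

End Cc_operations.

Section evaluation.
Variables (R : realType) (Y : puniformType).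
Variables (Gamma : set {family compact, R -> Y}) (g0 : Gamma).
Hypothesis Gamma_continuous : forall g : R -> Y, Gamma g -> continuous g.
Notation path := (path_space g0).

Lemma path_continuous (g : path) : continuous (path_fun g).
Proof. by apply: Gamma_continuous; exact: set_mem (valP g). Qed.

(** Convergence in [Gamma] is uniform on the compact neighbourhood [t-1, t+1] of [t], which controls
    h(s) against g(s); continuity of [g] controls g(s) against g(t). Continuity in the pair is what
    later makes evaluation equicontinuous in time. *)
Lemma ev_joint_continuous (g : path) (t : R) :
  ev p.2 p.1 @[p --> (g, t)] --> ev t g.
Proof.
move=> W; rewrite -nbhs_entourageE => -[E eE EW].
have eE2 := entourage_split_ent eE.
have vc : {for g, continuous (\val : path -> {family compact, R -> Y})}.
  exact: initial_continuous.
have /vc gW : nbhs (\val g : {family compact, R -> Y})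
    [set h | forall y, `[t - 1, t + 1]%classic y -> split_ent E (\val g y, h y)].
  exact: (fam_nbhs _ eE2 (@segment_compact _ _ _)).
have tW : nbhs t [set s | split_ent E (path_fun g t, path_fun g s)].
  have := @path_continuous g t (xsection (split_ent E) (path_fun g t)).
  move=> /(_ (nbhs_entourage _ eE2)) h.
  by apply: (@filterS _ (nbhs t) _ _ _ _ h) => s /= /xsectionP.
have tI : nbhs t `[t - 1, t + 1]%classic.
  apply: filterS (nbhsx_ballx t 1 ltr01) => s; rewrite /ball/= in_itv/= => ts.
  by rewrite -ler_distlC ltW.
exists ([set h | forall y, `[t - 1, t + 1]%classic y -> split_ent E (path_fun g y, path_fun h y)],
  [set s | split_ent E (path_fun g t, path_fun g s)] `&` `[t - 1, t + 1]%classic) => /=.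
  by split; [exact: gW|exact: filterI].
move=> -[h s] [/= hW [sW sI]]; apply: EW; apply/xsectionP.
by apply: entourage_split sW (hW s sI).
Qed.

Lemma ev_continuous (t : R) : continuous (ev t : path -> Y).
Proof.
move=> g W /(ev_joint_continuous (t := t))[[A B] /= [gA tB] AB].
apply: filterS gA => h Ah; apply: (AB (h, t)); split => //=.
exact: nbhs_singleton.
Qed.

Lemma measurable_ev (t : R) : measurable_fun setT (ev t : borel path -> borel Y).
Proof. by apply: (@continuous_borel path Y); exact: ev_continuous. Qed.

Lemma restr_measurable (I : set R) :
  measurable_fun setT (@restr R Y Gamma g0 I : borel path -> borel (restr_space g0 I)).
Proof. by apply: continuous_borel; apply/continuousP => A. Qed.

End evaluation.

Section cylinders.
Variables (R : realType) (Y : puniformType).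
Variables (Gamma : set {family compact, R -> Y}) (g0 : Gamma).
Hypothesis polishY : locally_compact_polish R Y.
Hypothesis Gamma_continuous : forall g : R -> Y, Gamma g -> continuous g.
Hypothesis Gamma_compact : forall (a b : R) (K : set Y), compact K ->
  compact [set g : path_space g0 | exists2 t, a <= t <= b & K (ev t g)].
Notation path := (path_space g0).

Let ev_cont t : continuous (ev t : path -> Y).
Proof. exact: ev_continuous. Qed.

Let hY : hausdorff_space Y.
Proof. by have [_ /metrizable_hausdorff] := polishY. Qed.

Lemma ev_preimage_compact (t : R) (K : set Y) : compact K ->
  compact ((ev t : path -> Y) @^-1` K).
Proof.
move=> cK; rewrite (_ : _ @^-1` _ = [set g : path | exists2 s, t <= s <= t & K (ev s g)]).
  exact: Gamma_compact.
apply/seteqP; split => g /=; first by exists t => //; rewrite lexx.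
by move=> [s /le_anti <-].
Qed.

Definition cylset (l : seq (R * set Y)) : set path :=
  foldr (fun p A => (ev p.1 @^-1` p.2) `&` A) setT l.

Lemma cylset_cat l1 l2 : cylset (l1 ++ l2) = cylset l1 `&` cylset l2.
Proof. by elim: l1 => [|p l1 ih] /=; rewrite ?setTI// ih setIA. Qed.

(** At least one constraint is imposed and all of them are compact, so that a cylinder lies in a
    compact set of paths and its indicator is a limit of functions in C_c(Gamma). *)
Definition compact_cyl (P : set R) : set (set (borel path)) :=
  [set A | exists l : seq (R * set Y),
    [/\ (0 < size l)%N, all (fun p => `[< P p.1 /\ compact p.2 >]) l & A = cylset l]].

Lemma compact_cylI P : setI_closed (compact_cyl P).
Proof.
move=> _ _ [l1 [l1_gt0 l1P ->]] [l2 [_ l2P ->]]; exists (l1 ++ l2); split.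
- by rewrite size_cat addn_gt0 l1_gt0.
- by rewrite all_cat l1P.
- by rewrite cylset_cat.
Qed.

Lemma cylset_measurable P l : all (fun p => `[< P p.1 /\ compact p.2 >]) l ->
  measurable (cylset l : set (borel path)).
Proof.
elim: l => [_|p l ih]; first exact: measurableT.
move=> /= /andP[/asboolP[_ cp] /ih ml]; apply: measurableI => //.
rewrite -[X in measurable X]setTI; apply: (@measurable_ev _ _ _ g0 Gamma_continuous p.1) => //.
by apply: borel_closed; exact: compact_closed.
Qed.

Lemma compact_cyl_measurable P : compact_cyl P `<=` measurable.
Proof. by move=> _ [l [_ lP ->]]; exact: cylset_measurable lP. Qed.

Let sigma P := g_sigma_algebraType (compact_cyl P).

Lemma compact_cyl_closed (P : set R) (t : R) (F : set Y) : P t -> closed F ->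
  measurable (ev t @^-1` F : set (sigma P)).
Proof.
move=> Pt cF; have [L [cL _ LT]] := sigma_compact polishY.
rewrite -[F]setTI -LT setI_bigcupl preimage_bigcup.
apply: bigcupT_measurable => n; apply: sub_sigma_algebra.
exists [:: (t, L n `&` F)]; split => //=; last by rewrite setIT.
rewrite andbT; apply/asboolP; split => //.
exact: compact_closedI.
Qed.

Lemma compact_cyl_open (P : set R) (t : R) (O : set Y) : P t -> open O ->
  measurable (ev t @^-1` O : set (sigma P)).
Proof.
move=> Pt oO; rewrite -(setCK O) preimage_setC; apply: measurableC.
exact: (compact_cyl_closed Pt (open_closedC oO)).
Qed.

(** A finite subcover of [C] by the sets [U n g], which control the times q(0), ..., q(n-1) up to
    1/(n+1), gives a cylindrical neighbourhood [W n]. A path [h] in all the [W n] is approximated at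
    these times by paths of [C]; a cluster point of them lies in [C] by compactness, agrees with [h]
    along [q], and saturation puts [h] in [C]. *)
Lemma compact_saturated_cyl (q : nat -> R) (C : set path) : compact C ->
  (forall g h, C g -> (forall i, ev (q i) g = ev (q i) h) -> C h) ->
  measurable (C : set (sigma (range q))).
Proof.
move=> cC satC; have [_ cm _] := polishY.
have [d [dn _ dC dD d0]] := metrizable_dist cm.
have inv_gt0 n : 0 < n.+1%:R^-1 :> R by rewrite invr_gt0.
pose O n (y : Y) := interior [set z | d y z < n.+1%:R^-1].
pose U n (g : path) : set path := \bigcap_(i < n) (ev (q i) @^-1` O n (ev (q i) g)).
have UP n g h : U n g h -> forall i, (i < n)%N -> d (ev (q i) g) (ev (q i) h) < n.+1%:R^-1.
  move=> Ugh i ltin; by have /interior_subset := Ugh i ltin.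
have oU n g : open (U n g).
  rewrite /U bigcap_mkord; apply: (big_ind (fun A : set path => open A)); [exact: openT|exact: openI|].
  move=> i _; move/continuousP : (@ev_cont (q i)); apply; exact: open_interior.
have Ug n g : U n g g.
  by move=> i _ /=; rewrite /O /interior; exact: dn.
have mU n g : measurable (U n g : set (sigma (range q))).
  rewrite /U bigcap_mkord; apply: bigsetI_measurable => i _; apply: compact_cyl_open; first by exists i.
  exact: open_interior.
have /choice[W WP] n : exists W : set (sigma (range q)), [/\ measurable W, C `<=` W &
    forall h, W h -> exists2 g, C g & U n g h].
  have := cC; rewrite compact_cover => /(_ _ C (U n) (fun g _ => oU n g)).
  case; first by move=> g Cg; exists g.
  move=> D DC CD; exists (\bigcup_(g in [set` D]) U n g); split => //.
    by apply: fin_bigcup_measurable => // g _; exact: mU.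
  by move=> h [g /DC Cg gh]; exists g => //; exact: set_mem Cg.
suff -> : C = \bigcap_n W n by apply: bigcapT_measurable => n; have [] := WP n.
apply/seteqP; split; first by move=> g Cg n _; have [_ /(_ g Cg)] := WP n.
move=> h Wh.
have /choice[g gP] n : exists g, C g /\ U n g h.
  by have [_ _ /(_ h (Wh n I))[g]] := WP n; exists g.
have PF : ProperFilter (g @ \oo) by exact: fmap_proper_filter.
have [|g' [Cg' clg']] := cC _ PF.
  by exists 0%N => // n _ /=; have [] := gP n.
apply: (satC g') => // i; apply: d0.
have d_ge0 u v : 0 <= d u v.
  have duu : 0 <= d u u by have := dD u u u; rewrite -subr_ge0 addrK.
  by have := le_trans duu (dD u v u); rewrite (dC v u) -mulr2n pmulrn_lge0.
apply/eqP; rewrite eq_le d_ge0 andbT; apply/ler_addgt0Pl => e e0; rewrite addr0.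
have e20 : 0 < e / 2 by rewrite divr_gt0.
have [N _ Ne] := near_infty_natSinv_lt (PosNum e20).
(* Beyond [N] the radius is below [e]/2; from [i.+1] on, the time [q i] is among those controlled by
   [U n]. *)
have gtail : (g @ \oo) (g @` [set n | (maxn N i.+1 <= n)%N]).
  by exists (maxn N i.+1) => // n /= nN; exists n.
have nbg : nbhs g' [set h' | d (ev (q i) g') (ev (q i) h') < e / 2].
  exact: (@ev_cont (q i) g' _ (dn _ _ e20)).
have [_ [[n /= nN <-] gn]] := clg' _ _ gtail nbg.
move: nN; rewrite geq_max => /andP[Nn ltin].
apply: le_trans (dD _ (ev (q i) (g n)) _) _; rewrite (splitr e) lerD//; first exact: ltW.
apply: ltW; apply: (lt_trans _ (Ne n Nn)).
by apply: UP => //; have [] := gP n.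
Qed.

(** Cutting [C] by the value at the time [q 0] along an exhaustion of [Y] keeps it saturated and
    makes it compact. *)
Lemma closed_saturated_cyl (q : nat -> R) (C : set path) : closed C ->
  (forall g h, C g -> (forall i, ev (q i) g = ev (q i) h) -> C h) ->
  measurable (C : set (sigma (range q))).
Proof.
move=> clC satC; have [L [cL _ LT]] := sigma_compact polishY.
rewrite -[C]setTI -(preimage_setT (ev (q 0%N))) -LT preimage_bigcup setI_bigcupl.
apply: bigcupT_measurable => n; apply: compact_saturated_cyl.
  by apply: compact_closedI => //; exact: ev_preimage_compact.
move=> g h [Lg Cg] gh; split; first by rewrite /= -gh.
exact: satC gh.
Qed.

End cylinders.

Section cylinder_generation.
Variables (R : realType) (Y : puniformType).
Variables (Gamma : set {family compact, R -> Y}) (g0 : Gamma).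
Hypothesis polishY : locally_compact_polish R Y.
Hypothesis Gamma_continuous : forall g : R -> Y, Gamma g -> continuous g.
Hypothesis Gamma_compact : forall (a b : R) (K : set Y), compact K ->
  compact [set g : path_space g0 | exists2 t, a <= t <= b & K (ev t g)].
Notation path := (path_space g0).

Let hY : hausdorff_space Y.
Proof. by have [_ /metrizable_hausdorff] := polishY. Qed.

Lemma ev_closure (P : set R) (s : R) (g h : path) : closure P s ->
  (forall t, P t -> ev t g = ev t h) -> ev s g = ev s h.
Proof.
move=> Ps gh; apply: hY => A B As Bs.
have gA : nbhs s (path_fun g @^-1` A) := path_continuous Gamma_continuous As.
have hB : nbhs s (path_fun h @^-1` B) := path_continuous Gamma_continuous Bs.
have [t [Pt [/= At Bt]]] := Ps _ (filterI gA hB).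
exists (ev t g); split => //.
by rewrite gh.
Qed.

Lemma dense_sequence : exists q : nat -> R, closure (range q) = setT.
Proof.
(* The rationals, enumerated through their codes; 0 is the default at integers that code nothing. *)
exists (fun n => if choice.unpickle n is Some r then (ratr (r : rat) : R) else 0).
rewrite -subTset => s _ A /nbhs_ballP[e /= e0 eA].
have se : s < s + e by rewrite ltrDl.
have [r /[!in_itv]/= /andP[sr re]] := rat_in_itvoo se.
exists (ratr r); split; first by exists (choice.pickle r); rewrite // choice.pickleK.
by apply: eA; rewrite /ball/= ltr_distlC; apply/andP; split => //; rewrite (lt_trans _ sr)// ltrBlDr ltrDl.
Qed.

Lemma compact_cylS (P Q : set R) : P `<=` Q ->
  compact_cyl (g0 := g0) P `<=` compact_cyl Q.
Proof.
move=> PQ _ [l [l0 lP ->]]; exists l; split => //.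
apply: sub_all lP => p /asboolP[Pp cp]; apply/asboolP; split => //; exact: PQ.
Qed.

Lemma saturated_open_cyl (q : nat -> R) (P : set R) (U : set path) :
  range q `<=` P -> open U ->
  (forall g h, U g -> (forall i, ev (q i) g = ev (q i) h) -> U h) ->
  <<s compact_cyl P >> U.
Proof.
move=> qP oU satU; apply: (sub_smallest2r _ (compact_cylS qP)).
  exact: smallest_sigma_algebra.
rewrite -[U]setCK.
apply: (@measurableC _ (g_sigma_algebraType (compact_cyl (range q)))).
apply: closed_saturated_cyl => //; first exact: open_closedC.
by move=> g h nUg gh Uh; apply: nUg; apply: satU Uh _ => i; rewrite gh.
Qed.

(** Continuous paths that agree along a dense sequence of times are equal, so every open set is
    saturated for that sequence. *)
Lemma borel_path_cyl (A : set (borel path)) : measurable A ->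
  <<s compact_cyl (g0 := g0) setT >> A.
Proof.
move=> mA; have [q qT] := dense_sequence.
apply: (@smallest_sub _ _ _ _ (smallest_sigma_algebra _ _) _ A mA) => U oU.
apply: (@saturated_open_cyl q) => // g h Ug gh.
suff -> : h = g by [].
apply: val_inj; apply/funext => s; apply/esym.
apply: (@ev_closure (range q)); first by rewrite qT.
by move=> _ [i _ <-].
Qed.

(* The sequence of times dense in [I] may be chosen in the interior of [I], so
   that a past and a future event at time [t] can be tested on times different
   from [t] only. *)
Lemma restr_cyl (I P : set R) (q : nat -> R) (A : set (borel (restr_space g0 I))) :
  I `<=` closure (range q) -> range q `<=` P -> range q `<=` I -> measurable A ->
  <<s compact_cyl (g0 := g0) P >> ((@restr R Y Gamma g0 I) @^-1` A).
Proof.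
move=> Iq qP qI mA.
have : measurable_fun setT (@restr R Y Gamma g0 I :
    g_sigma_algebraType (compact_cyl P) -> borel (restr_space g0 I)).
  apply: (@measurability _ _ _ (borel (restr_space g0 I)) _ _ open) => //.
  move=> _ [B oB <-]; rewrite setTI; apply: (saturated_open_cyl qP oB).
  move=> g h /= Bg gh.
  suff <- : restr I g = restr I h by [].
  apply: val_inj; apply/funext => s; apply: (@ev_closure (range q)).
    by apply: Iq; exact: set_valP.
  by move=> _ [i _ <-].
by move=> /(_ measurableT A mA); rewrite setTI.
Qed.

Lemma restr_le_cyl (t : R) (A : set (borel (restr_space g0 `]-oo, t]))) :
  measurable A ->
  <<s compact_cyl (g0 := g0) [set s | s < t] >> ((@restr R Y Gamma g0 `]-oo, t]) @^-1` A).
Proof.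
(* The times [t] - r with r a positive rational; integers that code nothing and rationals r <= 0
   default to [t] - 1, so that all [q n] are strictly before [t]. *)
pose q n : R := t - (if choice.unpickle n is Some r then (if 0 < ratr (r : rat) :> R then ratr r else 1) else 1).
have q_gt0 n : q n < t.
  by rewrite ltrBlDr ltrDl; case: choice.unpickle => [r|]//; case: ifPn.
apply: (@restr_cyl _ _ q); last 2 first.
- by move=> _ [n _ <-]; exact: q_gt0.
- by move=> _ [n _ <-] /=; rewrite in_itv/= ltW.
move=> s /=; rewrite in_itv/= => st A' /nbhs_ballP[e /= e0 eA].
have se : t - s < (t - s) + e by rewrite ltrDl.
have [r /[!in_itv]/= /andP[sr re]] := rat_in_itvoo se.
have r0 : 0 < ratr r :> R by rewrite (le_lt_trans _ sr)// subr_ge0.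
exists (t - ratr r); split; first by exists (choice.pickle r); rewrite // /q choice.pickleK r0.
apply: eA; rewrite /ball/= ltr_distlC; apply/andP; split; lra.
Qed.

Lemma restr_ge_cyl (t : R) (A : set (borel (restr_space g0 `[t, +oo[))) :
  measurable A ->
  <<s compact_cyl (g0 := g0) [set s | t < s] >> ((@restr R Y Gamma g0 `[t, +oo[) @^-1` A).
Proof.
pose q n : R := t + (if choice.unpickle n is Some r then (if 0 < ratr (r : rat) :> R then ratr r else 1) else 1).
have q_gt0 n : t < q n.
  by rewrite ltrDl; case: choice.unpickle => [r|]//; case: ifPn.
apply: (@restr_cyl _ _ q); last 2 first.
- by move=> _ [n _ <-]; exact: q_gt0.
- by move=> _ [n _ <-] /=; rewrite in_itv/= andbT ltW.
move=> s /=; rewrite in_itv/= andbT => st A' /nbhs_ballP[e /= e0 eA].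
have se : s - t < (s - t) + e by rewrite ltrDl.
have [r /[!in_itv]/= /andP[sr re]] := rat_in_itvoo se.
have r0 : 0 < ratr r :> R by rewrite (le_lt_trans _ sr)// subr_ge0.
exists (t + ratr r); split; first by exists (choice.pickle r); rewrite // /q choice.pickleK r0.
apply: eA; rewrite /ball/= ltr_distlC; apply/andP; split; lra.
Qed.

End cylinder_generation.

Section cylinder_functions.
Variables (R : realType) (Y : puniformType).
Variables (Gamma : set {family compact, R -> Y}) (g0 : Gamma).
Hypothesis polishY : locally_compact_polish R Y.
Hypothesis Gamma_continuous : forall g : R -> Y, Gamma g -> continuous g.
Hypothesis Gamma_compact : forall (a b : R) (K : set Y), compact K ->
  compact [set g : path_space g0 | exists2 t, a <= t <= b & K (ev t g)].
Notation path := (path_space g0).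

Lemma ev_Cc_continuous (t : R) (phi : Cc R Y) :
  continuous (fun g : path => phi (ev t g)).
Proof.
move=> g; apply: (@continuous_comp path Y R (ev t) phi).
  exact: ev_continuous.
exact: Cc_continuous.
Qed.

Lemma ev_Cc_compact (t : R) (phi : Cc R Y) :
  compact (closure [set g : path | phi (ev t g) != 0]).
Proof.
have cS := ev_preimage_compact Gamma_compact (t := t) (@Cc_compact _ _ phi).
apply: (subclosed_compact _ cS); first exact: closed_closure.
have /closure_id -> : closed ((ev t : path -> Y) @^-1` closure [set y | phi y != 0]).
  apply: closed_comp; last exact: closed_closure.
  by move=> g _; exact: ev_continuous.
by apply: closureS => g /= pg; exact: subset_closure.
Qed.

Definition Cc_ev (t : R) (phi : Cc R Y) : Cc R path :=
  MkCc (@ev_Cc_continuous t phi) (@ev_Cc_compact t phi).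

(* Over a nonempty list: the empty product [1] does not have compact support. *)
Fixpoint Cc_cyl (p : R * Cc R Y) (l : seq (R * Cc R Y)) : Cc R path :=
  if l is p' :: l' then Cc_mul (Cc_ev p.1 p.2) (Cc_cyl p' l') else Cc_ev p.1 p.2.

Definition nonneg_Cc (phi : Cc R Y) := forall y, 0 <= phi y.

Definition cyl_data (P : set R) : set (seq (R * Cc R Y)) :=
  [set l | all (fun x => `[< P x.1 /\ nonneg_Cc x.2 >]) l].

Lemma Cc_cyl_ge0 P p l g : cyl_data P (p :: l) -> 0 <= Cc_cyl p l g.
Proof.
elim: l p => [|q l ih] p; rewrite /cyl_data /=.
  by rewrite andbT => /asboolP[_]; apply.
move=> /andP[/asboolP[_ p0] /ih ql]; apply: mulr_ge0 => //; exact: p0.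
Qed.

(** Induction on the constraints: the approximations of the factors are multiplied, and so are their
    dominating functions. *)
Lemma cyl_approx (P : set R) (A : set path) : compact_cyl P A ->
  exists (p : nat -> R * Cc R Y) (l : nat -> seq (R * Cc R Y)) (chi : Cc R path),
  [/\ forall n, cyl_data P (p n :: l n),
      forall n g, 0 <= Cc_cyl (p n) (l n) g <= chi g, forall g, 0 <= chi g <= 1
    & forall g, Cc_cyl (p n) (l n) g @[n --> \oo] --> (\1_A g : R)].
Proof.
move=> [[|[t K] l] [] // _ + ->]; elim: l t K => [|[s L] l ih] t K.
  rewrite /= andbT => /asboolP[/= Pt cK].
  have [phi [chi [phichi chi01 phiK]]] := Cc_approx polishY cK.
  exists (fun n => (t, phi n)), (fun=> [::]), (Cc_ev t chi); split => //=.
  - move=> n; rewrite /cyl_data /= andbT; apply/asboolP; split => // y /=.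
    by have /andP[] := phichi n y.
  - move=> g; rewrite setIT (_ : \1__ g = \1_K (ev t g) :> R); first exact: phiK.
    by rewrite !indicE.
move=> /= /andP[/asboolP[/= Pt cK] /ih [p [k [chi' [pk pk01 chi'01 pkL]]]]].
have [phi [chi [phichi chi01 phiK]]] := Cc_approx polishY cK.
exists (fun n => (t, phi n)), (fun n => p n :: k n), (Cc_mul (Cc_ev t chi) chi'); split.
- move=> n; have pkn := pk n; rewrite /cyl_data /= -/(cyl_data _ _).
  apply/andP; split => //; apply/asboolP; split => // y /=.
  by have /andP[] := phichi n y.
- move=> n g /=; have /andP[a0 a1] := phichi n (ev t g).
  have /andP[b0 b1] := pk01 n g; rewrite mulr_ge0//=.
  by rewrite ler_pM.
- move=> g /=; have /andP[a0 a1] := chi01 (ev t g).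
  have /andP[b0 b1] := chi'01 g; rewrite mulr_ge0//=.
  by rewrite mulr_ile1.
- move=> g; rewrite indicI.
  apply: cvgM; last exact: pkL.
  rewrite (_ : \1__ g = \1_K (ev t g) :> R); first exact: phiK.
  by rewrite !indicE.
Qed.

Lemma cyl_exhaustion (P : set R) : P !=set0 -> exists G : nat -> set path,
  [/\ forall n, compact_cyl P (G n), forall n, compact (G n) & \bigcup_n G n = setT].
Proof.
move=> [t Pt]; have [L [cL _ LT]] := sigma_compact polishY.
exists (fun n => ev t @^-1` L n); split.
- move=> n; exists [:: (t, L n)]; split => //; last by rewrite /= setIT.
  by rewrite /= andbT; apply/asboolP; split.
- by move=> n; exact: ev_preimage_compact.
- by rewrite -preimage_bigcup LT preimage_setT.
Qed.

(** Dominated convergence carries the equality from cylinder functions to compact cylinders. These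
    form a pi-system with an exhaustion by compact sets, on which both measures are finite. *)
Lemma cyl_measure_unique (P : set R) (m1 m2 : {measure set (borel path) -> \bar R}) :
  P !=set0 ->
  (forall K : set path, compact K -> (m1 K < +oo)%E) ->
  (forall K : set path, compact K -> (m2 K < +oo)%E) ->
  (forall p l, cyl_data P (p :: l) ->
    \int[m1]_x ((EFin \o Cc_cyl p l : borel path -> \bar R) x) =
    \int[m2]_x ((EFin \o Cc_cyl p l : borel path -> \bar R) x))%E ->
  forall A, <<s compact_cyl (g0 := g0) P >> A -> m1 A = m2 A.
Proof.
move=> P0 fin1 fin2 m12; have [G [GP cG GT]] := cyl_exhaustion P0.
apply: (@g_sigma_algebra_measure_unique _ R (borel path) (compact_cyl P)
  (@compact_cyl_measurable _ _ _ _ polishY Gamma_continuous P) G GP GT m1 m2).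
- exact: compact_cylI.
- move=> A PA; have [p [l [chi [pl plchi _ plA]]]] := cyl_approx PA.
  have mA := compact_cyl_measurable polishY Gamma_continuous PA.
  have cv1 := Cc_integral_cvg fin1 mA plchi plA.
  have cv2 := Cc_integral_cvg fin2 mA plchi plA.
  apply: (cvg_unique (@ereal_hausdorff R) cv1).
  rewrite (_ : (fun n => _) = (fun n => \int[m2]_x ((EFin \o Cc_cyl (p n) (l n)) x))%E)//.
  by apply/funext => n; exact: m12.
- by move=> k; exact: fin1.
Qed.

End cylinder_functions.

(** * Mixtures and fibers of families of probabilities *)

Section mixtures.
Context d d' (X : measurableType d) (Z : measurableType d') (R : realType).
Variables (mu : {measure set X -> \bar R}) (k : X -> {measure set Z -> \bar R}).
Hypothesis mk : forall B, measurable B -> measurable_fun setT (k ^~ B).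
Variable m : {measure set Z -> \bar R}.
Hypothesis mE : forall B, measurable B -> m B = (\int[mu]_x k x B)%E.

Import HBNNSimple.

Let integral_mixture_nnsfun (f : {nnsfun Z >-> R}) :
  (\int[m]_z (f z)%:E = \int[mu]_x \int[k x]_z (f z)%:E)%E.
Proof.
have mf r : measurable (f @^-1` [set r]) by [].
have intE (n : {measure set Z -> \bar R}) :
    (\int[n]_z (f z)%:E = \sum_(r \in range f) (r%:E * n (f @^-1` [set r])))%E.
  by rewrite integralT_nnsfun sintegralE.
rewrite intE; under [in RHS]eq_integral do rewrite intE.
rewrite ge0_integral_fsum//.
- apply: eq_fsbigr => r /set_mem[z _ <-].
  rewrite mE// ge0_integralZl//; first exact: mk.
  by rewrite lee_fin.
- by move=> r; apply: measurable_funeM; exact: mk.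
- move=> r x _; apply: (mulemu_ge0 (fun r => f @^-1` [set r])) => s0.
  by rewrite preimage_nnfun0.
Qed.

(** Simple functions, then monotone convergence under both integrals; with nonnegative values this
    needs no finiteness of [mu]. *)
Lemma integral_mixture (f : Z -> \bar R) :
  measurable_fun setT f -> (forall z, (0 <= f z)%E) ->
  (\int[m]_z f z = \int[mu]_x \int[k x]_z f z)%E.
Proof.
move=> mf f0; pose f_ := nnsfun_approx measurableT mf.
have nd_f z : nondecreasing_seq (fun n => (f_ n z)%:E).
  by move=> a b ab; rewrite lee_fin; exact/lefP/nd_nnsfun_approx.
have lim_f (n : {measure set Z -> \bar R}) :
    (\int[n]_z f z = limn (fun i => \int[n]_z (f_ i z)%:E))%E.
  rewrite -monotone_convergence//.
  - by apply: eq_integral => z _; apply/esym/cvg_lim => //; exact: cvg_nnsfun_approx.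
  - by move=> i; exact/measurable_EFinP.
  - by move=> i z _; rewrite lee_fin.
rewrite lim_f; under [in RHS]eq_integral do rewrite lim_f.
rewrite monotone_convergence//.
- by congr (limn _); apply/funext => i; exact: integral_mixture_nnsfun.
- move=> i; apply: measurable_fun_integral_kernel; first exact: mk.
    by move=> z; rewrite lee_fin.
  exact/measurable_EFinP.
- by move=> i x _; apply: integral_ge0 => z _; rewrite lee_fin.
- move=> x _ a b ab; apply: ge0_le_integral => //.
  + by move=> z _; rewrite lee_fin.
  + by apply/measurable_EFinP.
  + by apply/measurable_EFinP.
  + by move=> z _; exact: nd_f.
Qed.

End mixtures.

Section families.
Variables (R : realType) (Y : puniformType).
Variables (Gamma : set {family compact, R -> Y}) (g0 : Gamma).
Notation path := (path_space g0).
Variable mu : radon R Y.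

Lemma supp_closed : closed (supp mu : set Y).
Proof.
rewrite -[supp mu]setCK; apply: open_closedC; rewrite openE => y /= nsy.
have [U [oU Uy mU]] : exists U : set Y, [/\ open U, U y & ~ (0 < mu U)%E].
  apply: contrapT => h; apply: nsy => U oU Uy; apply: contrapT => mU.
  by apply: h; exists U.
rewrite /interior; apply: filterS (open_nbhs_nbhs (conj oU Uy)) => z Uz.
by move=> /(_ U oU Uz).
Qed.

(** The zero measure outside [supp mu] matches the value 0 taken there by [mass], and lets integrals
    against [mu] run over all of [Y]. *)
Definition fiber (nu : prob_family g0 mu) (y : Y) : {measure set (borel path) -> \bar R} :=
  if insub y is Some x then prob_measure (nu x) else mzero.

Lemma fiberE (nu : prob_family g0 mu) (x : supp mu) : fiber nu (\val x) = prob_measure (nu x).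
Proof. by rewrite /fiber valK. Qed.

Lemma fiber_out (nu : prob_family g0 mu) (y : Y) : ~ supp mu y -> fiber nu y = mzero.
Proof. by move=> ny; rewrite /fiber insubN//; apply/negP => /set_mem. Qed.

Lemma massE (nu : prob_family g0 mu) B y : mass nu B y = fiber nu y B.
Proof.
rewrite /mass /= oinv_set_val /fiber.
by case: (insub y).
Qed.

End families.

(** * Decoupling and independence of the order of the markovianisations *)

Section product_laws.
Context d d1 d2 (T : measurableType d) (T1 : measurableType d1)
  (T2 : measurableType d2) (R : realType).
Variables (P P' : {measure set T -> \bar R}) (r1 : T -> T1) (r2 : T -> T2).
Hypotheses (P1 : P setT = 1%E) (mr1 : measurable_fun setT r1) (mr2 : measurable_fun setT r2).

Let r1_mfun : {mfun T >-> T1} := HB.pack r1 (isMeasurableFun.Build _ _ _ _ _ mr1).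
Let r2_mfun : {mfun T >-> T2} := HB.pack r2 (isMeasurableFun.Build _ _ _ _ _ mr2).
Let law := P : set T -> \bar R.
HB.instance Definition _ := Measure.on law.
HB.instance Definition _ := @Measure_isProbability.Build _ _ _ law P1.
Let prob_P : probability T R := law.

(** Tonelli for the product of the marginal laws of [P], transported by the pair ([r1], [r2]). [P]
    and [P'] are kept apart because a decoupled law is prescribed through the marginals of another
    law. *)
Lemma product_law_integral (u : T1 -> \bar R) (v : T2 -> \bar R) :
  (forall A, measurable A -> pushforward P' (fun x => (r1 x, r2 x)) A =
    (pushforward P r1 \x pushforward P r2)%E A) ->
  measurable_fun setT u -> measurable_fun setT v ->
  (forall x, (0 <= u x)%E) -> (forall x, (0 <= v x)%E) ->
  (\int[P']_x (u (r1 x) * v (r2 x)) = \int[P]_x u (r1 x) * \int[P]_x v (r2 x))%E.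
Proof.
move=> PP mu mv u0 v0.
have mr : measurable_fun setT (fun x => (r1 x, r2 x)) by exact: measurable_fun_pair.
pose w (z : T1 * T2) := (u z.1 * v z.2)%E.
have mw : measurable_fun setT w.
  by apply: emeasurable_funM; exact: measurableT_comp.
have w0 z : (0 <= w z)%E by exact: mule_ge0.
have := @ge0_integral_pushforward _ _ _ _ _ _ mr P' setT w measurableT mw (fun z _ => w0 z).
rewrite preimage_setT => <-.
pose m1 := distribution prob_P r1_mfun; pose m2 := distribution prob_P r2_mfun.
rewrite (@eq_measure_integral _ _ _ _ (m1 \x m2)%E); last by move=> A mA _; exact: PP.
rewrite fubini_tonelli1//.
have -> : fubini_F m2 w = (fun x => u x * \int[m2]_y v y)%E.
  by apply/funext => x; rewrite /fubini_F /w/= ge0_integralZl.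
rewrite ge0_integralZr//; last by apply: integral_ge0.
congr (_ * _)%E.
- have := @ge0_integral_pushforward _ _ _ _ _ _ mr1 P setT u measurableT mu (fun z _ => u0 z).
  by rewrite preimage_setT.
- have := @ge0_integral_pushforward _ _ _ _ _ _ mr2 P setT v measurableT mv (fun z _ => v0 z).
  by rewrite preimage_setT.
Qed.

Lemma product_lawP :
  (forall A B, measurable A -> measurable B ->
    P (r1 @^-1` A `&` r2 @^-1` B) = (P (r1 @^-1` A) * P (r2 @^-1` B))%E) ->
  forall A, measurable A -> pushforward P (fun x => (r1 x, r2 x)) A =
    (pushforward P r1 \x pushforward P r2)%E A.
Proof.
move=> PP A mA; apply/esym.
have mr : measurable_fun setT (fun x => (r1 x, r2 x)) by exact: measurable_fun_pair.
pose r : {mfun T >-> (T1 * T2)%type} := HB.pack (fun x => (r1 x, r2 x))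
  (isMeasurableFun.Build _ _ _ _ _ mr).
exact: (@product_measure_unique _ _ _ _ _ (distribution prob_P r1_mfun)
  (distribution prob_P r2_mfun) (distribution prob_P r)).
Qed.

End product_laws.

Section ecylinders.
Variables (R : realType) (Y : puniformType).
Variables (Gamma : set {family compact, R -> Y}) (g0 : Gamma).
Hypothesis Gamma_continuous : forall g : R -> Y, Gamma g -> continuous g.
Notation path := (path_space g0).
Notation Ev := (@ev R Y Gamma g0).
Local Notation datum := (R * (borel Y -> \bar R))%type.
Local Open Scope ereal_scope.

(** Each factor is a measurable function with values in [0,+oo], so that a conditional expectation
    can itself be a factor, whether finite or not. *)
Definition ecyl (l : seq datum) (g : borel path) : \bar R :=
  foldr (fun p a => p.2 (Ev p.1 g : borel Y) * a) 1 l.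

Definition ge0_measurable (f : borel Y -> \bar R) :=
  measurable_fun setT f /\ forall y, 0 <= f y.

Definition good : pred (seq datum) := all (fun p => `[< ge0_measurable p.2 >]).

Lemma ecyl_cat l k g : ecyl (l ++ k) g = ecyl l g * ecyl k g.
Proof. by elim: l => [|p l ih] /=; rewrite ?mul1e// ih muleA. Qed.

Lemma ecyl_filter (a : pred datum) l g :
  ecyl l g = ecyl (seq.filter a l) g * ecyl (seq.filter (predC a) l) g.
Proof.
elim: l => [|p l ih] /=; first by rewrite mul1e.
by case: (a p) => /=; rewrite ih; [rewrite muleA|rewrite muleCA].
Qed.

Lemma ecyl_ge0 l g : good l -> 0 <= ecyl l g.
Proof.
by elim: l => [|p l ih] //= /andP[/asboolP[_ p0] /ih l0]; apply: mule_ge0.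
Qed.

Lemma ecyl_measurable l : good l -> measurable_fun setT (ecyl l).
Proof.
elim: l => [|p l ih] /=; first by move=> _; exact: measurable_cst.
move=> /andP[/asboolP[mp _] /ih ml]; apply: emeasurable_funM => //.
exact: (measurableT_comp mp (@measurable_ev _ _ _ g0 Gamma_continuous p.1)).
Qed.

(** In the final topology, evaluation at a time of [I] is continuous on the space of restrictions
    because its composite with [restr I] is continuous on [Gamma]. *)
Lemma ecyl_restr (I : set R) l : good l -> all (fun p => `[< I p.1 >]) l ->
  exists u : borel (restr_space g0 I) -> \bar R, [/\ measurable_fun setT u,
    forall f, 0 <= u f & forall g, ecyl l g = u (restr I g)].
Proof.
elim: l => [_ _|p l ih /=].
  by exists (cst 1); split => //; exact: measurable_cst.
move=> /andP[/asboolP[mp p0] gl] /andP[/asboolP Ip Il].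
have [u [mu u0 uE]] := ih gl Il.
pose e : restr_space g0 I -> Y := fun f => \val f (SigSub (mem_set Ip)).
have me : measurable_fun setT (e : borel (restr_space g0 I) -> borel Y).
  apply: continuous_borel; apply/continuousP => O oO.
  rewrite /open/= /restr_open/=.
  by move/continuousP: (@ev_continuous _ _ _ g0 Gamma_continuous p.1); apply.
exists (fun f => p.2 (e f) * u f); split.
- by apply: emeasurable_funM => //; exact: (measurableT_comp mp me).
- by move=> f; exact: mule_ge0.
- by move=> g; rewrite uE.
Qed.

End ecylinders.

Lemma measureC_eq0 d (T : measurableType d) (R : realType)
    (m : {measure set T -> \bar R}) (A : set T) :
  measurable A -> m setT = 1%E -> m A = 1%E -> m (~` A) = 0%E.
Proof.
move=> mA mT mA1.
have : (m setT = m A + m (~` A))%E.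
  by rewrite -measureU// ?setUv ?setICr//; exact: measurableC.
by rewrite mT mA1 addeC => h; rewrite -[LHS](@addeK _ 1%E)// -h subee.
Qed.

Section fiber_integrals.
Variables (R : realType) (Y : puniformType).
Variables (Gamma : set {family compact, R -> Y}) (g0 : Gamma).
Hypothesis Gamma_continuous : forall g : R -> Y, Gamma g -> continuous g.
Hypothesis hY : hausdorff_space Y.
Notation path := (path_space g0).
Notation Ev := (@ev R Y Gamma g0).
Variable mu : radon R Y.
Local Open Scope ereal_scope.

Lemma probT (m : prob R path) : prob_measure m setT = 1.
Proof. exact: set_mem (valP m). Qed.

Lemma ev_fiber_measurable (t : R) (y : Y) :
  measurable ([set g | Ev t g = y] : set (borel path)).
Proof.
rewrite -[X in measurable X]setTI.
apply: (@measurable_ev _ _ _ g0 Gamma_continuous t measurableT [set y]).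
by apply: borel_closed; apply: accessible_closed_set1; exact: hausdorff_accessible.
Qed.

Lemma fiber_measurable (nu : prob_family g0 mu) : borel_family nu ->
  forall B, measurable B -> measurable_fun setT (fun y : borel Y => fiber nu y B).
Proof.
move=> nuB B mB.
have mS : measurable (supp mu : set (borel Y)) by apply: borel_closed; exact: supp_closed.
rewrite -(setUv (supp mu)); apply/measurable_funU => //; first exact: measurableC.
split.
  apply: eq_measurable_fun (nuB B mB) => y _; exact: massE.
apply: (eq_measurable_fun (cst 0)) => [y /set_mem nsy|]; last exact: measurable_cst.
by rewrite fiber_out.
Qed.

Lemma fiber_integral_measurable (nu : prob_family g0 mu) (f : borel path -> \bar R) :
  borel_family nu -> measurable_fun setT f -> (forall g, 0 <= f g) ->
  ge0_measurable (fun y : borel Y => \int[fiber nu y]_g f g).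
Proof.
move=> nuB mf f0; split; last by move=> y; exact: integral_ge0.
by apply: measurable_fun_integral_kernel => //; exact: fiber_measurable.
Qed.

Lemma mixture_integral (nu : prob_family g0 mu) (xi : radon R path)
    (f : borel path -> \bar R) :
  is_mixture nu xi -> measurable_fun setT f -> (forall g, 0 <= f g) ->
  \int[xi]_g f g = \int[mu]_y \int[fiber nu y]_g f g.
Proof.
move=> [nuB xiE] mf f0; apply: integral_mixture => //; first exact: fiber_measurable.
by move=> B mB; rewrite xiE//; apply: eq_integral => y _; exact: massE.
Qed.

Definition concentrated (t : R) (nu : prob_family g0 mu) :=
  forall x : supp mu, prob_measure (nu x) [set g | Ev t g = \val x] = 1.

(** Under the fiber over [y], g(t) equals [y] almost surely; outside [supp mu] the fiber is zero and
    so are both sides. *)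
Lemma concentrated_integral (t : R) (nu : prob_family g0 mu) (y : Y)
    (h : borel Y -> \bar R) (f : borel path -> \bar R) :
  concentrated t nu -> ge0_measurable h ->
  measurable_fun setT f -> (forall g, 0 <= f g) ->
  \int[fiber nu y]_g (h (Ev t g : borel Y) * f g) = h y * \int[fiber nu y]_g f g.
Proof.
move=> nut [mh h0] mf f0; rewrite -ge0_integralZl//.
apply: ge0_ae_eq_integral => //.
- apply: emeasurable_funM => //; exact: (measurableT_comp mh (@measurable_ev _ _ _ g0 Gamma_continuous t)).
- exact: measurable_funeM.
- by move=> g _; exact: mule_ge0.
- by move=> g _; exact: mule_ge0.
exists (~` [set g | Ev t g = y]); split.
- by apply: measurableC; exact: ev_fiber_measurable.
- have [sy|nsy] := pselect (supp mu y); last by rewrite fiber_out.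
  rewrite -[y]/(\val (SigSub (mem_set sy) : supp mu)) fiberE.
  set x : supp mu := SigSub _; have mx := ev_fiber_measurable t (\val x).
  by apply: measureC_eq0 => //; exact: probT.
- by move=> g /= + gy; apply; rewrite gy.
Qed.

Lemma concentrated_ev_integral (t : R) (nu : prob_family g0 mu) (y : Y)
    (h : borel Y -> \bar R) : concentrated t nu -> ge0_measurable h ->
  \int[fiber nu y]_g (h (Ev t g : borel Y)) = h y * fiber nu y setT.
Proof.
move=> nut gh; have := concentrated_integral y nut gh (f := cst 1) (@measurable_cst _ _ _ _ _ _) (fun=> lee01).
by rewrite integral_cst// mul1e; under eq_integral do rewrite mule1.
Qed.

End fiber_integrals.

Section markovianisation_step.
Variables (R : realType) (Y : puniformType).
Variables (Gamma : set {family compact, R -> Y}) (g0 : Gamma).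
Hypothesis polishY : locally_compact_polish R Y.
Hypothesis Gamma_continuous : forall g : R -> Y, Gamma g -> continuous g.
Hypothesis Gamma_compact : forall (a b : R) (K : set Y), compact K ->
  compact [set g : path_space g0 | exists2 t, a <= t <= b & K (ev t g)].
Notation path := (path_space g0).
Notation Ev := (@ev R Y Gamma g0).
Variable mu : radon R Y.
Local Notation datum := (R * (borel Y -> \bar R))%type.
Local Open Scope ereal_scope.
Local Notation "'E[' xi ] l" := (\int[xi]_g ecyl (g0 := g0) l g) (at level 10, l at level 9).

Let hY : hausdorff_space Y.
Proof. by have [_ /metrizable_hausdorff] := polishY. Qed.

Let mecyl (l : seq datum) : good l -> measurable_fun setT (ecyl (g0 := g0) l).
Proof. exact: ecyl_measurable. Qed.

Let ecyl0 (l : seq datum) : good l -> forall g, 0 <= ecyl (g0 := g0) l g.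
Proof. by move=> gl g; exact: ecyl_ge0. Qed.

Let mixE (nu : prob_family g0 mu) (xi : radon R path) (l : seq datum) :
  is_mixture nu xi -> good l -> E[xi] l = \int[mu]_y E[fiber nu y] l.
Proof. by move=> nuxi gl; apply: mixture_integral => //; [exact: mecyl|exact: ecyl0]. Qed.

Lemma decoupling_integral (t : R) (nu nu' : prob_family g0 mu) (l k : seq datum) (y : Y) :
  (forall x : supp mu, is_decoupling t (\val x) (nu x) (nu' x)) ->
  good l -> good k ->
  all (fun p => p.1 <= t)%R l -> all (fun p => t <= p.1)%R k ->
  E[fiber nu' y] (l ++ k) = E[fiber nu y] l * E[fiber nu y] k.
Proof.
move=> dec gl gk lt kt.
have [sy|nsy] := pselect (supp mu y); last first.
  by rewrite !fiber_out// !integral_measure_zero mule0.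
rewrite -[y]/(\val (SigSub (mem_set sy) : supp mu)) !fiberE; set x : supp mu := SigSub _.
have lI : all (fun p : datum => `[< [set` `]-oo, t]%R] p.1 >]) l.
  by apply: sub_all lt => p pt; apply/asboolP; rewrite /= in_itv.
have kI : all (fun p : datum => `[< [set` `[t, +oo[%R] p.1 >]) k.
  by apply: sub_all kt => p pt; apply/asboolP; rewrite /= in_itv/= andbT.
have [u [mu' u0 uE]] := ecyl_restr g0 Gamma_continuous gl lI.
have [v [mv v0 vE]] := ecyl_restr g0 Gamma_continuous gk kI.
under eq_integral do rewrite ecyl_cat uE vE.
under [in RHS]eq_integral do rewrite uE.
under [X in _ = _ * X]eq_integral do rewrite vE.
have [_ _ conc] := dec x.
have := @product_law_integral _ _ _ _ _ _ R (prob_measure (nu x)) (prob_measure (nu' x))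
  _ _ (probT (nu x)) (@restr_measurable _ _ _ _ _) (@restr_measurable _ _ _ _ _) u v conc mu' mv u0 v0.
exact.
Qed.

Definition agree (r : rel R) (t : R) (xi xi' : radon R path) :=
  forall l : seq datum, good l -> all (fun p => r p.1 t) l -> E[xi'] l = E[xi] l.

(* The conditional expectation at time [s] of a function of the times [r]-before
   [s] also represents it against functions of the times [r]-after [s]: taken
   for [r] both [<=] and [>=], this is the Markov property at time [s]. *)
Definition side (r : rel R) (s : R) (xi : radon R path) :=
  forall l : seq datum, good l -> all (fun p => r p.1 s) l ->
  exists2 f, ge0_measurable f & forall k : seq datum, good k ->
    all (fun p => r s p.1) k -> E[xi] (l ++ k) = E[xi] ((s, f) :: k).

Lemma eq_ecyl (xi : radon R path) (l k : seq datum) :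
  (forall g, ecyl (g0 := g0) l g = ecyl k g) -> E[xi] l = E[xi] k.
Proof. by move=> lk; apply: eq_integral => g _. Qed.

Lemma ecyl_catC (l k : seq datum) g : ecyl (g0 := g0) (l ++ k) g = ecyl (k ++ l) g.
Proof. by rewrite !ecyl_cat muleC. Qed.

(** Decoupling keeps the past and the future law of each fiber, whence agreement on either side of
    [t]. A list on one side of [t] is represented at time [t] by its fiber expectation under [nu],
    the disintegration of the old measure: decoupling splits it off as a factor, and this factor
    depends on g(t) only. *)
Lemma markovianisation_step (t : R) (xi xi' : radon R path) :
  markovianisation mu t xi xi' ->
  [/\ agree <=%R t xi xi', agree >=%R t xi xi', side <=%R t xi' & side >=%R t xi'].
Proof.
move=> [nu [nu' [[nut nuxi] dec nuxi']]].
have gnil : good ([::] : seq datum) by [].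
(* The mass of a fiber is 1 over [supp mu]; elsewhere both sides vanish. *)
have fT (l : seq datum) y : good l -> E[fiber nu y] l * E[fiber nu y] [::] = E[fiber nu y] l.
  move=> gl; rewrite /= integral_cst// mul1e.
  have [sy|nsy] := pselect (supp mu y); last first.
    by rewrite !fiber_out// integral_measure_zero mul0e.
  rewrite -[y]/(\val (SigSub (mem_set sy) : supp mu)) !fiberE.
  by rewrite probT mule1.
have le_agree : agree <=%R t xi xi'.
  move=> l gl lt.
  apply: (etrans (mixE nuxi' gl)); apply: (etrans _ (esym (mixE nuxi gl))).
  apply: eq_integral => y _.
  by have := decoupling_integral y dec gl gnil lt isT; rewrite cats0 fT.
have ge_agree : agree >=%R t xi xi'.
  move=> l gl lt.
  apply: (etrans (mixE nuxi' gl)); apply: (etrans _ (esym (mixE nuxi gl))).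
  apply: eq_integral => y _.
  by have := decoupling_integral y dec gnil gl isT lt; rewrite muleC fT.
have gf (l : seq datum) : good l -> ge0_measurable (fun y : borel Y => E[fiber nu y] l).
  move=> gl; apply: fiber_integral_measurable; [by case: nuxi|exact: mecyl|exact: ecyl0].
split => //.
- move=> l gl lt; exists (fun y => E[fiber nu y] l); first exact: gf.
  move=> k gk kt.
  have gtk : good ((t, fun y : borel Y => E[fiber nu y] l) :: k).
    by rewrite /good /= -/(good _) gk andbT; apply/asboolP; exact: gf.
  have ttk : all (fun p : datum => >=%R p.1 t) ((t, fun y : borel Y => E[fiber nu y] l) :: k).
    by rewrite /= lexx.
  rewrite (ge_agree _ gtk ttk).
  apply: (etrans (mixE nuxi' _)); first by rewrite /good all_cat -/(good _) -/(good _) gl gk.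
  apply: (etrans _ (esym (mixE nuxi gtk))).
  apply: eq_integral => y _; rewrite (decoupling_integral y dec gl gk lt kt).
  rewrite (concentrated_integral _ hY _ nut)//; [exact: gf|exact: mecyl|exact: ecyl0].
- move=> l gl lt; exists (fun y => E[fiber nu y] l); first exact: gf.
  move=> k gk kt.
  have gtk : good ((t, fun y : borel Y => E[fiber nu y] l) :: k).
    by rewrite /good /= -/(good _) gk andbT; apply/asboolP; exact: gf.
  have ttk : all (fun p : datum => <=%R p.1 t) ((t, fun y : borel Y => E[fiber nu y] l) :: k).
    by rewrite /= lexx.
  rewrite (le_agree _ gtk ttk).
  rewrite (eq_ecyl _ (ecyl_catC l k)).
  apply: (etrans (mixE nuxi' _)); first by rewrite /good all_cat -/(good _) -/(good _) gl gk.
  apply: (etrans _ (esym (mixE nuxi gtk))).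
  apply: eq_integral => y _; rewrite (decoupling_integral y dec gk gl kt lt) muleC.
  rewrite (concentrated_integral _ hY _ nut)//; [exact: gf|exact: mecyl|exact: ecyl0].
Qed.

End markovianisation_step.

Section markov_versions.
Variables (R : realType) (Y : puniformType).
Variables (Gamma : set {family compact, R -> Y}) (g0 : Gamma).
Hypothesis polishY : locally_compact_polish R Y.
Hypothesis Gamma_continuous : forall g : R -> Y, Gamma g -> continuous g.
Hypothesis Gamma_compact : forall (a b : R) (K : set Y), compact K ->
  compact [set g : path_space g0 | exists2 t, a <= t <= b & K (ev t g)].
Notation path := (path_space g0).
Variable mu : radon R Y.
Local Notation datum := (R * (borel Y -> \bar R))%type.
Local Open Scope ereal_scope.
Local Notation "'E[' xi ] l" := (\int[xi]_g ecyl (g0 := g0) l g) (at level 10, l at level 9).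

Lemma good_filter (a : pred datum) l : good l -> good (seq.filter a l).
Proof. by rewrite /good all_filter; apply: sub_all => p pg; apply/implyP. Qed.

Lemma has_seqfilter (T : Type) (a b : pred T) s :
  has a (seq.filter b s) = has [pred x | b x && a x] s.
Proof. by elim: s => //= x s ih; case: (b x) => /=; rewrite ih. Qed.

Lemma good_cat (l k : seq datum) : good (l ++ k) = good l && good k.
Proof. exact: all_cat. Qed.

Lemma good_cons (s : R) (f : borel Y -> \bar R) l :
  ge0_measurable f -> good l -> good ((s, f) :: l).
Proof. by move=> gf gl; rewrite /good /= -/(good _) gl andbT; apply/asboolP. Qed.

(** The data beyond [t], seen from [s], are replaced by a function of g(t), using the Markov
    property of [xi'] at [t]. What remains lies on one side of [t], where [xi'] agrees with [xi],
    and the property of [xi] at [s] applies. Keeping [r] abstract covers both directions of time. *)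
Lemma side_step (r : rel R) (s t : R) (xi xi' : radon R path) :
  total r -> transitive r -> reflexive r ->
  agree r t xi xi' -> agree (fun x y => r y x) t xi xi' ->
  side r t xi' -> side (fun x y => r y x) t xi' ->
  side r s xi -> side r s xi'.
Proof.
move=> rtot rtr rr ag ag' side_t side_t' side_s l gl ls.
pose bef (p : datum) := r p.1 t.
have aft p : predC bef p -> r t p.1.
  by rewrite /= /bef => /negbTE; have := rtot t p.1; case: (r t p.1) => //= ->.
have filt (q : pred datum) k : all q k -> all q (seq.filter bef k) && all q (seq.filter (predC bef) k).
  by rewrite !all_filter => qk; apply/andP; split; apply: sub_all qk => p qp; apply/implyP.
have befk k : all (fun p => r p.1 t) (seq.filter bef k).
  by rewrite all_filter; apply/allT => p; apply/implyP.
have aftk k : all (fun p => r t p.1) (seq.filter (predC bef) k).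
  by rewrite all_filter; apply/allT => p; apply/implyP; exact: aft.
have [rst|rts] := boolP (r s t); last first.
(* [t] comes before [s]: the part of [l] before [t] becomes [f] at time [t], and the representative
   at [s] is that of the modified list. *)
- have {}rts : r t s by have := rtot t s; rewrite (negbTE rts) orbF.
  have /andP[l1s l2s] := filt _ _ ls.
  have [f gf fP] := side_t _ (good_filter bef gl) (befk l).
  have gfl2 : good ((t, f) :: seq.filter (predC bef) l) by apply: good_cons => //; exact: good_filter.
  have tfl2 : all (fun p => r p.1 s) ((t, f) :: seq.filter (predC bef) l) by rewrite /= rts.
  have [h gh hP] := side_s _ gfl2 tfl2.
  exists h => // k gk ks.
  have tk : all (fun p => r t p.1) k by apply: sub_all ks => p; exact: rtr.
  have gl2k : good (seq.filter (predC bef) l ++ k) by rewrite good_cat gk good_filter.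
  transitivity (E[xi'] (seq.filter bef l ++ (seq.filter (predC bef) l ++ k))).
    by apply: eq_ecyl => g; rewrite !ecyl_cat muleA -ecyl_filter.
  rewrite fP//; last by rewrite all_cat aftk.
  transitivity (E[xi] ((t, f) :: (seq.filter (predC bef) l ++ k))).
    by apply: ag'; [exact: good_cons|rewrite /= rr all_cat aftk].
  transitivity (E[xi] ((s, h) :: k)); first exact: hP.
  apply/esym; apply: ag'; first exact: good_cons.
  by rewrite /= rts.
(* [s] comes before [t]: the representative [f] of [l] under [xi] is kept for [xi']. The part of [k]
   after [t] is folded into [g] at time [t], and unfolded again once [l] has been replaced by
   [f]. *)
- have [f gf fP] := side_s _ gl ls.
  exists f => // k gk ks.
  have /andP[k1s k2s] := filt _ _ ks.
  have [g gg gP] := side_t' _ (good_filter (predC bef) gk) (aftk k).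
  have lt : all (fun p => r p.1 t) l by apply: sub_all ls => p ps; exact: rtr rst.
  have gk1 := good_filter bef gk.
  have glk1 : good (l ++ seq.filter bef k) by rewrite good_cat gl.
  transitivity (E[xi'] (seq.filter (predC bef) k ++ (l ++ seq.filter bef k))).
    apply: eq_ecyl => w; rewrite !ecyl_cat (ecyl_filter bef k).
    by rewrite muleA muleC.
  rewrite gP//; last by rewrite all_cat lt befk.
  transitivity (E[xi] ((t, g) :: (l ++ seq.filter bef k))).
    by apply: ag; [exact: good_cons|rewrite /= rr all_cat lt befk].
  transitivity (E[xi] (l ++ (t, g) :: seq.filter bef k)).
    by apply: eq_ecyl => w; rewrite /= !ecyl_cat /= muleCA.
  rewrite fP; [|exact: good_cons|by rewrite /= rst].
  transitivity (E[xi'] ((s, f) :: (t, g) :: seq.filter bef k)).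
    apply/esym; apply: ag; first by do 2 apply: good_cons => //.
    by rewrite /= rst rr befk.
  transitivity (E[xi'] ((t, g) :: (s, f) :: seq.filter bef k)).
    by apply: eq_ecyl => w; rewrite /= muleCA.
  rewrite -gP; [|exact: good_cons|by rewrite /= rst befk].
  apply: eq_ecyl => w; rewrite /= ecyl_cat /= (ecyl_filter bef k).
  by rewrite muleCA (muleC (ecyl (seq.filter (predC bef) k) w)).
Qed.

(* An invariant of the markovianisations along [F], in any order, which
   determines [xi]: the law of [eta] is kept on families of times separated by
   no element of [F], and [xi] is Markov at the times of [F]. *)
Definition markov_version (F : set R) (eta xi : radon R path) :=
  (forall l : seq datum, good l ->
    (forall s, F s -> all (fun p => p.1 <= s)%R l || all (fun p => s <= p.1)%R l) ->
    E[xi] l = E[eta] l) /\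
  forall s, F s -> side <=%R s xi /\ side >=%R s xi.

Lemma markov_version_step (F : set R) (t : R) (eta xi xi' : radon R path) :
  markov_version F eta xi -> markovianisation mu t xi xi' ->
  markov_version (t |` F) eta xi'.
Proof.
move=> [eqF sideF] /(markovianisation_step polishY Gamma_continuous)[le_ag ge_ag le_side ge_side].
split.
- move=> l gl lF; transitivity (E[xi] l).
    have /orP[lt|lt] := lF t (or_introl erefl); first exact: le_ag.
    exact: ge_ag.
  by apply: eqF => // s Fs; apply: lF; right.
- move=> s [->//|/sideF[le_s ge_s]]; split.
  + apply: (@side_step <=%R s t xi) => //.
    * by move=> x y z; exact: le_trans.
  + apply: (@side_step >=%R s t xi) => //.
    * by move=> x y z /= xy yz; exact: le_trans yz xy.
    * exact: lexx.
Qed.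

Lemma markovianisations_version (s : seq R) (F : set R) (eta xi xi' : radon R path) :
  markov_version F eta xi -> markovianisations mu s xi xi' ->
  markov_version (F `|` [set` s]) eta xi'.
Proof.
elim: s F xi => [|t s ih] F xi vF.
  move=> /= ->; rewrite (_ : [set` [::]] = set0) ?setU0//.
  by apply/seteqP; split.
move=> /= [xi1 /(markov_version_step vF) v1 /(ih _ _ v1)].
rewrite (_ : t |` F `|` [set` s] = F `|` [set` t :: s])//.
apply/seteqP; split => x /=; rewrite in_cons.
  by move=> [[->|Fx]|xs]; [right; rewrite eqxx|left|right; rewrite xs orbT].
by move=> [Fx|/predU1P[->|xs]]; [left; right|left; left|right].
Qed.

Lemma finite_markovianisation_version (F : set R) (eta xi : radon R path) :
  finite_markovianisation mu F eta xi -> markov_version F eta xi.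
Proof.
move=> [s [_ <- sxi]]; rewrite -[X in markov_version X]set0U.
by apply: markovianisations_version sxi.
Qed.

(** Induction on the number of elements of [F] that strictly separate the times of [l]; with none,
    both integrals equal that of [eta]. Otherwise [l] is cut at a separating time [u] into [l1] and
    [l2]; [xi1] represents [l1] by [f] at [u], and [xi2] represents [l2] by [g] at [u]. The chain
    is: under [xi1], (l1, l2) becomes (f, l2); this passes to [xi2] and becomes (f, g); this returns
    to [xi1] and becomes (l1, g); this passes to [xi2] and becomes (l1, l2). In the lists exchanged
    between the two measures [u] no longer separates. *)
Lemma markov_version_cyl (F : set R) (eta xi1 xi2 : radon R path) (l : seq datum) :
  finite_set F -> markov_version F eta xi1 -> markov_version F eta xi2 ->
  good l -> E[xi1] l = E[xi2] l.
Proof.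
move=> /finite_seqP[s ->] v1 v2.
pose sep (k : seq datum) u := has (fun p => p.1 < u)%R k && has (fun p => u < p.1)%R k.
have [n] := ubnP (count (sep l) s); elim: n => // n ih in l *.
rewrite ltnS => ln gl.
have [/hasP[u us ul]|nsep] := boolP (has (sep l) s); last first.
  have lF u : [set` s] u -> all (fun p => p.1 <= u)%R l || all (fun p => u <= p.1)%R l.
    move=> us; have := hasPn nsep u us; rewrite negb_and => /orP[] h; apply/orP.
      right; move: h; rewrite -all_predC; apply: sub_all => p /=.
      by rewrite -leNgt.
    left; move: h; rewrite -all_predC; apply: sub_all => p /=.
    by rewrite -leNgt.
  by rewrite (v1.1 _ gl lF) (v2.1 _ gl lF).
(* The count drops once no new separating time appears and [u] ceases to be one. *)
have less k : (forall w, sep k w -> sep l w) -> ~~ sep k u -> (count (sep k) s < n)%N.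
  move=> kl ku; apply: leq_trans ln.
  elim: s us {v1 v2 ih} => //= w s ihs; rewrite inE => /predU1P[<-|us].
    by rewrite ul (negbTE ku) add0n add1n ltnS; apply: sub_count.
  rewrite -addnS leq_add//; last exact: ihs.
  by case: (sep k w) (kl w) => // ->.
pose bef (p : datum) := (p.1 <= u)%R.
pose l1 := seq.filter bef l; pose l2 := seq.filter (predC bef) l.
have gl1 : good l1 by exact: good_filter.
have gl2 : good l2 by exact: good_filter.
have l1u : all (fun p => p.1 <= u)%R l1.
  by rewrite all_filter; apply/allT => p; apply/implyP.
have l2u : all (fun p => u <= p.1)%R l2.
  by rewrite all_filter; apply/allT => p; apply/implyP; rewrite /= -ltNge => /ltW.
have [f gf fP] := (v1.2 u us).1 _ gl1 l1u.
have [g gg gP] := (v2.2 u us).2 _ gl2 l2u.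
have l1w w : has (fun p => w < p.1)%R l1 -> (w < u)%R.
  apply: contraTT; rewrite -leNgt -all_predC => uw.
  by apply: sub_all l1u => p pu /=; rewrite -leNgt (le_trans pu).
have l2w w : has (fun p => p.1 < w)%R l2 -> (u < w)%R.
  apply: contraTT; rewrite -leNgt -all_predC => wu.
  by apply: sub_all l2u => p up /=; rewrite -leNgt (le_trans wu).
have [ltul ltlu] := andP ul.
have sfl2 : (count (sep ((u, f) :: l2)) s < n)%N.
  apply: less => [w|].
    move=> /= /andP[uw wl].
    have {}uw : (u < w)%R by case/orP: uw => // /l2w.
    have wuF : (w < u)%R = false by apply/negbTE; rewrite -leNgt ltW.
    move: wl; rewrite /= wuF /= => wl.
    rewrite /sep (sub_has _ ltul) => [|p /= up]; last exact: lt_trans up uw.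
    by move: wl; rewrite has_seqfilter; apply: sub_has => p /= /andP[].
  apply/negP; rewrite /sep /= => /andP[+ _]; rewrite ltxx/= => /l2w.
  by rewrite ltxx.
have sfg : (count (sep [:: (u, f); (u, g)]) s < n)%N.
  apply: less => [w|]; last by rewrite /sep /= ltxx.
  by rewrite /sep/= !orbF !orbb => /andP[/lt_trans /[apply]]; rewrite ltxx.
have sl1g : (count (sep (l1 ++ [:: (u, g)])) s < n)%N.
  apply: less => [w|].
    rewrite /sep !has_cat /= !orbF => /andP[wl uw].
    have {}uw : (w < u)%R by case/orP: uw => // /l1w.
    have uwF : (u < w)%R = false by apply/negbTE; rewrite -leNgt ltW.
    move: wl; rewrite uwF ?orbF => wl.
    apply/andP; split; last by apply: sub_has ltlu => p; exact: lt_trans.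
    by move: wl; rewrite has_seqfilter; apply: sub_has => p /= /andP[].
  apply/negP; rewrite /sep !has_cat /= !orbF => /andP[_]; rewrite ltxx orbF => /l1w.
  by rewrite ltxx.
have gl1g : good (l1 ++ [:: (u, g)]) by rewrite good_cat gl1; exact: good_cons.
have gfl2 : good ((u, f) :: l2) by exact: good_cons.
have gfg : good [:: (u, f); (u, g)] by do 2 apply: good_cons => //.
transitivity (E[xi1] (l1 ++ l2)).
  by apply: eq_ecyl => w; rewrite ecyl_cat -ecyl_filter.
rewrite fP// (ih _ sfl2 gfl2).
transitivity (E[xi2] (l2 ++ [:: (u, f)])).
  by apply: eq_ecyl => w; rewrite ecyl_cat /= mule1 muleC.
rewrite gP; [|exact: good_cons|by rewrite /= lexx].
transitivity (E[xi2] [:: (u, f); (u, g)]).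
  by apply: eq_ecyl => w; rewrite /= muleCA.
rewrite -(ih _ sfg gfg) -fP; [|exact: good_cons|by rewrite /= lexx].
rewrite (ih _ sl1g gl1g).
transitivity (E[xi2] ((u, g) :: l1)).
  by apply: eq_ecyl => w; rewrite ecyl_cat /= mule1 muleC.
rewrite -gP//.
by apply: eq_ecyl => w; rewrite ecyl_cat muleC -ecyl_filter.
Qed.

End markov_versions.

Section markov_consequences.
Variables (R : realType) (Y : puniformType).
Variables (Gamma : set {family compact, R -> Y}) (g0 : Gamma).
Hypothesis polishY : locally_compact_polish R Y.
Hypothesis Gamma_continuous : forall g : R -> Y, Gamma g -> continuous g.
Hypothesis Gamma_compact : forall (a b : R) (K : set Y), compact K ->
  compact [set g : path_space g0 | exists2 t, a <= t <= b & K (ev t g)].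
Notation path := (path_space g0).
Variable mu : radon R Y.
Local Notation datum := (R * (borel Y -> \bar R))%type.
Local Open Scope ereal_scope.
Local Notation "'E[' xi ] l" := (\int[xi]_g ecyl (g0 := g0) l g) (at level 10, l at level 9).

Let hY : hausdorff_space Y.
Proof. by have [_ /metrizable_hausdorff] := polishY. Qed.

Definition Cc_datum (p : R * Cc R Y) : datum := (p.1, EFin \o p.2).

Lemma Cc_datum_good P (l : seq (R * Cc R Y)) : cyl_data P l -> good (map Cc_datum l).
Proof.
rewrite /cyl_data /= /good all_map; apply: sub_all => p /asboolP[_ p0] /=.
apply/asboolP; split; first exact: Cc_measurable.
by move=> y; rewrite /= lee_fin; exact: p0.
Qed.

Lemma ecyl_Cc p l g : ecyl (g0 := g0) (map Cc_datum (p :: l)) g =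
  (Cc_cyl Gamma_continuous Gamma_compact p l g)%:E.
Proof.
elim: l p => [|q l ih] p /=; first by rewrite mule1.
by have /= -> := ih q; rewrite EFinM.
Qed.

(** Neither the ordering of [F] nor the disintegrations chosen at each step matter: by
    [markov_version_cyl] the integrals of cylinder functions are determined by [F] and [eta]. *)
Lemma finite_markovianisation_unique (F : set R) (eta xi1 xi2 : radon R path) :
  finite_markovianisation mu F eta xi1 -> finite_markovianisation mu F eta xi2 ->
  forall A, measurable A -> xi1 A = xi2 A.
Proof.
move=> F1 F2 A mA.
have fF : finite_set F by have [s [_ <- _]] := F1; exact: finite_seq.
have v1 := finite_markovianisation_version polishY Gamma_continuous F1.
have v2 := finite_markovianisation_version polishY Gamma_continuous F2.
apply: (@cyl_measure_unique _ _ _ _ polishY Gamma_continuous Gamma_compact setT xi1 xi2).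
- by exists 0%R.
- by have [] := radonP xi1.
- by have [] := radonP xi2.
- move=> p l pl.
  have e (m : radon R path) : \int[m]_x (EFin \o Cc_cyl Gamma_continuous Gamma_compact p l) x =
      E[m] (map Cc_datum (p :: l)).
    by apply: eq_integral => g _; exact: (esym (ecyl_Cc p l g)).
  rewrite !e; exact: markov_version_cyl fF v1 v2 (Cc_datum_good pl).
- exact: borel_path_cyl.
Qed.

(** A single time is separated by no element of [F]. *)
Lemma markov_version_marginals (F : set R) (eta xi : radon R path) :
  has_marginals mu eta -> markov_version F eta xi -> has_marginals mu xi.
Proof.
move=> etaM [v _] t B mB; apply: etrans _ (etaM t B mB); rewrite /pushforward.
have gB : ge0_measurable (EFin \o \1_B : borel Y -> \bar R).
  split; last by move=> y; rewrite /= lee_fin.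
  by apply/measurable_EFinP; exact: measurable_indic.
have mE : measurable ((@ev _ _ _ g0 t : borel path -> borel Y) @^-1` B).
  rewrite -[X in measurable X]setTI.
  exact: (@measurable_ev _ _ _ g0 Gamma_continuous t measurableT B mB).
have intE (m : {measure set (borel path) -> \bar R}) :
    E[m] [:: (t, EFin \o \1_B)] = m ((@ev _ _ _ g0 t : borel path -> borel Y) @^-1` B).
  rewrite -[X in _ = m X]setIT -integral_indic//.
  by apply: eq_integral => g _; rewrite /= mule1 !indicE.
rewrite -!intE; apply: v.
- by apply: good_cons.
- move=> s _ /=; rewrite !andbT.
  by case/orP: (real_leVge (num_real t) (num_real s)) => ->; rewrite ?orbT.
Qed.

Lemma disintegration_unique (xi1 xi2 : radon R path) (t : R) (nu : prob_family g0 mu) :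
  (forall A, measurable A -> xi1 A = xi2 A) ->
  disintegration xi1 t nu -> disintegration xi2 t nu.
Proof.
move=> x12 [nut [nuB xi1E]]; split => //; split => // B mB.
by rewrite -x12// xi1E.
Qed.

Lemma disintegration_integral (xi : radon R path) (t : R) (nu : prob_family g0 mu)
    (h : borel Y -> \bar R) (l : seq datum) :
  disintegration xi t nu -> ge0_measurable h -> good l ->
  E[xi] ((t, h) :: l) = \int[mu]_y (h y * E[fiber nu y] l).
Proof.
move=> [nut nuxi] gh gl; have ghl := good_cons t gh gl.
apply: (etrans (mixture_integral nuxi _ _)).
- by apply: ecyl_measurable.
- by move=> g; exact: ecyl_ge0.
apply: eq_integral => y _.
apply: (concentrated_integral Gamma_continuous hY y nut gh).
- by apply: ecyl_measurable.
- by move=> g; exact: ecyl_ge0.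
Qed.

Lemma ge0_measurableM (f h : borel Y -> \bar R) :
  ge0_measurable f -> ge0_measurable h -> ge0_measurable (fun y => f y * h y).
Proof.
move=> [mf f0] [mh h0]; split; first exact: emeasurable_funM.
by move=> y; exact: mule_ge0.
Qed.

(** The representative [f] of [l] is used twice: to replace [l] in the presence of [k] and the
    weight [h], and then backwards, to restore [l] in the presence of [h] times the fiber
    expectation of [k], a function of g(t). So [f] need not be identified with the fiber expectation
    of [l]. *)
Lemma side_disintegration (xi : radon R path) (t : R) (nu : prob_family g0 mu)
    (h : borel Y -> \bar R) (l k : seq datum) :
  side <=%R t xi -> disintegration xi t nu -> ge0_measurable h ->
  good l -> good k -> all (fun p => p.1 <= t)%R l -> all (fun p => t <= p.1)%R k ->
  \int[mu]_y (h y * E[fiber nu y] (l ++ k)) =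
  \int[mu]_y (h y * (E[fiber nu y] l * E[fiber nu y] k)).
Proof.
move=> side_t dis gh gl gk lt kt; have [f gf fP] := side_t _ gl lt.
have glk : good (l ++ k) by rewrite good_cat gl.
have gK : ge0_measurable (fun y : borel Y => E[fiber nu y] k).
  apply: fiber_integral_measurable; first by case: dis => _ [].
  - exact: ecyl_measurable.
  - by move=> g; exact: ecyl_ge0.
have ghK := ge0_measurableM gh gK.
rewrite -(disintegration_integral dis gh glk).
transitivity (E[xi] (l ++ (t, h) :: k)).
  by apply: eq_ecyl => g; rewrite /= !ecyl_cat /= muleCA.
rewrite fP; [|exact: good_cons|by rewrite /= lexx].
rewrite (disintegration_integral dis gf (good_cons t gh gk)).
transitivity (\int[mu]_y (f y * E[fiber nu y] [:: (t, fun y => h y * E[fiber nu y] k)])).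
  apply: eq_integral => y _; congr (_ * _).
  have nut : concentrated t nu by case: dis.
  apply: (etrans (concentrated_integral Gamma_continuous hY y nut gh _ _)).
  - exact: ecyl_measurable.
  - by move=> g; exact: ecyl_ge0.
  apply: (etrans _ (esym (concentrated_integral Gamma_continuous hY y nut ghK (f := ecyl [::]) _ _))).
  - rewrite /= integral_cst// mul1e.
    have [sy|nsy] := pselect (supp mu y); last first.
      by rewrite !fiber_out// integral_measure_zero mule0 mul0e.
    rewrite -[y]/(\val (SigSub (mem_set sy) : supp mu)) !fiberE.
    by rewrite probT mule1.
  - exact: ecyl_measurable.
  - by move=> g; exact: ecyl_ge0.
have gt : good [:: (t, fun y : borel Y => h y * E[fiber nu y] k)] by exact: good_cons.
rewrite -(disintegration_integral dis gf gt) -fP//; last by rewrite /= lexx.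
transitivity (E[xi] ((t, fun y : borel Y => h y * E[fiber nu y] k) :: l)).
  by apply: eq_ecyl => g; rewrite /= ecyl_cat /= mule1 muleC.
rewrite (disintegration_integral dis ghK gl).
by apply: eq_integral => y _; rewrite -muleA [X in _ * X]muleC.
Qed.

End markov_consequences.

(** * Vague limits of disintegrations *)

Section vague_topology.
Variables (R : realType) (T : ptopologicalType).

(** Exhibits the pseudometric of [Phi] inside the uniformity of pointwise convergence, so that
    convergence of families gives uniform estimates on compact sets. *)
Lemma vague_entourage (Phi : Cc R T) (e : R) : 0 < e ->
  entourage [set mm : prob R T * prob R T |
    `|vague_eval (\val mm.1) Phi - vague_eval (\val mm.2) Phi| < e].
Proof.
move=> e0.
pose B : set ({ptws Cc R T -> R} * {ptws Cc R T -> R}) :=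
  [set fg | `|fg.1 Phi - fg.2 Phi| < e].
have eB : entourage B.
  rewrite /entourage /= /sup_ent /= smallest_filter_finI.
  move=> r /= [_]; apply => /=.
  pose Phi' : {classic Cc R T} := Phi.
  suff /asboolP entE : @entourage (initial_topology (@proj _ (fun _ : Cc R T => R) Phi)) (Phi', B).2.
    by exists (exist _ (Phi', B) entE).
  exists [set xy : R * R | `|xy.1 - xy.2| < e] => //=.
  rewrite -entourage_ballE; exists e => //=.
by exists [set mm : radon R T * radon R T | B (vague_eval mm.1, vague_eval mm.2)] => //; exists B.
Qed.

Lemma vague_eval_continuous (Phi : Cc R T) :
  continuous (fun m : radon R T => vague_eval m Phi).
Proof.
move=> m; apply: (@continuous_comp _ {ptws Cc R T -> R} _ (@vague_eval R T)
  (fun f => f Phi)).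
  exact: (@initial_continuous (radon R T) {ptws Cc R T -> R} (@vague_eval R T)).
exact: (@proj_continuous {classic Cc R T} (fun=> R) Phi).
Qed.

Lemma vague_cvg (F : set_system (radon R T)) (m : radon R T) : Filter F ->
  (forall Phi, vague_eval m' Phi @[m' --> F] --> vague_eval m Phi) -> F --> m.
Proof.
move=> FF Fm A [_ [[B oB <-] /= Bm BA]].
apply: filterS BA _.
suff : (@vague_eval R T) m' @[m' --> F] --> (vague_eval m : {ptws Cc R T -> R}).
  by apply; apply: open_nbhs_nbhs.
apply/cvg_sup => Phi C [_ [[D oD <-] /= Dm DC]].
apply: filterS DC _.
by apply: (Fm Phi); apply: open_nbhs_nbhs.
Qed.

End vague_topology.

Section supports.
Variables (R : realType) (Y : puniformType) (mu : radon R Y).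

Lemma supp_preimage_compact (K : set Y) : hausdorff_space Y -> compact K ->
  compact ((\val : supp mu -> Y) @^-1` K).
Proof.
move=> hY cK F PF FK.
have PF' : ProperFilter ((\val : supp mu -> Y) @ F) by exact: fmap_proper_filter.
have [y [Ky Fy]] := cK _ PF' FK.
have im A : F A -> ((\val : supp mu -> Y) @ F) (\val @` A).
  move=> FA; suff : F (\val @^-1` (\val @` A)) by [].
  by apply: filterS FA => x Ax; exists x.
have sy : supp mu y.
  apply: supp_closed => A yA; have [_ [[x _ <-] Ax]] := Fy _ _ (im _ filterT) yA.
  by exists (\val x); split => //; exact: set_mem (valP x).
exists (SigSub (mem_set sy)); split => //.
move=> A B FA [_ [[C oC <-] /= Cy CB]].
have yC : nbhs y C by apply: open_nbhs_nbhs.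
have [_ [[x Ax <-] Cx]] := Fy _ _ (im _ FA) yC.
by exists x; split => //; exact: CB.
Qed.

Lemma supp_extension_measurable (h : supp mu -> R) (g : Y -> R) :
  continuous h -> (forall x, g (\val x) = h x) ->
  (forall y, ~ supp mu y -> g y = 0) -> measurable_fun setT (g : borel Y -> R).
Proof.
move=> ch gh g0.
have mS : measurable (supp mu : set (borel Y)) by apply: borel_closed; exact: supp_closed.
rewrite -(setUv (supp mu)); apply/measurable_funU => //; first exact: measurableC.
split; last first.
  apply: (@eq_measurable_fun _ _ (borel Y) R _ (cst 0)); last exact: measurable_cst.
  by move=> y /set_mem nsy; rewrite g0.
apply: (measurability _ (RGenOpens.measurableE R)) => _ [_ [a [b ->] <-]].
have : open (h @^-1` `]a, b[) by move/continuousP: ch; apply; exact: interval_open.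
case=> O oO hO.
rewrite (_ : supp mu `&` _ = supp mu `&` O).
  by apply: measurableI => //; exact: borel_open.
apply/seteqP; split => y [sy Oy]; split => //.
- rewrite -[y]/(\val (SigSub (mem_set sy) : supp mu)).
  suff : (h @^-1` `]a, b[) (SigSub (mem_set sy) : supp mu) by rewrite -hO.
  by rewrite /= -gh.
- have : (\val @^-1` O) (SigSub (mem_set sy) : supp mu) by [].
  by rewrite hO /= -gh.
Qed.

(** Inner regularity reduces the claim to compact sets, each covered by finitely many open sets of
    measure 0. *)
Lemma supp_measure0 : hausdorff_space Y -> mu (~` supp mu) = 0%E.
Proof.
move=> hY; have [fin reg] := radonP mu.
have mC : measurable (~` supp mu : set (borel Y)).
  by apply: measurableC; apply: borel_closed; exact: supp_closed.
apply/eqP; rewrite eq_le measure_ge0 andbT (reg _ mC).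
apply: ge_ereal_sup => _ [K [cK KS] <-].
rewrite compact_cover in cK.
pose D : set (set Y) := [set U | open U /\ mu U = 0%E].
have [U|y Ky|D' D'D KD'] := cK _ D id; first by case.
  have : ~ supp mu y by exact: KS.
  move=> /existsNP[U /not_implyP[oU /not_implyP[Uy /negP]]].
  rewrite -leNgt => mU0; exists U => //; split => //.
  by apply/eqP; rewrite eq_le mU0 measure_ge0.
have [oD' mD'] : D (cover [set` D'] id).
  rewrite /cover bigcup_fset big_seq; apply: (big_ind D).
  - by split; [exact: open0|exact: measure0].
  - move=> A B [oA mA] [oB mB]; split; first exact: openU.
    apply/eqP; rewrite eq_le measure_ge0 andbT.
    have : (mu (A `|` B) <= mu A + mu B)%E by apply: measureU2; exact: borel_open.
    by rewrite mA mB adde0.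
  - by move=> U /D'D /set_mem.
rewrite -mD'; apply: (le_measure mu) => //; apply/mem_set.
- by apply: borel_closed; apply: compact_closed => //; rewrite compact_cover.
- exact: borel_open.
Qed.

End supports.

Section weighted_limits.
Variables (R : realType) (Y : puniformType) (mu : radon R Y).

Lemma Cc_weight_integrable (psi : Cc R Y) (h : borel Y -> R) (c : R) :
  measurable_fun setT h -> (forall y, `|h y| <= c) ->
  mu.-integrable setT (EFin \o (fun y : borel Y => psi y * h y)).
Proof.
move=> mh hc; have [fin _] := radonP mu.
apply: (@le_integrable _ _ _ _ _ measurableT _ (fun y : borel Y => c%:E * (EFin \o psi) y)%E).
- apply/measurable_EFinP; apply: measurable_funM => //.
  by apply: continuous_borel_real; exact: Cc_continuous.
- move=> y _; rewrite /= lee_fin mulrC !normrM ler_wpM2r//.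
  by rewrite (le_trans (hc y))// ler_norm.
- by apply: integrableZl => //; exact: Cc_integrable.
Qed.

(** Dominated convergence fails along general filters; uniform convergence on the compact support of
    [psi] replaces it. *)
Lemma weighted_cvg (J : Type) (F : set_system J) (psi : Cc R Y)
    (h_ : J -> borel Y -> R) (h : borel Y -> R) (c : R) : Filter F ->
  (forall j, measurable_fun setT (h_ j)) -> measurable_fun setT h ->
  (forall j y, `|h_ j y| <= c) -> (forall y, `|h y| <= c) ->
  (forall (K : set Y) e, compact K -> 0 < e ->
    \forall j \near F, forall y, K y -> `|h_ j y - h y| < e) ->
  \int[mu]_y (psi y * h_ j y) @[j --> F] --> \int[mu]_y (psi y * h y).
Proof.
move=> FF mh_ mh h_c hc unif; have [fin _] := radonP mu.
pose I := \int[mu]_y `|psi y|.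
have ipsi : mu.-integrable setT (EFin \o (fun y : borel Y => `|psi y|)).
  exact: (integrable_abse (Cc_integrable (m := mu) psi fin)).
have I0 : 0 <= I by apply: Rintegral_ge0.
apply/cvgrPdist_lt => e e0.
(* The 1 keeps the denominator positive and the final inequality strict when [I] is 0. *)
have d0 : 0 < e / (I + 1) by rewrite divr_gt0// ltr_wpDl.
have cS := @Cc_compact _ _ psi.
near=> j.
have hj : forall y, closure [set y | psi y != 0] y -> `|h_ j y - h y| < e / (I + 1).
  by near: j; exact: unif.
have i1 := Cc_weight_integrable psi mh hc.
have i2 := Cc_weight_integrable psi (mh_ j) (h_c j).
rewrite -RintegralB//.
have le1 (y : borel Y) : `|psi y * h y - psi y * h_ j y| <= e / (I + 1) * `|psi y|.
  rewrite -mulrBr normrM mulrC distrC.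
  have [->|py0] := eqVneq (psi y) 0; first by rewrite normr0 !mulr0.
  by apply: ler_wpM2r => //; apply/ltW/hj; exact: subset_closure.
have i3 : mu.-integrable setT (EFin \o (fun y : borel Y => psi y * h y - psi y * h_ j y)).
  exact: (integrableB measurableT i1 i2).
have i4 : mu.-integrable setT (EFin \o (fun y : borel Y => e / (I + 1) * `|psi y|)).
  exact: (integrableZl measurableT (e / (I + 1)) ipsi).
apply: le_lt_trans (le_normr_Rintegral measurableT i3) _.
apply: (@le_lt_trans _ _ (\int[mu]_y (e / (I + 1) * `|psi y|))).
  apply: le_Rintegral => //; exact: (integrable_abse i3).
rewrite RintegralZl// -/I mulrAC ltr_pdivrMr ?ltr_wpDl//.
by rewrite ltr_pM2l// ltrDl.
Unshelve. all: by end_near. Qed.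

End weighted_limits.

Section fiber_functions.
Variables (R : realType) (Y : puniformType).
Variables (Gamma : set {family compact, R -> Y}) (g0 : Gamma).
Notation path := (path_space g0).
Variable mu : radon R Y.
Implicit Types Phi : Cc R path.

Definition fint (nu : prob_family g0 mu) (Phi : Cc R path) (y : borel Y) : R :=
  \int[fiber nu y]_g (Phi : borel path -> R) g.

Lemma fint_val (nu : prob_family g0 mu) Phi (x : supp mu) :
  fint nu Phi (\val x) = vague_eval (\val (nu x)) Phi.
Proof. by rewrite /fint fiberE. Qed.

Lemma fint_out (nu : prob_family g0 mu) Phi y : ~ supp mu y -> fint nu Phi y = 0.
Proof. by move=> ny; rewrite /fint fiber_out// /Rintegral integral_measure_zero. Qed.

Lemma fiber_fin (nu : prob_family g0 mu) y (K : set path) : compact K ->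
  (fiber nu y K < +oo)%E.
Proof.
move=> cK; have [sy|nsy] := pselect (supp mu y); last by rewrite fiber_out// ltry.
rewrite -[y]/(\val (SigSub (mem_set sy) : supp mu)) fiberE.
by have [fin _] := radonP (\val (nu (SigSub (mem_set sy)))); exact: fin.
Qed.

Lemma fintE (nu : prob_family g0 mu) Phi y :
  (\int[fiber nu y]_g (EFin \o Phi : borel path -> \bar R) g = (fint nu Phi y)%:E)%E.
Proof.
rewrite /fint /Rintegral fineK//; apply: integrable_fin_num => //.
by apply: Cc_integrable; exact: fiber_fin.
Qed.

Lemma fint_le (nu : prob_family g0 mu) Phi y c : 0 <= c ->
  (forall g, `|Phi g| <= c) -> `|fint nu Phi y| <= c.
Proof.
move=> c0 Pc; have [sy|nsy] := pselect (supp mu y); last by rewrite fint_out// normr0.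
rewrite /fint -[y]/(\val (SigSub (mem_set sy) : supp mu)) fiberE.
set m := prob_measure _; have mT : m setT = 1%E by exact: probT.
have fin : forall K : set path, compact K -> (m K < +oo)%E by case: (radonP (\val (nu (SigSub (mem_set sy))))).
have iP := Cc_integrable Phi fin.
apply: le_trans (le_normr_Rintegral measurableT iP) _.
have -> : c = \int[m]_g c by rewrite Rintegral_cst// mT mulr1.
apply: le_Rintegral => //; first exact: (integrable_abse iP).
apply/integrableP; split; first by apply/measurable_EFinP; exact: measurable_cst.
by rewrite integral_cst// mT mule1 ltry.
Qed.

Lemma fint_measurable (nu : prob_family g0 mu) Phi :
  continuous (nu : supp mu -> prob R path) -> measurable_fun setT (fint nu Phi).
Proof.
move=> cnu; apply: (@supp_extension_measurable _ _ mu (fun x => vague_eval (\val (nu x)) Phi)).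
- move=> x; apply: (@continuous_comp _ (radon R path) R (fun x => \val (nu x))
    (fun m => vague_eval m Phi)).
    apply: (@continuous_comp _ (prob R path) (radon R path) nu \val); first exact: cnu.
    exact: initial_continuous.
  exact: vague_eval_continuous.
- by move=> x; rewrite fint_val.
- by move=> y; exact: fint_out.
Qed.

Lemma fint_continuous (nu : prob_family g0 mu) Phi :
  continuous (nu : supp mu -> prob R path) ->
  continuous (fun x : supp mu => fint nu Phi (\val x)).
Proof.
move=> cnu; rewrite (_ : (fun x => _) = fun x => vague_eval (\val (nu x)) Phi); last first.
  by apply/funext => x; exact: fint_val.
move=> x; apply: (@continuous_comp _ (radon R path) R (fun x => \val (nu x))
    (fun m => vague_eval m Phi)).
  apply: (@continuous_comp _ (prob R path) (radon R path) nu \val); first exact: cnu.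
  exact: initial_continuous.
exact: vague_eval_continuous.
Qed.

Lemma fint_cvg (J : Type) (F : set_system J) (nu_ : J -> prob_family g0 mu)
    (nu : prob_family g0 mu) (Phi : Cc R path) (K : set Y) (e : R) :
  hausdorff_space Y -> Filter F -> nu_ j @[j --> F] --> nu -> compact K -> 0 < e ->
  \forall j \near F, forall y, K y -> `|fint (nu_ j) Phi y - fint nu Phi y| < e.
Proof.
move=> hY FF nunu cK e0.
have cS := supp_preimage_compact (mu := mu) hY cK.
have := fam_nbhs (fam := compact) nu (vague_entourage Phi e0) cS.
move=> /nunu h; apply: (@filterS J F FF _ _ _ h) => j /= nuj y Ky.
have [sy|nsy] := pselect (supp mu y); last by rewrite !fint_out// subrr normr0.
rewrite -[y]/(\val (SigSub (mem_set sy) : supp mu)) !fint_val distrC.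
exact: nuj.
Qed.

End fiber_functions.

Section limits.
Variables (R : realType) (Y : puniformType).
Variables (Gamma : set {family compact, R -> Y}) (g0 : Gamma).
Hypothesis polishY : locally_compact_polish R Y.
Hypothesis Gamma_continuous : forall g : R -> Y, Gamma g -> continuous g.
Hypothesis Gamma_compact : forall (a b : R) (K : set Y), compact K ->
  compact [set g : path_space g0 | exists2 t, a <= t <= b & K (ev t g)].
Notation path := (path_space g0).
Notation Ev := (@ev R Y Gamma g0).
Variable mu : radon R Y.
Implicit Types (Phi : Cc R path) (psi : Cc R Y).

Let hY : hausdorff_space Y.
Proof. by have [_ /metrizable_hausdorff] := polishY. Qed.

Let ev_meas t : measurable_fun setT (Ev t : borel path -> borel Y).
Proof. exact: measurable_ev. Qed.

(** The estimate is uniform over all paths. Those meeting the support of [psi] during [t-1, t+1]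
    form a compact set, on which joint continuity of evaluation gives uniformity; for the others
    both values of [psi] are 0. *)
Lemma ev_Cc_equicontinuous psi (t e : R) : 0 < e ->
  \forall s \near t, forall g : path, `|psi (Ev s g) - psi (Ev t g)| < e.
Proof.
move=> e0; pose S := closure [set y | psi y != 0].
have cK := @Gamma_compact (t - 1) (t + 1) _ (@Cc_compact _ _ psi).
have /compact_near_coveringP cover := cK.
have nearK : \forall s \near t, forall g : path,
    (exists2 r, t - 1 <= r <= t + 1 & S (Ev r g)) -> `|psi (Ev s g) - psi (Ev t g)| < e.
  refine (cover R (nbhs t) (fun s g => `|psi (Ev s g) - psi (Ev t g)| < e) _ _) => g _.
  have psic : {for Ev t g, continuous psi} by exact: Cc_continuous.
  have e20 : 0 < e / 2 by rewrite divr_gt0.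
  have nb : nbhs (Ev t g) [set y | `|psi (Ev t g) - psi y| < e / 2].
    exact: (psic _ (nbhsx_ballx (psi (Ev t g)) _ e20)).
  have [[A B] /= [gA tB] AB] := @ev_joint_continuous _ _ _ g0 Gamma_continuous g t _ nb.
  exists (A, B) => // -[h s] /= [Ah Bs].
  have /= h1 := AB (h, s) (conj Ah Bs).
  have /= h2 := AB (h, t) (conj Ah (nbhs_singleton tB)).
  rewrite (splitr e) (_ : _ - _ = (psi (Ev t g) - psi (Ev t h)) - (psi (Ev t g) - psi (Ev s h))).
    by rewrite (le_lt_trans (ler_normB _ _))// ltrD.
  lra.
near=> s => g.
have [gK|ngK] := pselect (exists2 r, t - 1 <= r <= t + 1 & S (Ev r g)).
  by move: g gK; near: s.
have zero r : t - 1 <= r <= t + 1 -> psi (Ev r g) = 0.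
  move=> tr; apply: contrapT => /eqP pr; apply: ngK; exists r => //.
  exact: subset_closure.
have tt1 : t - 1 <= t <= t + 1 by apply/andP; split; lra.
have ts1 : t - 1 <= s <= t + 1.
  have : `|t - s| < 1 by near: s; exact: (nbhsx_ballx t 1 ltr01).
  by move/ltW; rewrite ler_distlC.
by rewrite (zero _ ts1) (zero _ tt1) subrr normr0.
Unshelve. all: by end_near. Qed.

Lemma marginal_integral (xi : radon R path) (t : R) (h : borel Y -> \bar R) :
  has_marginals mu xi -> ge0_measurable h ->
  (\int[xi]_g h (Ev t g : borel Y) = \int[mu]_y h y)%E.
Proof.
move=> xiM [mh h0].
have := @ge0_integral_pushforward _ _ (borel path) (borel Y) R (Ev t) (@ev_meas t) xi
  setT h measurableT mh (fun y _ => h0 y).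
rewrite preimage_setT => <-.
by apply: eq_measure_integral => A mA _; exact: xiM.
Qed.

(** |Phi(g)| is at most c chi(g(0)), where [chi] is 1 on the compact set of values at time 0 of the
    paths in the support of [Phi]. The integral of chi(g(0)) depends on the marginal only, hence a
    bound common to all [xi]. *)
Lemma Cc_marginal_bound Phi : exists C, forall xi : radon R path,
  has_marginals mu xi -> \int[xi]_g `|Phi g| <= C.
Proof.
have [c cP] := Cc_bounded Phi.
have cS : compact (Ev 0 @` closure [set g | Phi g != 0]).
  apply: continuous_compact; last exact: Cc_compact.
  by apply: continuous_subspaceT => g; exact: ev_continuous.
have [chi [chi01 chi1 _]] := Cc_urysohn polishY cS openT (@subsetT _ _).
exists (c * \int[mu]_y chi y) => xi xiM; have [fin _] := radonP xi.
have gchi : ge0_measurable (EFin \o chi : borel Y -> \bar R).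
  by split; [exact: Cc_measurable|move=> y; rewrite lee_fin; have /andP[] := chi01 y].
have -> : \int[mu]_y chi y = \int[xi]_g chi (Ev 0 g).
  rewrite /Rintegral; congr fine.
  exact: (esym (marginal_integral 0 xiM gchi)).
have ichi := Cc_integrable (Cc_ev Gamma_continuous Gamma_compact 0 chi) fin.
rewrite -RintegralZl//.
apply: le_Rintegral => //.
- exact: (integrable_abse (Cc_integrable Phi fin)).
- exact: (integrableZl measurableT c ichi).
- move=> g _ /=; have [Sg|nSg] := pselect (closure [set g | Phi g != 0] g).
    by rewrite chi1 ?mulr1//; exists g.
  have -> : Phi g = 0.
    by apply: contrapT => /eqP Px; apply: nSg; exact: subset_closure.
  rewrite normr0 mulr_ge0//; last by have /andP[] := chi01 (Ev 0 g).
  exact: le_trans (cP g).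
Qed.

Lemma disintegration_fint (xi : radon R path) (t : R) (nu : prob_family g0 mu) psi Phi :
  disintegration xi t nu -> (forall y, 0 <= psi y) -> (forall g, 0 <= Phi g) ->
  \int[xi]_g (psi (Ev t g) * Phi g) = \int[mu]_y (psi y * fint nu Phi y).
Proof.
move=> [nut nuxi] psi0 Phi0; rewrite /Rintegral; congr fine.
have mPhi := Cc_measurable Phi.
have mpsi := Cc_measurable psi.
have gpsi : ge0_measurable (EFin \o psi : borel Y -> \bar R).
  by split => // y; rewrite /= lee_fin.
transitivity (\int[xi]_g ((EFin \o psi : borel Y -> \bar R) (Ev t g) * (EFin \o Phi) g))%E.
  by apply: eq_integral => g _.
apply: (etrans (mixture_integral nuxi _ _)).
- apply: emeasurable_funM => //; exact: (measurableT_comp mpsi (@ev_meas t)).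
- by move=> g; rewrite /= -EFinM lee_fin mulr_ge0.
apply: eq_integral => y _.
apply: (etrans (concentrated_integral Gamma_continuous hY y nut gpsi mPhi _)).
- by move=> g; rewrite /= lee_fin.
by rewrite fintE.
Qed.

Section limit.
Variables (J : Type) (F : set_system J).
Hypothesis FF : ProperFilter F.
Variables (t_ : J -> R) (t : R) (eta_ : J -> radon R path)
  (nu_ : J -> prob_family g0 mu) (nu : prob_family g0 mu).
Hypothesis t_cvg : t_ j @[j --> F] --> t.
Hypothesis nu_cvg : nu_ j @[j --> F] --> nu.
Hypothesis eta_marg : forall j, has_marginals mu (eta_ j).
Hypothesis nu_dis : forall j, disintegration (eta_ j) (t_ j) (nu_ j).
Hypothesis nu_cont_ : forall j, continuous (nu_ j : supp mu -> prob R path).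
Hypothesis nu_cont : continuous (nu : supp mu -> prob R path).

(** With the weight taken at [t_ j] the disintegration gives an exact formula, which converges by
    [weighted_cvg]. Moving the weight to the fixed time [t] costs at most the uniform oscillation of
    [psi] along paths times the bound [C] common to all [j]. *)
Lemma limit_fint psi Phi : (forall y, 0 <= psi y) -> (forall g, 0 <= Phi g) ->
  \int[eta_ j]_g (psi (Ev t g) * Phi g) @[j --> F] --> \int[mu]_y (psi y * fint nu Phi y).
Proof.
move=> psi0 Phi0; have [c cP] := Cc_bounded Phi.
have c0 : 0 <= c by exact: le_trans (cP g0).
have lim1 : \int[eta_ j]_g (psi (Ev (t_ j) g) * Phi g) @[j --> F] -->
    \int[mu]_y (psi y * fint nu Phi y).
  rewrite (_ : (fun j => _) = fun j => \int[mu]_y (psi y * fint (nu_ j) Phi y)); last first.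
    by apply/funext => j; exact: disintegration_fint.
  apply: (@weighted_cvg _ _ mu J F psi (fun j => fint (nu_ j) Phi) (fint nu Phi) c).
  - by move=> j; exact: fint_measurable.
  - exact: fint_measurable.
  - by move=> j y; exact: fint_le.
  - by move=> y; exact: fint_le.
  - by move=> K e cK e0; exact: fint_cvg.
have [C CP] := Cc_marginal_bound Phi.
have [j0 _] := filter_ex (filterT : F setT).
have C0 : 0 <= C by apply: le_trans (CP _ (eta_marg j0)); exact: Rintegral_ge0.
pose d_ j : R := \int[eta_ j]_g (psi (Ev t g) * Phi g) -
  \int[eta_ j]_g (psi (Ev (t_ j) g) * Phi g).
suff lim2 : d_ j @[j --> F] --> (0 : R).
  rewrite (_ : (fun j => _) = fun j => d_ j + \int[eta_ j]_g (psi (Ev (t_ j) g) * Phi g)).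
    by rewrite -[X in _ --> X]add0r; exact: cvgD lim2 lim1.
  by apply/funext => j; rewrite /d_ subrK.
apply/cvgrPdist_lt => e e0.
have d0 : 0 < e / (C + 1) by rewrite divr_gt0// ltr_wpDl.
have near_t : \forall j \near F, forall g : path,
    `|psi (Ev (t_ j) g) - psi (Ev t g)| < e / (C + 1).
  exact: t_cvg (ev_Cc_equicontinuous psi t d0).
near=> j; rewrite sub0r normrN /d_.
have tj : forall g : path, `|psi (Ev (t_ j) g) - psi (Ev t g)| < e / (C + 1).
  by near: j.
have [fin _] := radonP (eta_ j).
have i1 := Cc_integrable (Cc_mul (Cc_ev Gamma_continuous Gamma_compact t psi) Phi) fin.
have i2 := Cc_integrable (Cc_mul (Cc_ev Gamma_continuous Gamma_compact (t_ j) psi) Phi) fin.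
have i3 := integrable_abse (Cc_integrable Phi fin).
rewrite -RintegralB//.
apply: le_lt_trans (le_normr_Rintegral measurableT (integrableB measurableT i1 i2)) _.
apply: (@le_lt_trans _ _ (\int[eta_ j]_g (e / (C + 1) * `|Phi g|))).
  apply: le_Rintegral => //.
  - exact: (integrable_abse (integrableB measurableT i1 i2)).
  - exact: (integrableZl measurableT (e / (C + 1)) i3).
  - move=> g _ /=; rewrite -mulrBl normrM ler_wpM2r// distrC.
    exact: ltW.
rewrite RintegralZl//.
apply: (@le_lt_trans _ _ (e / (C + 1) * C)).
  by apply: ler_wpM2l; [exact: ltW|exact: CP].
by rewrite mulrAC ltr_pdivrMr ?ltr_wpDl// ltr_pM2l// ltrDl.
Unshelve. all: by end_near. Qed.

End limit.
End limits.

Section limit_families.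
Variables (R : realType) (Y : puniformType).
Variables (Gamma : set {family compact, R -> Y}) (g0 : Gamma).
Hypothesis polishY : locally_compact_polish R Y.
Hypothesis Gamma_continuous : forall g : R -> Y, Gamma g -> continuous g.
Hypothesis Gamma_compact : forall (a b : R) (K : set Y), compact K ->
  compact [set g : path_space g0 | exists2 t, a <= t <= b & K (ev t g)].
Notation path := (path_space g0).
Notation Ev := (@ev R Y Gamma g0).
Notation Cc_ev := (Cc_ev Gamma_continuous Gamma_compact).
Notation Cc_cyl := (Cc_cyl Gamma_continuous Gamma_compact).
Variable mu : radon R Y.
Implicit Types (Phi : Cc R path) (psi : Cc R Y).

Let hY : hausdorff_space Y.
Proof. by have [_ /metrizable_hausdorff] := polishY. Qed.

(** If [h] exceeded [k] at [x], it would do so on [supp mu] near [x]. For [psi] supported there,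
    [psi] times (h - k) is nonnegative with integral 0, hence 0 almost everywhere, though positive
    on [supp mu] wherever [psi] is. The open set where [psi] is positive would then be null, against
    [x] being in the support. The conclusion is one-sided; equality comes from exchanging [h] and
    [k]. *)
Lemma weights_determine (h k : borel Y -> R) (c : R) :
  measurable_fun setT h -> measurable_fun setT k ->
  (forall y, `|h y| <= c) -> (forall y, `|k y| <= c) ->
  (forall y, ~ supp mu y -> h y = 0) -> (forall y, ~ supp mu y -> k y = 0) ->
  continuous (fun x : supp mu => h (\val x)) ->
  continuous (fun x : supp mu => k (\val x)) ->
  (forall psi, (forall y, 0 <= psi y) ->
     \int[mu]_y (psi y * h y) = \int[mu]_y (psi y * k y)) ->
  forall x : supp mu, h (\val x) <= k (\val x).
Proof.
move=> mh mk hc kc h0 k0 ch ck hk x; rewrite leNgt; apply/negP => xkh.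
pose D := [set z : supp mu | k (\val z) < h (\val z)].
have : nbhs x D.
  have : h (\val z) - k (\val z) @[z --> x] --> h (\val x) - k (\val x).
    exact: (cvgB (ch x) (ck x)).
  have hk0 : 0 < h (\val x) - k (\val x) by rewrite subr_gt0.
  move=> /cvgrPdist_lt /(_ _ hk0); apply: filterS => z /=.
  by move=> /(le_lt_trans (ler_norm _)) z0; rewrite /D /=; lra.
move=> [_ [[U oU <-] /= Ux UD]].
have xU : [set \val x] `<=` U by move=> _ ->.
have [psi [psi01 psi1 psiU]] := Cc_urysohn polishY (@compact_set1 _ (\val x)) oU xU.
have psi0 y : 0 <= psi y by have /andP[] := psi01 y.
pose d (y : borel Y) := psi y * h y - psi y * k y.
have ih := Cc_weight_integrable mu psi mh hc.
have ik := Cc_weight_integrable mu psi mk kc.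
have id_ : mu.-integrable setT (EFin \o d) := integrableB measurableT ih ik.
have dpos (y : supp mu) : 0 < psi (\val y) -> 0 < d (\val y).
  move=> py; rewrite /d -mulrBr mulr_gt0// subr_gt0; apply: (UD y) => /=.
  by apply: contrapT => nU; move: py; rewrite psiU// ltxx.
have d_ge0 y : 0 <= d y.
  have [sy|nsy] := pselect (supp mu y); last by rewrite /d h0// k0// !mulr0 subrr.
  have := dpos (SigSub (mem_set sy)) => /=.
  have := psi0 y; rewrite le_eqVlt => /predU1P[p0 _|py /(_ py)/ltW//].
  by rewrite /d -p0 !mul0r subrr.
have int0 : (\int[mu]_y `|(EFin \o d) y| = 0)%E.
  under eq_integral do rewrite /= ger0_norm//.
  rewrite -(fineK (integrable_fin_num measurableT id_)).
  by rewrite -/(Rintegral mu setT d) /d RintegralB// hk// subrr.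
have [mid _] := integrableP _ _ _ id_.
have [N [mN N0 dN]] := (ae_eq_integral_abs mu measurableT mid).1 int0.
pose V := [set y : Y | 0 < psi y].
have oV : open V.
  have := @Cc_continuous _ _ psi => /continuousP /(_ _ (@open_gt R 0)).
  by rewrite /V; congr (open _); apply/seteqP; split => y /=.
have sx : supp mu (\val x) := set_mem (valP x).
have : (0 < mu V)%E by apply: sx => //; rewrite /V/= psi1.
apply/negP; rewrite -leNgt.
have mS : measurable (~` supp mu : set (borel Y)).
  by apply: measurableC; apply: borel_closed; exact: supp_closed.
apply: (@le_trans _ _ (mu (N `|` ~` supp mu))).
  apply: (le_measure mu); [apply/mem_set; exact: borel_open|apply/mem_set; exact: measurableU|].
  move=> y Vy; have [sy|] := pselect (supp mu y); last by right.
  left; apply: dN => /(_ I) /= /eqP; rewrite eqe => /eqP dy0.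
  have := dpos (SigSub (mem_set sy)) Vy => /=.
  by rewrite dy0 ltxx.
have : (mu (N `|` ~` supp mu) <= mu N + mu (~` supp mu))%E by exact: measureU2.
by rewrite N0 supp_measure0// adde0.
Qed.

Section limit.
Variables (J : Type) (F : set_system J).
Hypothesis FF : ProperFilter F.
Variables (t_ : J -> R) (t : R) (eta_ : J -> radon R path)
  (nu_ : J -> prob_family g0 mu) (nu : prob_family g0 mu).
Hypothesis t_cvg : t_ j @[j --> F] --> t.
Hypothesis nu_cvg : nu_ j @[j --> F] --> nu.
Hypothesis eta_marg : forall j, has_marginals mu (eta_ j).
Hypothesis nu_dis : forall j, disintegration (eta_ j) (t_ j) (nu_ j).
Hypothesis nu_cont_ : forall j, continuous (nu_ j : supp mu -> prob R path).
Hypothesis nu_cont : continuous (nu : supp mu -> prob R path).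

Lemma fint_ev (s : R) (ka : prob_family g0 mu) psi (x : supp mu) :
  concentrated s ka -> (forall y, 0 <= psi y) ->
  fint ka (Cc_ev s psi) (\val x) = psi (\val x).
Proof.
move=> kas psi0.
have gpsi : ge0_measurable (EFin \o psi : borel Y -> \bar R).
  by split; [exact: Cc_measurable|move=> y; rewrite /= lee_fin].
have := concentrated_ev_integral Gamma_continuous hY (\val x) kas gpsi.
rewrite fiberE probT mule1 /= -fiberE => e.
by have := fintE ka (Cc_ev s psi) (\val x); rewrite [LHS]e => -[].
Qed.

(** The fiber of [nu_ j] gives psi(g(t_j)) the exact integral psi(x). One half of [e] pays for
    replacing [t_ j] by [t], uniformly in the path and with fibers of mass 1; the other half pays
    for replacing [nu_ j] by [nu] at the single point [x]. *)
Lemma limit_fint_ev psi (x : supp mu) : (forall y, 0 <= psi y) ->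
  fint nu (Cc_ev t psi) (\val x) = psi (\val x).
Proof.
move=> psi0; apply/eqP; rewrite -subr_eq0 -normr_le0; apply/ler_addgt0Pl => e e0.
rewrite addr0.
have e20 : 0 < e / 2 by rewrite divr_gt0.
have near1 : \forall j \near F, forall y : Y, [set \val x] y ->
    `|fint (nu_ j) (Cc_ev t psi) y - fint nu (Cc_ev t psi) y| < e / 2.
  by apply: fint_cvg => //; exact: compact_set1.
have near2 : \forall j \near F, forall g : path, `|psi (Ev (t_ j) g) - psi (Ev t g)| < e / 2.
  exact: t_cvg (ev_Cc_equicontinuous Gamma_continuous Gamma_compact psi t e20).
have [j [/(_ (\val x) erefl) j1 j2]] := filter_ex (filterI near1 near2).
rewrite -(fint_ev x (nu_dis j).1 psi0) distrC.
rewrite (_ : _ - _ = (fint (nu_ j) (Cc_ev (t_ j) psi) (\val x) - fint (nu_ j) (Cc_ev t psi) (\val x))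
   + (fint (nu_ j) (Cc_ev t psi) (\val x) - fint nu (Cc_ev t psi) (\val x))); last first.
  by rewrite addrA subrK.
apply: le_trans (ler_normD _ _) _; rewrite (splitr e) lerD//; last exact: ltW.
have fin : forall K : set path, compact K -> (fiber (nu_ j) (\val x) K < +oo)%E.
  by move=> K; exact: fiber_fin.
have i1 := Cc_integrable (Cc_ev (t_ j) psi) fin.
have i2 := Cc_integrable (Cc_ev t psi) fin.
rewrite /fint -RintegralB//.
apply: le_trans (le_normr_Rintegral measurableT (integrableB measurableT i1 i2)) _.
have mT : fiber (nu_ j) (\val x) setT = 1%E by rewrite fiberE; exact: probT.
have -> : e / 2 = \int[fiber (nu_ j) (\val x)]_g (e / 2).
  by rewrite Rintegral_cst// mT mulr1.
apply: le_Rintegral => //.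
- exact: (integrable_abse (integrableB measurableT i1 i2)).
- apply/integrableP; split; first by apply/measurable_EFinP; exact: measurable_cst.
  by rewrite integral_cst// mT mule1 ltry.
- by move=> g _ /=; exact/ltW/j2.
Qed.

(** For [phi n] tending to the indicator of the point [x], the integral of [phi n] at g(t) tends to
    the mass of the paths through [x]; it also equals [phi n] at [x], which tends to 1. *)
Lemma limit_concentrated : concentrated t nu.
Proof.
move=> x; have [phi [chi [phichi chi01 phix]]] := Cc_approx polishY (@compact_set1 _ (\val x)).
have [fin _] := radonP (\val (nu x)).
have := @Cc_integral_cvg _ path (prob_measure (nu x)) (fun n => Cc_ev t (phi n))
  (Cc_ev t chi) [set g | Ev t g = \val x] fin (ev_fiber_measurable Gamma_continuous hY t (\val x)).
move=> /(_ (fun n g => phichi n (Ev t g))) cv.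
have : (\int[prob_measure (nu x)]_g (EFin \o Cc_ev t (phi n)) g)%E @[n --> \oo] -->
    prob_measure (nu x) [set g | Ev t g = \val x].
  apply: cv => g; have := phix (Ev t g).
  by rewrite !indicE.
rewrite (_ : (fun n => _) = EFin \o (fun n => phi n (\val x))); last first.
  apply/funext => n.
  apply: (@etrans _ _ (fint nu (Cc_ev t (phi n)) (\val x))%:E).
    by rewrite -fintE fiberE.
  by rewrite limit_fint_ev// => y; have /andP[] := phichi n y.
have : (EFin \o (fun n => phi n (\val x))) n @[n --> \oo] --> (1%:E : \bar R)%E.
  apply: cvg_EFin; first exact: nearW.
  by have := phix (\val x); rewrite indicE mem_set.
by move=> c1 c2; exact: (cvg_unique (@ereal_hausdorff R) c2 c1).
Qed.

End limit.
End limit_families.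

(** * Decoupling of the limit family *)

Section limit_decoupling.
Variables (R : realType) (Y : puniformType).
Variables (Gamma : set {family compact, R -> Y}) (g0 : Gamma).
Hypothesis polishY : locally_compact_polish R Y.
Hypothesis Gamma_continuous : forall g : R -> Y, Gamma g -> continuous g.
Hypothesis Gamma_compact : forall (a b : R) (K : set Y), compact K ->
  compact [set g : path_space g0 | exists2 t, a <= t <= b & K (ev t g)].
Notation path := (path_space g0).
Notation Ev := (@ev R Y Gamma g0).
Notation Cc_ev := (Cc_ev Gamma_continuous Gamma_compact).
Notation Cc_cyl := (Cc_cyl Gamma_continuous Gamma_compact).
Notation cyl P := (compact_cyl (g0 := g0) P).
Variable mu : radon R Y.
Implicit Types (Phi : Cc R path) (psi : Cc R Y).

Let hY : hausdorff_space Y.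
Proof. by have [_ /metrizable_hausdorff] := polishY. Qed.

Lemma fint_cutoff (t : R) (nu : prob_family g0 mu) psi Phi y :
  concentrated t nu -> (forall z, 0 <= psi z) -> (forall g, 0 <= Phi g) ->
  (forall g, psi (Ev t g) * Phi g = Phi g) -> psi y * fint nu Phi y = fint nu Phi y.
Proof.
move=> nut psi0 Phi0 psiPhi.
have gpsi : ge0_measurable (EFin \o psi : borel Y -> \bar R).
  by split; [exact: Cc_measurable|move=> z; rewrite /= lee_fin].
have := concentrated_integral Gamma_continuous hY y nut gpsi (Cc_measurable Phi).
move=> /(_ (fun g => _)) e.
have {}e : (\int[fiber nu y]_g (EFin \o Phi) g = (psi y)%:E * \int[fiber nu y]_g (EFin \o Phi) g)%E.
  rewrite -[RHS]e; last by move=> g; rewrite /= lee_fin.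
  by apply: eq_integral => g _; rewrite /= -EFinM psiPhi.
by move: e; rewrite !fintE -EFinM => -[].
Qed.

Section limit.
Variables (J : Type) (F : set_system J).
Hypothesis FF : ProperFilter F.
Variables (t_ : J -> R) (t : R) (eta_ : J -> radon R path)
  (nu_ : J -> prob_family g0 mu) (nu : prob_family g0 mu).
Hypothesis t_cvg : t_ j @[j --> F] --> t.
Hypothesis nu_cvg : nu_ j @[j --> F] --> nu.
Hypothesis eta_marg : forall j, has_marginals mu (eta_ j).
Hypothesis nu_dis : forall j, disintegration (eta_ j) (t_ j) (nu_ j).
Hypothesis nu_cont_ : forall j, continuous (nu_ j : supp mu -> prob R path).
Hypothesis nu_cont : continuous (nu : supp mu -> prob R path).

(** A weight can be inserted for free: [psi] is taken to be 1 on the compact set of values at time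
    [t] of the paths in the support of [Phi]. *)
Lemma limit_mixture Phi : (forall g, 0 <= Phi g) ->
  vague_eval (eta_ j) Phi @[j --> F] --> \int[mu]_y fint nu Phi y.
Proof.
move=> Phi0.
have nut := limit_concentrated polishY Gamma_continuous Gamma_compact FF t_cvg nu_cvg nu_dis.
have cS : compact (Ev t @` closure [set g | Phi g != 0]).
  apply: continuous_compact; last exact: Cc_compact.
  by apply: continuous_subspaceT => g; exact: ev_continuous.
have [psi [psi01 psi1 _]] := Cc_urysohn polishY cS openT (@subsetT _ _).
have psi0 y : 0 <= psi y by have /andP[] := psi01 y.
have psiPhi g : psi (Ev t g) * Phi g = Phi g.
  have [Sg|nSg] := pselect (closure [set g | Phi g != 0] g).
    by rewrite psi1 ?mul1r//; exists g.
  have -> : Phi g = 0.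
    by apply: contrapT => /eqP Px; apply: nSg; exact: subset_closure.
  by rewrite mulr0.
have := limit_fint polishY Gamma_continuous Gamma_compact FF t_cvg nu_cvg eta_marg nu_dis
  nu_cont_ nu_cont psi0 Phi0.
rewrite (_ : (fun j => _) = (fun j => vague_eval (eta_ j) Phi)); last first.
  by apply/funext => j; apply: eq_Rintegral => g _; exact: psiPhi.
rewrite (_ : \int[mu]_y _ = \int[mu]_y fint nu Phi y)//.
by apply: eq_Rintegral => y _; exact: (fint_cutoff y nut psi0 Phi0 psiPhi).
Qed.

Hypothesis eta_markov : forall j, side <=%R (t_ j) (eta_ j).

Lemma limit_decoupling_fint p l q k (x : supp mu) :
  cyl_data [set s | s < t] (p :: l) -> cyl_data [set s | t < s] (q :: k) ->
  fint nu (Cc_mul (Cc_cyl p l) (Cc_cyl q k)) (\val x) =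
  fint nu (Cc_cyl p l) (\val x) * fint nu (Cc_cyl q k) (\val x).
Proof.
move=> pl qk; set Phi := Cc_cyl p l; set Psi := Cc_cyl q k.
have [a aP] := Cc_bounded Phi; have [b bP] := Cc_bounded Psi.
have [c cP] := Cc_bounded (Cc_mul Phi Psi).
have a0 : 0 <= a := le_trans (normr_ge0 _) (aP g0).
have b0 : 0 <= b := le_trans (normr_ge0 _) (bP g0).
have c0 : 0 <= c := le_trans (normr_ge0 _) (cP g0).
have ab_le (ka : prob_family g0 mu) y : `|fint ka Phi y * fint ka Psi y| <= a * b.
  by rewrite normrM ler_pM//; exact: fint_le.
have mprod (ka : prob_family g0 mu) : continuous (ka : supp mu -> prob R path) ->
    measurable_fun setT (fun y => fint ka Phi y * fint ka Psi y).
  by move=> cka; apply: measurable_funM; exact: fint_measurable.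
have cprod : continuous (fun x : supp mu => fint nu Phi (\val x) * fint nu Psi (\val x)).
  move=> z; exact: (cvgM (@fint_continuous _ _ _ _ _ nu Phi nu_cont z) (@fint_continuous _ _ _ _ _ nu Psi nu_cont z)).
(* In integrated form against weights, the identity for [nu_ j] passes to the limit without keeping
   track of a null set for each [j]. *)
have key psi : (forall y, 0 <= psi y) ->
    \int[mu]_y (psi y * fint nu (Cc_mul Phi Psi) y) =
    \int[mu]_y (psi y * (fint nu Phi y * fint nu Psi y)).
  move=> psi0.
  have limA : \int[mu]_y (psi y * fint (nu_ j) (Cc_mul Phi Psi) y) @[j --> F] -->
      \int[mu]_y (psi y * fint nu (Cc_mul Phi Psi) y).
    apply: (@weighted_cvg _ _ mu J F psi (fun j => fint (nu_ j) (Cc_mul Phi Psi))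
      (fint nu (Cc_mul Phi Psi)) c).
    - by move=> j; exact: fint_measurable.
    - exact: fint_measurable.
    - by move=> j y; exact: fint_le.
    - by move=> y; exact: fint_le.
    - by move=> K e cK e0; exact: fint_cvg.
  have limB : \int[mu]_y (psi y * (fint (nu_ j) Phi y * fint (nu_ j) Psi y)) @[j --> F] -->
      \int[mu]_y (psi y * (fint nu Phi y * fint nu Psi y)).
    apply: (@weighted_cvg _ _ mu J F psi (fun j y => fint (nu_ j) Phi y * fint (nu_ j) Psi y)
      (fun y => fint nu Phi y * fint nu Psi y) (a * b)) => //.
    - by move=> j; exact: mprod.
    - exact: mprod.
    - move=> K e cK e0.
      (* Adapted to u v - u' v' = u (v - v') + (u - u') v', with |u| <= a and |v'| <= b; the 1 keeps
         the denominator positive. *)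
      have d0 : 0 < e / (a + b + 1) by rewrite divr_gt0// ltr_wpDl// addr_ge0.
      have near1 : \forall j \near F, forall y, K y ->
        `|fint (nu_ j) Phi y - fint nu Phi y| < e / (a + b + 1) by exact: fint_cvg.
      have near2 : \forall j \near F, forall y, K y ->
        `|fint (nu_ j) Psi y - fint nu Psi y| < e / (a + b + 1) by exact: fint_cvg.
      apply: filterS2 near1 near2 => j h1 h2 y Ky.
      have {}h1 := h1 y Ky; have {}h2 := h2 y Ky.
      set u := fint (nu_ j) Phi y in h1 *; set v := fint (nu_ j) Psi y in h2 *.
      set u' := fint nu Phi y in h1 *; set v' := fint nu Psi y in h2 *.
      have ua : `|u| <= a by exact: fint_le.
      have vb : `|v'| <= b by exact: fint_le.
      have -> : u * v - u' * v' = u * (v - v') + (u - u') * v' by ring.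
      apply: le_lt_trans (ler_normD _ _) _; rewrite !normrM.
      apply: (@le_lt_trans _ _ (a * (e / (a + b + 1)) + (e / (a + b + 1)) * b)).
        by apply: lerD; apply: ler_pM => //; exact: ltW.
      rewrite (mulrC a) -mulrDr mulrAC ltr_pdivrMr ?ltr_wpDl ?addr_ge0//.
      by rewrite ltr_pM2l// ltrDl.
  (* A strict inequality with [t] persists for [t_ j]; a datum at time [t] itself could fall on
     either side of [t_ j]. *)
  have near1 : \forall j \near F, all (fun p => p.1 <= t_ j) (p :: l).
    elim: (p :: l) pl => [|r s ih]; first by move=> _; exact: nearW.
    rewrite /cyl_data /= => /andP[/asboolP[rt _] /ih near_s].
    have near_r : \forall j \near F, r.1 < t_ j by exact: (t_cvg (lt_nbhsr rt)).
    by apply: filterS2 near_r near_s => j rj sj; rewrite (ltW rj).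
  have near2 : \forall j \near F, all (fun p => t_ j <= p.1) (q :: k).
    elim: (q :: k) qk => [|r s ih]; first by move=> _; exact: nearW.
    rewrite /cyl_data /= => /andP[/asboolP[rt _] /ih near_s].
    have near_r : \forall j \near F, t_ j < r.1 by exact: (t_cvg (lt_nbhsl rt)).
    by apply: filterS2 near_r near_s => j rj sj; rewrite (ltW rj).
  have gpsi : ge0_measurable (EFin \o psi : borel Y -> \bar R).
    by split; [exact: Cc_measurable|move=> y; rewrite /= lee_fin].
  have ABj : \forall j \near F, \int[mu]_y (psi y * fint (nu_ j) (Cc_mul Phi Psi) y) =
      \int[mu]_y (psi y * (fint (nu_ j) Phi y * fint (nu_ j) Psi y)).
    apply: filterS2 near1 near2 => j lj kj.
    have lj' : all (fun p => p.1 <= t_ j) (map (@Cc_datum R Y) (p :: l)).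
      by rewrite all_map; apply: sub_all lj => r.
    have kj' : all (fun p => t_ j <= p.1) (map (@Cc_datum R Y) (q :: k)).
      by rewrite all_map; apply: sub_all kj => r.
    have sd := side_disintegration polishY Gamma_continuous (@eta_markov j) (nu_dis j) gpsi
      (Cc_datum_good pl) (Cc_datum_good qk) lj' kj'.
    have e1 y : (\int[fiber (nu_ j) y]_g ecyl (g0 := g0) (map (@Cc_datum R Y) (p :: l)) g = (fint (nu_ j) Phi y)%:E)%E.
      by rewrite -fintE; apply: eq_integral => g _; exact: ecyl_Cc.
    have e2 y : (\int[fiber (nu_ j) y]_g ecyl (g0 := g0) (map (@Cc_datum R Y) (q :: k)) g = (fint (nu_ j) Psi y)%:E)%E.
      by rewrite -fintE; apply: eq_integral => g _; exact: ecyl_Cc.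
    have e3 y : (\int[fiber (nu_ j) y]_g ecyl (g0 := g0) (map (@Cc_datum R Y) (p :: l) ++ map (@Cc_datum R Y) (q :: k)) g
        = (fint (nu_ j) (Cc_mul Phi Psi) y)%:E)%E.
      rewrite -fintE; apply: eq_integral => g _.
      by rewrite ecyl_cat !(ecyl_Cc Gamma_continuous Gamma_compact) -EFinM.
    rewrite /Rintegral; congr fine; apply: etrans (etrans _ sd) _.
      by apply: eq_integral => y _; rewrite e3 EFinM.
    by apply: eq_integral => y _; rewrite e1 e2 !EFinM.
  apply: (cvg_unique (@Rhausdorff R) limA).
  apply: cvg_trans limB; apply: near_eq_cvg.
  by apply: filterS ABj => j ->.
have zero (ka : prob_family g0 mu) y : ~ supp mu y -> fint ka Phi y * fint ka Psi y = 0.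
  by move=> ny; rewrite (@fint_out _ _ _ _ mu ka Phi y ny) mul0r.
have m1 := fint_measurable (Cc_mul Phi Psi) nu_cont.
have m2 := mprod _ nu_cont.
have cmax1 y : `|fint nu (Cc_mul Phi Psi) y| <= Num.max c (a * b).
  by rewrite le_max fint_le.
have cmax2 y : `|fint nu Phi y * fint nu Psi y| <= Num.max c (a * b).
  by rewrite le_max ab_le orbT.
have c1 := @fint_continuous _ _ _ _ mu nu (Cc_mul Phi Psi) nu_cont.
have o1 := @fint_out _ _ _ _ mu nu (Cc_mul Phi Psi).
apply/eqP; rewrite eq_le; apply/andP; split.
- exact: (weights_determine polishY m1 m2 cmax1 cmax2 o1 (zero nu) c1 cprod key).
- apply: (weights_determine polishY m2 m1 cmax2 cmax1 (zero nu) o1 cprod c1 _ x).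
  by move=> psi psi0; rewrite key.
Qed.

End limit.
End limit_decoupling.

Section decoupling_of_cylinders.
Variables (R : realType) (Y : puniformType).
Variables (Gamma : set {family compact, R -> Y}) (g0 : Gamma).
Hypothesis polishY : locally_compact_polish R Y.
Hypothesis Gamma_continuous : forall g : R -> Y, Gamma g -> continuous g.
Hypothesis Gamma_compact : forall (a b : R) (K : set Y), compact K ->
  compact [set g : path_space g0 | exists2 t, a <= t <= b & K (ev t g)].
Notation path := (path_space g0).
Notation Ev := (@ev R Y Gamma g0).
Notation Cc_cyl := (Cc_cyl Gamma_continuous Gamma_compact).
Notation cyl P := (compact_cyl (g0 := g0) P).

Section product.
Variable m : {measure set (borel path) -> \bar R}.
Hypothesis mT : m setT = 1%E.

Let fin (A : set (borel path)) : measurable A -> (m A < +oo)%E.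
Proof.
move=> mA; apply: (@le_lt_trans _ _ (m setT)); last by rewrite mT ltry.
by apply: (le_measure m) => //; apply/mem_set.
Qed.

(** The measures sending [A] to m(A & B), for intersection, and to m(A) m(B) agree on the pi-system
    of cylinders, hence on the sigma-algebra it generates. *)
Lemma pi_system_product (P : set R) (B A : set (borel path)) : P !=set0 -> measurable B ->
  (forall A, cyl P A -> m (A `&` B) = m A * m B)%E ->
  <<s cyl P >> A -> (m (A `&` B) = m A * m B)%E.
Proof.
move=> P0 mB AB sA; have [G [GP cG GT]] := cyl_exhaustion polishY Gamma_compact P0.
have mBfin : m B \is a fin_num by rewrite ge0_fin_numE// fin.
have Gm := @compact_cyl_measurable _ _ _ g0 polishY Gamma_continuous P.
pose b : {nonneg R} := NngNum (fine_ge0 (measure_ge0 m B)).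
have bE A' : mscale b m A' = (m A' * m B)%E by rewrite /mscale /= fineK// muleC.
rewrite -bE.
apply: (@g_sigma_algebra_measure_unique _ R (borel path) (cyl P) Gm G GP GT
  (mrestr m mB) (mscale b m)) => //.
- exact: compact_cylI.
- by move=> A' PA'; exact: (etrans (AB A' PA') (esym (bE A'))).
- move=> n; rewrite /mrestr /=; apply: fin; apply: measurableI => //; exact: Gm.
Qed.

Lemma product_cyl (P Q : set R) (A B : set (borel path)) : P !=set0 -> Q !=set0 ->
  (forall A B, cyl P A -> cyl Q B -> m (A `&` B) = m A * m B)%E ->
  <<s cyl P >> A -> <<s cyl Q >> B -> (m (A `&` B) = m A * m B)%E.
Proof.
move=> P0 Q0 AB sA sB.
have Qm := @compact_cyl_measurable _ _ _ g0 polishY Gamma_continuous Q.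
have Pm := @compact_cyl_measurable _ _ _ g0 polishY Gamma_continuous P.
have mA : measurable A.
  by apply: (smallest_sub _ Pm) sA; exact: sigma_algebra_measurable.
rewrite setIC muleC; apply: (pi_system_product Q0 mA) sB => B' QB'.
rewrite setIC muleC; apply: (pi_system_product P0 (Qm _ QB')) sA => A' PA'.
exact: AB.
Qed.

End product.

Variable mu : radon R Y.

Let hY : hausdorff_space Y.
Proof. by have [_ /metrizable_hausdorff] := polishY. Qed.

(** The product formula passes from cylinder functions to compact cylinders by dominated
    convergence, then to the sigma-algebras of the strict past and the strict future. These contain
    the events of the closed half-lines by continuity of paths, and rectangles determine the joint
    law. *)
Lemma cyl_decoupling (t : R) (nu : prob_family g0 mu) (x : supp mu) :
  concentrated t nu ->
  (forall p l q k, cyl_data [set s | s < t] (p :: l) -> cyl_data [set s | t < s] (q :: k) ->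
    fint nu (Cc_mul (Cc_cyl p l) (Cc_cyl q k)) (\val x) =
    fint nu (Cc_cyl p l) (\val x) * fint nu (Cc_cyl q k) (\val x)) ->
  is_decoupling t (\val x) (nu x) (nu x).
Proof.
move=> nut prod; pose m := prob_measure (nu x).
have mT : m setT = 1%E by exact: probT.
have finK (K : set path) : compact K -> (m K < +oo)%E.
  by move=> cK; rewrite /m -fiberE; exact: fiber_fin.
have fm (A : set (borel path)) : measurable A -> m A \is a fin_num.
  move=> mA; rewrite ge0_fin_numE//; apply: (@le_lt_trans _ _ (m setT)).
    by apply: (le_measure m) => //; apply/mem_set.
  by rewrite mT ltry.
split.
- rewrite -(nut x) /restr_law /pushforward; congr (prob_measure (nu x) _).
  apply/seteqP; split => g.
    move=> [s [st gs]]; apply: (etrans _ gs).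
    exact: (congr1 (path_fun g) (esym st)).
  move=> /= gx; have tI : [set` `]-oo, t]] t by rewrite /= in_itv/= lexx.
  by exists (SigSub (mem_set tI)).
- rewrite -(nut x) /restr_law /pushforward; congr (prob_measure (nu x) _).
  apply/seteqP; split => g.
    move=> [s [st gs]]; apply: (etrans _ gs).
    exact: (congr1 (path_fun g) (esym st)).
  move=> /= gx; have tI : [set` `[t, +oo[] t by rewrite /= in_itv/= lexx.
  by exists (SigSub (mem_set tI)).
have h := @product_lawP _ _ _ _ _ _ R m _ _ mT
  (@restr_measurable R Y Gamma g0 `]-oo, t]) (@restr_measurable R Y Gamma g0 `[t, +oo[).
apply: h.
move=> A B mA mB.
apply: (product_cyl mT (P := [set s | s < t]) (Q := [set s | t < s])).
- by exists (t - 1) => /=; lra.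
- by exists (t + 1) => /=; lra.
- move=> {mA mB}A {}B PA QB.
  have mA := compact_cyl_measurable polishY Gamma_continuous PA.
  have mB := compact_cyl_measurable polishY Gamma_continuous QB.
  have [p [l [chi [pl plchi chi01 plA]]]] := cyl_approx polishY Gamma_continuous Gamma_compact PA.
  have [q [k [xhi [qk qkxhi xhi01 qkB]]]] := cyl_approx polishY Gamma_continuous Gamma_compact QB.
  have toR (Phi : nat -> Cc R path) (C : set (borel path)) : measurable C ->
      (\int[m]_g ((EFin \o Phi n : borel path -> \bar R) g))%E @[n --> \oo] --> m C ->
      fint nu (Phi n) (\val x) @[n --> \oo] --> fine (m C).
    move=> mC cv; rewrite (_ : (fun n => _) = fine \o
      (fun n => \int[m]_g ((EFin \o Phi n : borel path -> \bar R) g))%E).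
      by apply: fine_cvg; rewrite fineK ?fm.
    by apply/funext => n; rewrite /fint fiberE.
  have cA := toR _ _ mA (Cc_integral_cvg finK mA plchi plA).
  have cB := toR _ _ mB (Cc_integral_cvg finK mB qkxhi qkB).
  have cAB := toR (fun n => Cc_mul (Cc_cyl (p n) (l n)) (Cc_cyl (q n) (k n))) _ (measurableI _ _ mA mB).
  have {}cAB := cAB (Cc_integral_cvg (Phi := fun n => Cc_mul (Cc_cyl (p n) (l n)) (Cc_cyl (q n) (k n)))
    (chi := Cc_mul chi xhi) finK (measurableI _ _ mA mB) _ _).
  rewrite -(fineK (fm _ mA)) -(fineK (fm _ mB)) -EFinM -(fineK (fm _ (measurableI _ _ mA mB))).
  congr EFin; apply: (cvg_unique (@Rhausdorff R) (cAB _ _)).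
  + move=> n g /=; have /andP[a0 a1] := plchi n g; have /andP[b0 b1] := qkxhi n g.
    by rewrite mulr_ge0//= ler_pM.
  + by move=> g; rewrite indicI; apply: cvgM; [exact: plA|exact: qkB].
  rewrite (_ : (fun n => _) = fun n => fint nu (Cc_cyl (p n) (l n)) (\val x) *
      fint nu (Cc_cyl (q n) (k n)) (\val x)); first exact: cvgM.
  by apply/funext => n; exact: prod.
- exact: restr_le_cyl.
- exact: restr_ge_cyl.
Qed.

End decoupling_of_cylinders.

(** * Mixtures as Radon measures *)

Section inner_regularity.
Variables (R : realType) (T : ptopologicalType).
Hypothesis polishT : locally_compact_polish R T.
Variable m : {measure set (borel T) -> \bar R}.
Hypothesis fin : forall K : set T, compact K -> (m K < +oo)%E.

Let hT : hausdorff_space T.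
Proof. by have [_ /metrizable_hausdorff] := polishT. Qed.

Let cmeas (K : set (borel T)) : compact (K : set T) -> measurable K.
Proof. by move=> cK; apply: borel_closed; exact: compact_closed. Qed.

Section compact_part.
Variable L : set (borel T).
Hypothesis cL : compact (L : set T).

(* Symmetric in [A] and its complement, so that the sets [A] satisfying it form
   a sigma-algebra. *)
Let approx (A : set (borel T)) := forall e : R, 0 < e -> exists C D : set (borel T),
  [/\ compact (C : set T) /\ C `<=` A `&` L, compact (D : set T) /\ D `<=` L `\` A
    & (m (L `\` (C `|` D)) <= e%:E)%E].

(** Continuity from above, available because the compact set [L] has finite measure. *)
Let decreasing_small (G : nat -> set (borel T)) (e : R) : 0 < e ->
  (forall n, measurable (G n)) -> (forall n, G n.+1 `<=` G n) ->
  G 0%N `<=` L -> (m (\bigcap_n G n) < e%:E)%E -> exists n, (m (G n) <= e%:E)%E.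
Proof.
move=> e0 mG dG GL small.
have fG0 : (m (G 0%N) < +oo)%E.
  by apply: le_lt_trans (fin cL); apply: (le_measure m) => //; apply/mem_set => //; exact: cmeas.
have mcap : measurable (\bigcap_n G n) by exact: bigcapT_measurable.
have nG : nonincreasing_seq G by apply/nonincreasing_seqP => n; apply/subsetPset; exact: dG.
have cv := nonincreasing_cvg_mu fG0 mG mcap nG.
apply: contrapT => /forallNP large.
have : (e%:E <= m (\bigcap_n G n))%E.
  rewrite -(cvg_lim _ cv)//; apply: lime_ge; first by apply/cvg_ex; eexists; exact: cv.
  by apply: nearW => n; apply: ltW; rewrite ltNge; apply/negP; exact: large.
by rewrite leNgt small.
Qed.

(** The part of [L] outside [U] is already compact, and the part inside is an increasing union of
    the compact sets [C n], as the complement of [U] is the intersection of the [V n]. *)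
Let approx_open (U : set (borel T)) : open (U : set T) -> approx U.
Proof.
move=> oU e e0; have [_ cm _] := polishT.
have [V [oV dV UV]] := metrizable_closed_Gdelta cm (open_closedC oU).
pose D : set (borel T) := L `\` U.
have cD : compact (D : set T).
  by apply: (@compact_closedI T L (~` U)) => //; exact: open_closedC.
pose C n : set (borel T) := L `&` ~` V n.
have cC n : compact (C n : set T).
  by apply: (@compact_closedI T L (~` V n)) => //; exact: open_closedC.
have CU n : C n `<=` U `&` L.
  move=> x [Lx nVx]; split => //; apply: contrapT => nUx; apply: nVx.
  by have : (~` U) x by []; rewrite UV; apply.
have [||||n small] := @decreasing_small (fun n => L `\` (C n `|` D)) e e0.
- move=> n; apply: measurableD; first exact: cmeas.
  by apply: measurableU; apply: cmeas.
- move=> n x [Lx nCD]; split => // -[[_ nVx]|Dx]; apply: nCD; [left|by right].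
  by split => // /dV.
- by move=> x [].
- rewrite (_ : \bigcap_n _ = set0) ?measure0 ?lte_fin//.
  rewrite -subset0 => x Gx; have [Lx nD] := Gx 0%N I.
  have : (~` U) x.
    rewrite UV => n _; apply: contrapT => nV; have [_ nC] := Gx n I.
    by apply: nC; left.
  by move=> nUx; apply: nD; right.
by exists (C n), D; split; [split|split; last exact: subset_refl|].
Qed.

Let approxC (A : set (borel T)) : approx A -> approx (setT `\` A).
Proof.
move=> aA e e0; have [C [D [[cC CA] [cD DA] small]]] := aA e e0.
exists D, C; split; last by rewrite setUC.
- by split => // x /DA[Lx nAx]; split => //; split.
- by split => // x /CA[Ax Lx]; split => // -[_]; exact.
Qed.

Let approx_bigcup (A : nat -> set (borel T)) :
  (forall n, approx (A n)) -> approx (\bigcup_n A n).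
Proof.
move=> aA e e0; have e20 : 0 < e / 2 by rewrite divr_gt0.
(* These errors sum to at most [e]/2, strictly below [e] as [decreasing_small] requires. *)
have en0 n : 0 < e / 2 / (2 ^ n.+1)%:R by rewrite divr_gt0// ltr0n expn_gt0.
have /choice[CD CDP] n : exists CD : set (borel T) * set (borel T),
  [/\ compact (CD.1 : set T) /\ CD.1 `<=` A n `&` L,
      compact (CD.2 : set T) /\ CD.2 `<=` L `\` A n
    & (m (L `\` (CD.1 `|` CD.2)) <= (e / 2 / (2 ^ n.+1)%:R)%:E)%E].
  by have [C [D CDP]] := aA n _ (en0 n); exists (C, D).
(* The infinite intersection [D] is compact, but the union of the [C n] may not be: it is cut at a
   finite [N], found by continuity from above. *)
pose C n := (CD n).1; pose D := \bigcap_n (CD n).2.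
have cC n : compact (C n : set T) by have [[]] := CDP n.
have cD : compact (D : set T).
  have [_ [cD0 _] _] := CDP 0%N; apply: (subclosed_compact _ cD0).
    by apply: closed_bigI => n _; apply: compact_closed => //; have [_ []] := CDP n.
  by move=> x; apply.
pose CN N : set (borel T) := \big[setU/set0]_(i < N) C i.
have cCN N : compact (CN N : set T) by apply: bigsetU_compact => i _; exact: cC.
have mE n : measurable (L `\` ((CD n).1 `|` (CD n).2)).
  have [[c1 _] [c2 _] _] := CDP n.
  by apply: measurableD; [exact: cmeas|apply: measurableU; exact: cmeas].
have [||||N small] := @decreasing_small (fun N => L `\` (CN N `|` D)) e e0.
- move=> n; apply: measurableD; first exact: cmeas.
  by apply: measurableU; exact: cmeas.
- move=> n x [Lx nCD]; split => // -[Cx|Dx]; apply: nCD; [left|by right].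
  by rewrite /CN big_ord_recr; left.
- by move=> x [].
- apply: (@le_lt_trans _ _ (e / 2)%:E); last first.
    by rewrite lte_fin ltr_pdivrMr// mulr_natr mulr2n ltrDl.
  apply: (@le_trans _ _ (m (\bigcup_n (L `\` ((CD n).1 `|` (CD n).2))))).
    apply: (le_measure m); [apply/mem_set|apply/mem_set|].
    + apply: bigcapT_measurable => n; apply: measurableD; first exact: cmeas.
      by apply: measurableU; exact: cmeas.
    + exact: bigcupT_measurable.
    + move=> x Gx; have [Lx nCD0] := Gx 0%N I.
      have nD : ~ D x by move=> Dx; apply: nCD0; right.
      have [n nDn] : exists n, ~ (CD n).2 x.
        by apply: contrapT => h; apply: nD => n _; apply: contrapT => nD; apply: h; exists n.
      exists n => //; split => // -[Cx|//].
      have [_ nCn] := Gx n.+1 I; apply: nCn; left.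
      by rewrite /CN big_ord_recr; right.
  apply: le_trans (generalized_Boole_inequality m mE (bigcupT_measurable _ mE)) _.
  apply: le_trans (epsilon_trick0 _ (ltW e20)).
  by apply: lee_nneseries => // n _; have [_ _] := CDP n.
exists (CN N), D; split => //; split => //.
- move=> x; rewrite /CN -bigcup_mkord => -[n _ Cx].
  have [[_ CA] _ _] := CDP n; have [Ax Lx] := CA x Cx.
  by split => //; exists n.
- move=> x Dx; split; first by have [_ [_ DA] _] := CDP 0%N; have [] := DA x (Dx 0%N I).
  by move=> [n _ Ax]; have [_ [_ DA] _] := CDP n; have [_] := DA x (Dx n I); apply.
Qed.

Lemma compact_inner_regular (A : set (borel T)) (e : R) : measurable A -> 0 < e ->
  exists C : set (borel T), [/\ compact (C : set T), C `<=` A `&` L &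
    (m (A `&` L) <= m C + e%:E)%E].
Proof.
move=> mA e0; have aA : approx A.
  suff sub : <<s @open T >> `<=` approx by exact: sub.
  apply: smallest_sub; last exact: approx_open.
  split; [by apply: approx_open; exact: open0|exact: approxC|exact: approx_bigcup].
have [C [D [[cC CA] [cD DA] small]]] := aA e e0.
exists C; split => //.
have mC := cmeas cC; have mD := cmeas cD; have mL := cmeas cL.
have mCD : measurable (L `\` (C `|` D)) by apply: measurableD => //; exact: measurableU.
apply: (@le_trans _ _ (m (C `|` (L `\` (C `|` D))))).
  apply: (le_measure m); [apply/mem_set; exact: measurableI|apply/mem_set; exact: measurableU|].
  move=> x [Ax Lx]; have [Cx|nCx] := pselect (C x); [by left|right].
  by split => // -[//|/DA[]].
have : (m (C `|` (L `\` (C `|` D))) <= m C + m (L `\` (C `|` D)))%E by exact: measureU2.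
by move=> /le_trans; apply; rewrite leeD2l.
Qed.

End compact_part.

(** Makes a Radon measure out of any Borel measure finite on compact sets, in particular out of a
    mixture. The set [A] is exhausted by its traces on compact sets, each approximated from
    inside. *)
Lemma locally_finite_radon : is_radon m.
Proof.
split => // A mA; apply/eqP; rewrite eq_le; apply/andP; split; last first.
  apply: ge_ereal_sup => _ [K [cK KA] <-].
  by apply: (le_measure m) => //; apply/mem_set => //; exact: cmeas.
have [L [cL ndL LT]] := sigma_compact polishT.
have mAL n : measurable (A `&` L n : set (borel T)).
  by apply: measurableI => //; exact: cmeas.
have cv : m (A `&` L n) @[n --> \oo] --> m A.
  have := @nondecreasing_cvg_mu _ _ R m (fun n => A `&` L n) mAL.
  rewrite -setI_bigcupr LT setIT; apply => //.
  by apply/nondecreasing_seqP => n; apply/subsetPset => x [Ax Lx]; split => //; exact: ndL.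
rewrite -(cvg_lim _ cv)//; apply: lime_le; first by apply/cvg_ex; eexists; exact: cv.
apply: nearW => n; apply/lee_addgt0Pr => e e0.
have [C [cC CAL le]] := compact_inner_regular (cL n) mA e0.
apply: le_trans le _; rewrite leeD2r//; apply: ereal_sup_ubound.
by exists C => //; split => // x /CAL[].
Qed.

End inner_regularity.

Section continuous_mixtures.
Variables (R : realType) (Y : puniformType).
Variables (Gamma : set {family compact, R -> Y}) (g0 : Gamma).
Hypothesis polishY : locally_compact_polish R Y.
Hypothesis Gamma_continuous : forall g : R -> Y, Gamma g -> continuous g.
Hypothesis polishGamma : locally_compact_polish R (path_space g0).
Hypothesis Gamma_compact : forall (a b : R) (K : set Y), compact K ->
  compact [set g : path_space g0 | exists2 t, a <= t <= b & K (ev t g)].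
Notation path := (path_space g0).
Notation Ev := (@ev R Y Gamma g0).
Notation cyl P := (compact_cyl (g0 := g0) P).
Variable mu : radon R Y.
Variable nu : prob_family g0 mu.
Hypothesis nu_cont : continuous (nu : supp mu -> prob R path).

Let hY : hausdorff_space Y.
Proof. by have [_ /metrizable_hausdorff] := polishY. Qed.

Let hG : hausdorff_space path.
Proof. by have [_ /metrizable_hausdorff] := polishGamma. Qed.

Let mS : measurable (supp mu : set (borel Y)).
Proof. by apply: borel_closed; exact: supp_closed. Qed.

Lemma fiberT y : fiber nu y setT = (\1_(supp mu) y)%:E.
Proof.
have [sy|nsy] := pselect (supp mu y); last by rewrite fiber_out// indicE memNset.
rewrite indicE mem_set//= -[y]/(\val (SigSub (mem_set sy) : supp mu)) fiberE.
exact: probT.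
Qed.

Lemma fiber_le1 y B : measurable B -> (fiber nu y B <= 1)%E.
Proof.
move=> mB; apply: (@le_trans _ _ (fiber nu y setT)).
  by apply: (le_measure (fiber nu y)) => //; apply/mem_set.
by rewrite fiberT lee_fin indicE; case: (y \in _).
Qed.

Lemma fiber_fin_num y B : measurable B -> fiber nu y B \is a fin_num.
Proof.
by move=> mB; rewrite ge0_fin_numE// (le_lt_trans (fiber_le1 _ mB))// ltry.
Qed.

(** Integrals of cylinder functions are continuous on [supp mu], hence measurable; their limits give
    compact cylinders, and Dynkin's argument the rest, complements being handled through the finite
    mass of the fibers. *)
Lemma continuous_fiber_measurable B : measurable B ->
  measurable_fun setT (fun y : borel Y => fiber nu y B).
Proof.
move=> mB.
have cylm := @compact_cyl_measurable _ _ _ g0 polishY Gamma_continuous setT.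
have eqm : measurable = <<s cyl setT >> :> set (set (borel path)).
  apply/seteqP; split; first by move=> A; exact: borel_path_cyl.
  by apply: smallest_sub => //; exact: sigma_algebra_measurable.
apply: (@dynkin_induction _ (borel path) (cyl setT)
  (fun B => measurable_fun setT (fun y : borel Y => fiber nu y B)) eqm).
- exact: compact_cylI.
- rewrite (_ : (fun y => _) = EFin \o \1_(supp mu)).
    by apply/measurable_EFinP; exact: measurable_indic.
  by apply/funext => y; exact: fiberT.
- move=> A PA; have [p [l [chi [pl plchi _ plA]]]] :=
    cyl_approx polishY Gamma_continuous Gamma_compact PA.
  apply: (@emeasurable_fun_cvg _ _ _ setT
    (fun n y => (fint nu (Cc_cyl Gamma_continuous Gamma_compact (p n) (l n)) y)%:E)) => //.
    by move=> n; apply/measurable_EFinP; exact: fint_measurable.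
  move=> y _; rewrite (_ : (fun n => _) = fun n => (\int[fiber nu y]_g
    ((EFin \o Cc_cyl Gamma_continuous Gamma_compact (p n) (l n) : borel path -> \bar R) g))%E).
    by apply: (Cc_integral_cvg _ (cylm _ PA) plchi plA) => K; exact: fiber_fin.
  by apply/funext => n; rewrite fintE.
- move=> A mA mfA; rewrite (_ : (fun y => _) = (fun y => fiber nu y setT - fiber nu y A)%E).
    apply: emeasurable_funB => //.
    rewrite (_ : (fun y => _) = EFin \o \1_(supp mu)).
      by apply/measurable_EFinP; exact: measurable_indic.
    by apply/funext => y; exact: fiberT.
  apply/funext => y; have : (fiber nu y setT = fiber nu y A + fiber nu y (~` A))%E.
    by rewrite -measureU// ?setUv ?setICr//; exact: measurableC.
  by move=> ->; rewrite addeAC subee ?add0e// fiber_fin_num.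
- move=> G mG tG mfG.
  rewrite (_ : (fun y => _) = (fun y => \sum_(n <oo) fiber nu y (G n))%E).
    by apply: ge0_emeasurable_sum => [n y _ _|n _]; [exact: measure_ge0|exact: mfG].
  apply/funext => y; apply/esym/cvg_lim => //.
  exact: (measure_sigma_additive mG tG).
- by rewrite -eqm.
Qed.

Lemma continuous_borel_family : borel_family nu.
Proof.
move=> B mB; apply: (@eq_measurable_fun _ _ (borel Y) _ (supp mu) (fun y => fiber nu y B)).
  by move=> y _; rewrite massE.
by apply: measurable_funTS; exact: continuous_fiber_measurable.
Qed.

Definition mixture (B : set (borel path)) : \bar R := (\int[mu]_y fiber nu y B)%E.

Let mixture0 : mixture set0 = 0%E.
Proof. by rewrite /mixture integral0_eq// => y _; exact: measure0. Qed.

Let mixture_ge0 B : (0 <= mixture B)%E.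
Proof. by apply: integral_ge0 => y _; exact: measure_ge0. Qed.

Let mixture_sigma_additive : semi_sigma_additive mixture.
Proof.
move=> G mG tG mUG; rewrite [X in _ --> X](_ : _ =
    \int[mu]_y (\sum_(n <oo) fiber nu y (G n)))%E; last first.
  by apply: eq_integral => y _; rewrite measure_semi_bigcup.
apply/cvg_closeP; split.
  by apply: is_cvg_nneseries => n _ _; exact: mixture_ge0.
rewrite closeE// integral_nneseries// => n.
exact: continuous_fiber_measurable.
Qed.

HB.instance Definition _ := isMeasure.Build _ _ _ mixture
  mixture0 mixture_ge0 mixture_sigma_additive.

(** Finiteness on a compact [K]: the fiber over [y] charges [K] only if [y] is the value at time [t]
    of a path in [K], so the mixture of [K] is at most the [mu]-measure of this compact set of
    values. *)
Lemma mixture_radon (t : R) : concentrated t nu ->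
  exists etab : radon R path, forall B, measurable B -> etab B = mixture B.
Proof.
move=> nut; have [finmu _] := radonP mu.
suff fin K : compact K -> (mixture K < +oo)%E.
  by exists (Radon (locally_finite_radon polishGamma fin)).
move=> cK; pose L := Ev t @` K.
have cL : compact L.
  apply: continuous_compact => //.
  by apply: continuous_subspaceT => g; exact: ev_continuous.
have mL : measurable (L : set (borel Y)) by apply: borel_closed; exact: compact_closed.
have mK : measurable (K : set (borel path)) by apply: borel_closed; exact: compact_closed.
apply: (@le_lt_trans _ _ (mu L)); last exact: finmu.
have -> : mu L = (\int[mu]_y (\1_L y)%:E)%E by rewrite integral_indic// setIT.
apply: ge0_le_integral => //.
- exact: continuous_fiber_measurable.
- by apply/measurable_EFinP; exact: measurable_indic.
move=> y _; rewrite indicE; have [Ly|nLy] := boolP (y \in L).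
  exact: fiber_le1.
have [sy|nsy] := pselect (supp mu y); last by rewrite fiber_out.
rewrite -[y]/(\val (SigSub (mem_set sy) : supp mu)) fiberE.
set x : supp mu := SigSub _; have mx := ev_fiber_measurable Gamma_continuous hY t (\val x).
have z : prob_measure (nu x) (~` [set g | Ev t g = \val x]) = 0%E.
  by apply: measureC_eq0 => //; exact: probT.
apply: (@le_trans _ _ (prob_measure (nu x) (~` [set g | Ev t g = \val x]))); last by rewrite z.
apply: (le_measure (prob_measure (nu x))); [exact: mem_set|by apply: mem_set; exact: measurableC|].
by move=> g Kg /= gx; move/negP: nLy; apply; apply/mem_set; exists g.
Qed.

End continuous_mixtures.

(** * The Markov hull *)

(** Plays the part of extracting a convergent subsequence: an ultrafilter finer than [F] is mapped
    to an ultrafilter containing [K], which converges by compactness. *)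
Lemma compact_subfilter (J : Type) (X : topologicalType) (F : set_system J)
    (K : set X) (f : J -> X) :
  ProperFilter F -> compact K -> (forall j, K (f j)) ->
  exists (G : set_system J) (x : X), [/\ ProperFilter G, F `<=` G, K x & f j @[j --> G] --> x].
Proof.
move=> PF cK Kf; have [G [UG FG]] := ultraFilterLemma PF.
have PG : ProperFilter G by exact: ultra_proper.
have PfG : ProperFilter (f @ G) by exact: fmap_proper_filter.
have UfG : UltraFilter (f @ G).
  apply: Build_UltraFilter => H PH GH; apply/seteqP; split => // A HA.
  have [//|GA] := in_ultra_setVsetC (f @^-1` A) UG.
  have HnA : H (~` A) by apply: GH.
  by have [x [Ax /(_ Ax)]] := filter_ex (filterI HA HnA).
have KG : (f @ G) K.
  suff -> : (f @ G) K = G setT by exact: filterT.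
  by rewrite /fmap/=; congr (G _); apply/seteqP; split => // j _; exact: Kf.
move: cK; rewrite compact_ultra => /(_ _ UfG KG)[x [Kx fx]].
by exists G, x.
Qed.

Section vague_parts.
Variables (R : realType) (T : ptopologicalType).

Lemma Cc_dominated (Phi : Cc R T) (f : T -> R) : continuous f ->
  (forall x, Phi x = 0 -> f x = 0) -> exists Psi : Cc R T, forall x, Psi x = f x.
Proof.
move=> cf f0; have cS : compact (closure [set x | f x != 0]).
  apply: (subclosed_compact _ (@Cc_compact _ _ Phi)); first exact: closed_closure.
  by apply: closureS => x /=; apply: contraNN => /eqP /f0 ->.
by exists (MkCc cf cS).
Qed.

(** |Phi| and |Phi| - Phi do the work of the positive and negative parts, so that vague convergence
    can be tested on nonnegative functions only. *)
Lemma Cc_parts (Phi : Cc R T) : exists P N : Cc R T,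
  [/\ forall x, 0 <= P x, forall x, 0 <= N x & forall m : radon R T,
    vague_eval m Phi = vague_eval m P - vague_eval m N].
Proof.
have cPhi := @Cc_continuous _ _ Phi.
have cabs : continuous (fun x => `|Phi x|) by move=> x; apply: cvg_norm; exact: cPhi.
have [P PE] := @Cc_dominated Phi (fun x => `|Phi x|) cabs
  (fun x e => etrans (congr1 Num.norm e) (normr0 _)).
have [N NE] : exists N : Cc R T, forall x, N x = `|Phi x| - Phi x.
  apply: (@Cc_dominated Phi).
    by move=> x; apply: cvgB; [exact: cabs|exact: cPhi].
  by move=> x ->; rewrite normr0 subrr.
exists P, N; split.
- by move=> x; rewrite PE.
- by move=> x; rewrite NE subr_ge0 ler_norm.
move=> m; have [fin _] := radonP m.
rewrite /vague_eval -RintegralB//; [|exact: Cc_integrable|exact: Cc_integrable].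
by apply: eq_Rintegral => x _; rewrite PE NE opprB addrC subrK.
Qed.

Lemma vague_cvg_ge0 (J : Type) (F : set_system J) (m_ : J -> radon R T) (m : radon R T) :
  Filter F ->
  (forall Phi : Cc R T, (forall x, 0 <= Phi x) -> vague_eval (m_ j) Phi @[j --> F] --> vague_eval m Phi) ->
  m_ j @[j --> F] --> m.
Proof.
move=> FF cv; apply: vague_cvg => Phi.
have [P [N [P0 N0 PN]]] := Cc_parts Phi.
rewrite PN (_ : (fun m' => _) = fun m' => vague_eval m' P - vague_eval m' N); last first.
  by apply/funext => m'; exact: PN.
exact: (cvgB (cv P P0) (cv N N0)).
Qed.

Lemma vague_evalE (m : radon R T) (Phi : Cc R T) :
  (\int[m]_x (EFin \o Phi : borel T -> \bar R) x = (vague_eval m Phi)%:E)%E.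
Proof.
rewrite /vague_eval /Rintegral fineK//; apply: integrable_fin_num => //.
by apply: Cc_integrable; case: (radonP m).
Qed.

End vague_parts.

Section hull.
Variables (R : realType) (Y : puniformType).
Variables (Gamma : set {family compact, R -> Y}) (g0 : Gamma).
Hypothesis polishY : locally_compact_polish R Y.
Hypothesis Gamma_continuous : forall g : R -> Y, Gamma g -> continuous g.
Hypothesis polishGamma : locally_compact_polish R (path_space g0).
Hypothesis Gamma_compact : forall (a b : R) (K : set Y), compact K ->
  compact [set g : path_space g0 | exists2 t, a <= t <= b & K (ev t g)].
Notation path := (path_space g0).
Notation Ev := (@ev R Y Gamma g0).
Variable mu : radon R Y.

Let hY : hausdorff_space Y.
Proof. by have [_ /metrizable_hausdorff] := polishY. Qed.

Lemma compact_measure_unique (m1 m2 : {measure set (borel Y) -> \bar R}) :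
  (forall K : set Y, compact K -> (m1 K < +oo)%E) ->
  (forall K : set Y, compact K -> m1 K = m2 K) ->
  forall B, measurable B -> m1 B = m2 B.
Proof.
move=> fin m12 B mB; have [L [cL _ LT]] := sigma_compact polishY.
have cm : [set K : set (borel Y) | compact (K : set Y)] `<=` measurable.
  by move=> K cK; apply: borel_closed; exact: compact_closed.
apply: (@g_sigma_algebra_measure_unique _ R (borel Y) _ cm L cL LT m1 m2) => //.
- by move=> A A' cA cA'; apply: compact_closedI => //; exact: compact_closed.
- by move=> n; exact: fin.
suff sub : @open Y `<=` <<s [set K : set (borel Y) | compact (K : set Y)] >>.
  by apply: (smallest_sub _ sub) mB; exact: smallest_sigma_algebra.
move=> V oV; rewrite -[V]setCK.
apply: (@measurableC _ (g_sigma_algebraType [set K : set (borel Y) | compact (K : set Y)])).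
rewrite -[X in measurable X]setTI -LT setI_bigcupl.
apply: bigcupT_measurable => n; apply: sub_sigma_algebra.
by apply: compact_closedI => //; exact: open_closedC.
Qed.

(** For [phi] in C_c(Y), phi(g(s)) is in C_c(Gamma) and has the same integral under every [eta_ j]:
    the vague limit cannot lose mass of the marginals. *)
Lemma marginals_of_limit (J : Type) (F : set_system J) (eta_ : J -> radon R path)
    (etab : radon R path) : ProperFilter F ->
  (forall j, has_marginals mu (eta_ j)) -> eta_ j @[j --> F] --> etab ->
  has_marginals mu etab.
Proof.
move=> PF etaM etab_lim s B mB; have [finmu _] := radonP mu; have [fin _] := radonP etab.
have mEv := @measurable_ev _ _ _ g0 Gamma_continuous s.
apply/esym.
have agreeK (K : set Y) : compact K -> mu K = pushforward etab (Ev s : borel path -> borel Y) K.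
  move=> cK; have [phi [chi [phichi chi01 phiK]]] := Cc_approx polishY cK.
  have mK : measurable (K : set (borel Y)) by apply: borel_closed; exact: compact_closed.
  have mEK : measurable ((Ev s : borel path -> borel Y) @^-1` K).
    by rewrite -[X in measurable X]setTI; exact: mEv.
  have cv1 := Cc_integral_cvg finmu mK phichi phiK.
  have cv2 := @Cc_integral_cvg _ path etab
    (fun n => Cc_ev Gamma_continuous Gamma_compact s (phi n))
    (Cc_ev Gamma_continuous Gamma_compact s chi) _ fin mEK
    (fun n g => phichi n (Ev s g)) (fun g => phiK (Ev s g)).
  apply: (cvg_unique (@ereal_hausdorff R) cv1).
  rewrite (_ : (fun n => _) = (fun n => \int[etab]_x
    ((EFin \o Cc_ev Gamma_continuous Gamma_compact s (phi n)) x))%E)//.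
  apply/funext => n; rewrite !vague_evalE; congr EFin.
  have evcv := @vague_eval_continuous R path (Cc_ev Gamma_continuous Gamma_compact s (phi n)) etab.
  have {}evcv := continuous_cvg _ evcv etab_lim.
  suff cst_cv : vague_eval (eta_ j) (Cc_ev Gamma_continuous Gamma_compact s (phi n)) @[j --> F]
      --> vague_eval mu (phi n)
    by exact: (cvg_unique (@Rhausdorff R) cst_cv (evcv _)).
  rewrite (_ : (fun j => _) = cst (vague_eval mu (phi n))); first exact: cvg_cst.
  apply/funext => j; rewrite /vague_eval /Rintegral; congr fine.
  have gphi : ge0_measurable (EFin \o phi n : borel Y -> \bar R).
    by split; [exact: Cc_measurable|move=> y; rewrite lee_fin; have /andP[] := phichi n y].
  exact: (marginal_integral Gamma_continuous s (etaM j) gphi).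
exact: (compact_measure_unique finmu agreeK mB).
Qed.

Lemma mixture_vague (nu : prob_family g0 mu) (xi : radon R path) (Phi : Cc R path) :
  is_mixture nu xi -> (forall g, 0 <= Phi g) -> vague_eval xi Phi = \int[mu]_y fint nu Phi y.
Proof.
move=> nuxi Phi0; rewrite /vague_eval /Rintegral; congr fine.
have := mixture_integral nuxi (Cc_measurable Phi).
move=> ->; last by move=> g; rewrite /= lee_fin.
by apply: eq_integral => y _; rewrite fintE.
Qed.

Lemma exists_mixture (nu : prob_family g0 mu) (t : R) :
  continuous (nu : supp mu -> prob R path) -> concentrated t nu ->
  exists2 etab : radon R path, is_mixture nu etab & disintegration etab t nu.
Proof.
move=> cnu nut.
have [etab etabE] := mixture_radon polishY Gamma_continuous polishGamma Gamma_compact cnu nut.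
have nuB := continuous_borel_family polishY Gamma_continuous Gamma_compact cnu.
have mix : is_mixture nu etab.
  split => // B mB; rewrite etabE//.
  by apply: eq_integral => y _; rewrite massE.
by exists etab.
Qed.

Lemma vague_eval_unique (xi1 xi2 : radon R path) :
  (forall Phi : Cc R path, (forall g, 0 <= Phi g) -> vague_eval xi1 Phi = vague_eval xi2 Phi) ->
  forall A, measurable A -> xi1 A = xi2 A.
Proof.
move=> x12 A mA.
apply: (@cyl_measure_unique _ _ _ _ polishY Gamma_continuous Gamma_compact setT xi1 xi2).
- by exists 0.
- by have [] := radonP xi1.
- by have [] := radonP xi2.
- move=> p l pl; rewrite !vague_evalE x12//.
  by move=> g; exact: Cc_cyl_ge0 pl.
- exact: borel_path_cyl.
Qed.

Variable eta : radon R path.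
Hypothesis eta_marginals : has_marginals mu eta.
Hypothesis eta_regular : markov_regular mu eta.

Lemma rational_ordering : exists (D : set R) (DN : nat -> set R),
  [/\ countable D, dense D, set_ordering D DN & forall N, finite_set (DN N)].
Proof.
have /card_set_bijP[f [_ finj fsurj]] : ([set: nat] #= [set: rat])%card by rewrite card_eq_sym card_rat.
pose q n : R := ratr (f n).
have qI : {in setT &, injective q}.
  by move=> m n mT nT /(fmorph_inj (ratr : {rmorphism rat -> R})) /finj; exact.
exists (range q), (fun N => q @` `I_N); split.
- by apply: sub_countable (countableP [set: nat]); exact: card_image_le.
- move=> O [s Os] oO.
  have /nbhs_ballP[e /= e0 eO] : nbhs s O by apply: open_nbhs_nbhs.
  have se : s < s + e by rewrite ltrDl.
  have [r /[!in_itv]/= /andP[sr re]] := rat_in_itvoo se.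
  exists (ratr r); split.
    by apply: eO; rewrite /ball/= ltr_distlC; apply/andP; split => //; rewrite (lt_trans _ sr)// ltrBlDr ltrDl.
  have [n _ fn] := fsurj r I.
  by exists n => //; rewrite /q fn.
- split.
  + move=> N _; split.
    * by move=> _ [n _ <-]; exists n.
    * by apply: inj_card_eq => m n _ _; apply: qI; rewrite in_setT.
    * by move=> _ [n /= nN <-]; exists n => //=; exact: ltnW.
  + by move=> _ [n _ <-]; exists n.+1 => //; exists n => /=.
- by move=> N; apply: finite_image; exact: finite_II.
Qed.

Lemma hull_nonempty : markov_hull mu eta !=set0.
Proof.
have [D [DN [cD dD ordD finD]]] := rational_ordering.
(* One fixed time is enough to construct the limit; the choice of 0 is arbitrary. *)
have [K [cK KX Kdis]] := @eta_regular _ (@compact_set1 R 0).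
have /choice[en enP] N : exists en : radon R path * prob_family g0 mu,
    [/\ finite_markovianisation mu (DN N) eta en.1, disintegration en.1 0 en.2 & K en.2].
  by have [e [n enP]] := Kdis (DN N) 0 (finD N) erefl; exists (e, n).
pose eta_ N := (en N).1; pose nu_ N := (en N).2.
have nuK N : K (nu_ N) by have [] := enP N.
have nu_dis N : disintegration (eta_ N) 0 (nu_ N) by have [] := enP N.
have eta_fin N : finite_markovianisation mu (DN N) eta (eta_ N) by have [] := enP N.
have eta_marg N : has_marginals mu (eta_ N).
  apply: (markov_version_marginals Gamma_continuous eta_marginals).
  exact: (finite_markovianisation_version polishY Gamma_continuous (eta_fin N)).
have nu_cont N : continuous (nu_ N : supp mu -> prob R path) by have [] := KX _ (nuK N).
have [G [nu [PG FG Knu nu_cvg]]] := compact_subfilter (J := nat) (F := \oo) _ cK nuK.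
have [cnu _] := KX _ Knu.
have t_cvg : (fun=> 0 : R) N @[N --> G] --> (0 : R) by exact: cvg_cst.
have nut := limit_concentrated polishY Gamma_continuous Gamma_compact PG t_cvg nu_cvg nu_dis.
have [etab mix dis] := exists_mixture cnu nut.
have eta_cvg : eta_ N @[N --> G] --> etab.
  apply: vague_cvg_ge0 => Phi Phi0; rewrite (mixture_vague mix Phi0).
  exact: (limit_mixture polishY Gamma_continuous Gamma_compact PG t_cvg nu_cvg eta_marg nu_dis
    nu_cont cnu Phi0).
exists etab, D => //; split; first exact: marginals_of_limit eta_cvg.
exists DN, eta_; split => //.
(* [G] refines the filter of the sequence, so a limit along [G] is a cluster point of the
   sequence. *)
move=> A B etaA etabB.
have GA : G (eta_ @^-1` A) by exact: FG.
have GB : G (eta_ @^-1` B) by exact: eta_cvg.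
have [N [AN BN]] := filter_ex (filterI GA GB).
by exists (eta_ N).
Qed.

Lemma hull_strong_markov (etab : radon R path) :
  markov_hull mu eta etab -> strong_markov mu etab.
Proof.
move=> [D [cD dD] [etabM [DN [etaN [[ordD DsubDN] etaN_fin etaN_cl]]]]].
suff main t : exists nu : prob_family g0 mu, [/\ disintegration etab t nu, Xmu nu &
    forall x : supp mu, is_decoupling t (\val x) (nu x) (nu x)].
  split => t; last exact: main.
  (* A disintegration that is its own decoupling witnesses that markovianisation at [t] fixes
     [etab]. *)
  by have [nu [dis _ dec]] := main t; exists nu, nu; split => //; case: dis.
have [K [cK KX Kdis]] := @eta_regular _ (@segment_compact R (t - 1) (t + 1)).
(* [t] need not belong to [D]: it is approached by times of [DN N], at which the
   [N]-th term of the ordering has the Markov property. *)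
pose J := {p : nat * R | [/\ (0 < p.1)%N, DN p.1 p.2 & `[t - 1, t + 1]%classic p.2]}.
pose t_ (j : J) := (sval j).2; pose eta_ (j : J) := etaN (sval j).1.
have DN_fin N : (0 < N)%N -> finite_set (DN N).
  by move=> N0; have [_ + _] := ordD N N0; exists N.
have vers (j : J) : markov_version (DN (sval j).1) eta (eta_ j).
  apply: (finite_markovianisation_version polishY Gamma_continuous).
  by apply: etaN_fin; case: (svalP j).
(* Regularity disintegrates some markovianisation [etaF] along [DN N]; as it equals [etaN N] on
   Borel sets, the same family disintegrates [etaN N]. *)
have /choice[nu_ nuP] (j : J) : exists nu, disintegration (eta_ j) (t_ j) nu /\ K nu.
  have [N0 DNs Is] := svalP j.
  have [etaF [nu [F1 dis Knu]]] := Kdis _ _ (DN_fin _ N0) Is.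
  exists nu; split => //; apply: disintegration_unique dis.
  exact: (finite_markovianisation_unique polishY Gamma_continuous Gamma_compact F1 (etaN_fin _ N0)).
(* Along [F], [t_ j] tends to [t] and [eta_ j] tends to [etab] simultaneously. *)
pose F : set_system J := [set P | exists (e : R) (O : set (radon R path)),
  [/\ 0 < e, nbhs etab O & forall j, `|t_ j - t| < e -> O (eta_ j) -> P j]].
have FF : Filter F.
  split.
  - by exists 1, setT; split => //; exact: filterT.
  - move=> P Q [e [V [e0 nV VP]]] [e' [V' [e'0 nV' V'Q]]].
    exists (Num.min e e'), (V `&` V'); split.
    + by rewrite lt_min e0.
    + exact: filterI.
    + by move=> j; rewrite lt_min => /andP[je je'] [Vj V'j]; split; [exact: VP|exact: V'Q].
  - by move=> P Q PQ [e [V [e0 nV VP]]]; exists e, V; split => // j je Vj; exact/PQ/VP.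
have mono N M : (0 < N)%N -> (N <= M)%N -> DN N `<=` DN M.
  move=> N0; elim: M => [|M ih]; first by rewrite leqNgt N0.
  rewrite leq_eqVlt => /predU1P[->//|]; rewrite ltnS => NM.
  have [_ _ sub] := ordD M (leq_trans N0 NM).
  exact: subset_trans (ih NM) sub.
have PF : ProperFilter F.
  apply: Build_ProperFilter_ex => P [e [V [e0 nV VP]]].
  (* The bound 1 keeps the approximating time in [t-1, t+1], the interval for which [K] was
     obtained. *)
  pose e1 := Num.min e 1; have e10 : 0 < e1 by rewrite lt_min e0 ltr01.
  have [s [ts Ds]] : interior (ball t e1) `&` D !=set0.
    apply: dD; last exact: open_interior.
    by exists t; exact: (nbhsx_ballx t e1 e10).
  have {}ts : `|t - s| < e1 by exact: interior_subset ts.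
  have [N0 N00 DNs] := DsubDN s Ds.
  (* The time [s] belongs to [DN N] for all N >= N0, and [etab] being a cluster point, some such [N]
     also puts [etaN N] in [V]. *)
  have etail : (etaN @ \oo) (etaN @` [set N | (N0 <= N)%N]).
    by exists N0 => // N /= NN; exists N.
  have [_ [[N /= N0N <-] VN]] := etaN_cl _ _ etail nV.
  have Npos : (0 < N)%N := leq_trans N00 N0N.
  move: ts; rewrite lt_min => /andP[tse ts1].
  have Is : `[t - 1, t + 1]%classic s by rewrite /= in_itv/= -ler_distlC ltW.
  exists (exist _ (N, s) (And3 Npos (mono _ _ N00 N0N _ DNs) Is)); apply: VP => //.
  by rewrite /t_ /= distrC.
have nuK j : K (nu_ j) by have [] := nuP j.
have nu_dis j : disintegration (eta_ j) (t_ j) (nu_ j) by have [] := nuP j.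
have eta_marg j : has_marginals mu (eta_ j).
  exact: (markov_version_marginals Gamma_continuous eta_marginals (vers j)).
have nu_cont j : continuous (nu_ j : supp mu -> prob R path) by have [] := KX _ (nuK j).
have eta_markov j : side <=%R (t_ j) (eta_ j).
  by have [_ /(_ (t_ j))[]] := vers j; first by case: (svalP j).
have [G [nu [PG FG Knu nu_cvg]]] := compact_subfilter PF cK nuK.
have [cnu _] := KX _ Knu.
have t_cvg : t_ j @[j --> G] --> t.
  apply/cvgrPdist_lt => e e0; apply: FG; exists e, setT; split => //; first exact: filterT.
  by move=> j; rewrite distrC.
have eta_cvg : eta_ j @[j --> G] --> etab.
  by move=> O nO; apply: FG; exists 1, O; split.
have nut := limit_concentrated polishY Gamma_continuous Gamma_compact PG t_cvg nu_cvg nu_dis.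
have [xi mix dis] := exists_mixture cnu nut.
(* The mixture [xi] of [nu] and the given [etab] give the same integrals to nonnegative test
   functions, both being limits along [G] of the integrals under [eta_ j]. *)
have xiE : forall A, measurable A -> xi A = etab A.
  apply: vague_eval_unique => Phi Phi0; rewrite (mixture_vague mix Phi0).
  have lim1 := limit_mixture polishY Gamma_continuous Gamma_compact PG t_cvg nu_cvg eta_marg
    nu_dis nu_cont cnu Phi0.
  have lim2 := continuous_cvg _ (@vague_eval_continuous R path Phi etab) eta_cvg.
  exact: (cvg_unique (@Rhausdorff R) lim1 (lim2 _)).
exists nu; split.
- exact: disintegration_unique xiE dis.
- exact: KX.
move=> x; apply: (cyl_decoupling polishY nut) => p l q k pl qk.
exact: (limit_decoupling_fint polishY Gamma_continuous Gamma_compact PG t_cvg nu_cvg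
  nu_dis nu_cont cnu eta_markov x pl qk).
Qed.

End hull.

Theorem theorem1p2 (R : realType) (Y : puniformType) (mu : radon R Y)
    (Gamma : set {family compact, R -> Y}) (g0 : Gamma)
    (polishY : locally_compact_polish R Y)
    (Gamma_continuous : forall g : R -> Y, Gamma g -> continuous g)
    (polishGamma : locally_compact_polish R Gamma)
    (Gamma_compact : forall (a b : R) (K : set Y), compact K ->
       compact [set g : path_space g0 | exists2 t, a <= t <= b & K (ev t g)])
    (Gamma_shift : forall h : R,
       (fun (g : R -> Y) (t : R) => g (t - h)) @` Gamma = Gamma)
    (eta : radon R (path_space g0))
    (eta_marginals : has_marginals mu eta)
    (eta_regular : markov_regular mu eta) :
  markov_hull mu eta !=set0 /\
  (forall etab : radon R (path_space g0),
     markov_hull mu eta etab -> strong_markov mu etab).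
Proof.
split.
  exact: (hull_nonempty polishY Gamma_continuous polishGamma Gamma_compact eta_marginals
    eta_regular).
move=> etab; exact: (hull_strong_markov polishY Gamma_continuous polishGamma Gamma_compact
  eta_marginals eta_regular).
Qed.
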